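(* Let $\mu_1,\mu_2\in\mathfrak{M}^1_+(\Omega)$ with $\mu_1\le\mu_2$, and let $\mu_1^*,\mu_2^*$ be their reduced measures relative to $g$. Then $\mu_1^*\le\mu_2^*$ and $$\mu_2^*-\mu_1^*\le\mu_2-\mu_1.$$
   Context: Throughout: $\Omega\subset\mathbb{R}^N$ ($N\ge1$) is a bounded domain, $T>0$, $Q_T=\Omega\times(0,T)$, $\rho(x)=\operatorname{dist}(x,\partial\Omega)$, and $g:\mathbb{R}\to\mathbb{R}$ is continuous, nondecreasing and vanishes on $(-\infty,0]$. $\mathfrak{M}^1_+(\Omega)$ is the set of positive Radon measures $\mu$ on $\Omega$ with $\int_\Omega\rho\,d\mu<\infty$; $L^1_\rho(Q_T)$ is the set of measurable $f$ with $\iint_{Q_T}|f|\rho<\infty$. $C^{2,1}_{\ell,0}(\overline{Q_T})$ is the space of $C^{2,1}(\overline{Q_T})$ functions vanishing on $\partial\Omega\times[0,T]\cup\overline\Omega\times\{T\}$. For $\nu\in\mathfrak{M}^1_+(\Omega)$, a weak solution of $\partial_tu-\Delta u+g(u)=0$ in $Q_T$, $u=0$ on $\partial\Omega\times(0,T)$, $u(\cdot,0)=\nu$ is a $u\in L^1(Q_T)$ with $g(u)\in L^1_\rho(Q_T)$ and $\iint_{Q_T}(-u\partial_t\zeta-u\Delta\zeta+\zeta g(u))\,dx\,dt=\int_\Omega\zeta(x,0)\,d\nu$ for all $\zeta\in C^{2,1}_{\ell,0}(\overline{Q_T})$; $\nu$ is a good measure if such a solution exists. Reduced measure of $\mu$: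 with any nondecreasing sequence $\{g_k\}$ of continuous nondecreasing functions vanishing on $(-\infty,0]$, $0\le g_k(r)\le c_kr^p+c_k'$ ($r\ge0$, $p\in(1,(N+2)/(N+1))$), $g_k\to g$ pointwise, let $u_k$ be the weak solution with $g_k$ in place of $g$ and initial datum $\mu$; $u_k\to u^*$ in $L^1(Q_T)$, $u^*$ is a weak solution with $g$ and initial datum a positive measure $\mu^*\le\mu$ (the initial trace of $u^*$), called the reduced measure; equivalently $\mu^*$ is the largest good measure below $\mu$. *)

(* Defs.v *)
From HB Require Import structures.
From mathcomp Require Import all_boot all_order all_algebra.
From mathcomp Require Import all_classical all_reals all_analysis.
Set Implicit Arguments. Unset Strict Implicit. Unset Printing Implicit Defensive.
Import Order.TTheory GRing.Theory Num.Theory.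
Import numFieldNormedType.Exports.
Local Open Scope classical_set_scope.
Local Open Scope ring_scope.

(* Points of R^N are row vectors 'rV[R]_N; time is in R.
   Functions on Q_T are written u : 'rV[R]_N -> R -> R  (u x t). *)

Notation BorelRV R n := (g_sigma_algebraType (@open 'rV[R]_n)).

Definition eucl (R : realType) (N : nat) (x y : 'rV[R]_N) : R :=
  Num.sqrt (\sum_(i < N) (x ord0 i - y ord0 i) ^+ 2).

Definition bdry (R : realType) (N : nat) (O : set 'rV[R]_N) : set 'rV[R]_N :=
  closure O `\` O.

Definition rho (R : realType) (N : nat) (O : set 'rV[R]_N) (x : 'rV[R]_N) : R :=
  inf [set d | exists2 y, bdry O y & d = eucl x y].

Definition bounded_domain (R : realType) (N : nat) (O : set 'rV[R]_N) : Prop :=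
  open O /\ connected O /\ O !=set0 /\ bounded_set O.

Fixpoint iint (R : realType) (n : nat) : ('rV[R]_n -> \bar R) -> \bar R :=
  match n return ('rV[R]_n -> \bar R) -> \bar R with
  | 0 => fun F => F 0
  | n'.+1 => fun F =>
      (\int[@lebesgue_measure R]_(s in [set: R])
         iint (fun y : 'rV[R]_n' => F (row_mx (const_mx s : 'rV[R]_1) y)))%E
  end.

(* Lebesgue integral over Q_T = Omega x (0,T) of F, computed as an iterated integral *)
Definition intQ (R : realType) (N : nat) (O : set 'rV[R]_N) (T : R)
    (F : 'rV[R]_N -> R -> \bar R) : \bar R :=
  iint (fun x : 'rV[R]_N =>
    ((\1_O x)%:E * \int[@lebesgue_measure R]_(t in `]0%R, T[%classic) F x t)%E).

Definition jmeas (R : realType) (N : nat) (u : 'rV[R]_N -> R -> R) : Prop :=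
  measurable_fun [set: BorelRV R (N + 1)]
    (fun z : BorelRV R (N + 1) => u (lsubmx z) (rsubmx z ord0 ord0)).

(* positive Radon measure on Omega with int rho dmu < oo : mu in M^1_+(Omega) *)
Definition M1plus (R : realType) (N : nat) (O : set 'rV[R]_N)
    (mu : {measure set (BorelRV R N) -> \bar R}) : Prop :=
  mu (~` O) = 0%E /\
  (forall K : set 'rV[R]_N, compact K -> K `<=` O -> (mu K < +oo)%E) /\
  (\int[mu]_(x in O) (rho O x)%:E < +oo)%E.

Definition unitv {R : realType} {N : nat} (i : 'I_N) : 'rV[R]_N := delta_mx 0 i.

(* zeta in C^{2,1}(closure Q_T), with zt = d_t zeta, zx i = d_{x_i} zeta,
   zxx i j = d_{x_j} d_{x_i} zeta on Q_T, all extending continuously to the closure. *)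
Definition C21 (R : realType) (N : nat) (O : set 'rV[R]_N) (T : R)
    (zeta zt : 'rV[R]_N -> R -> R) (zx : 'I_N -> 'rV[R]_N -> R -> R)
    (zxx : 'I_N -> 'I_N -> 'rV[R]_N -> R -> R) : Prop :=
  (forall x t, O x -> 0 < t < T ->
     is_derive t 1 (zeta x) (zt x t) /\
     forall i, is_derive x (unitv i) (fun y => zeta y t) (zx i x t) /\
       forall j, is_derive x (unitv j) (fun y => zx i y t) (zxx i j x t)) /\
  let Qc := closure O `*` `[0, T] in
  {within Qc, continuous (fun z : 'rV[R]_N * R => zeta z.1 z.2)} /\
  {within Qc, continuous (fun z : 'rV[R]_N * R => zt z.1 z.2)} /\
  (forall i, {within Qc, continuous (fun z : 'rV[R]_N * R => zx i z.1 z.2)}) /\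
  (forall i j, {within Qc, continuous (fun z : 'rV[R]_N * R => zxx i j z.1 z.2)}).

Definition vanish_l0 (R : realType) (N : nat) (O : set 'rV[R]_N) (T : R)
    (zeta : 'rV[R]_N -> R -> R) : Prop :=
  (forall x t, bdry O x -> 0 <= t <= T -> zeta x t = 0) /\
  (forall x, closure O x -> zeta x T = 0).

Definition admissible (R : realType) (g : R -> R) : Prop :=
  continuous g /\ {homo g : a b / a <= b} /\ (forall r, r <= 0 -> g r = 0).

(* weak solution of  u_t - Delta u + g(u) = 0 in Q_T, u = 0 on lateral boundary,
   u(.,0) = nu *)
Definition weak_sol (R : realType) (N : nat) (O : set 'rV[R]_N) (T : R)
    (g : R -> R) (nu : {measure set (BorelRV R N) -> \bar R})
    (u : 'rV[R]_N -> R -> R) : Prop :=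
  jmeas u /\
  (intQ O T (fun x t => `|u x t|%:E) < +oo)%E /\
  (intQ O T (fun x t => (`|g (u x t)| * rho O x)%:E) < +oo)%E /\
  forall zeta zt zx zxx, C21 O T zeta zt zx zxx -> vanish_l0 O T zeta ->
    intQ O T (fun x t => (- u x t * zt x t - u x t * (\sum_(i < N) zxx i i x t)
                          + zeta x t * g (u x t))%:E)
    = (\int[nu]_(x in O) (zeta x 0)%:E)%E.

Definition reduced_measure (R : realType) (N : nat) (O : set 'rV[R]_N) (T : R)
    (g : R -> R) (mu mus : {measure set (BorelRV R N) -> \bar R}) : Prop :=
  M1plus O mus /\
  exists (gk : nat -> R -> R) (p : R) (uk : nat -> 'rV[R]_N -> R -> R)
         (us : 'rV[R]_N -> R -> R),
    1 < p < (N.+2)%:R / (N.+1)%:R /\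
    (forall k, admissible (gk k)) /\
    (forall k, exists c c' : R, forall r, 0 <= r ->
        0 <= gk k r <= c * r `^ p + c') /\
    (forall k r, gk k r <= gk k.+1 r) /\
    (forall r, (fun k => gk k r) @ \oo --> g r) /\
    (forall k, weak_sol O T (gk k) mu (uk k)) /\
    ((fun k => intQ O T (fun x t => `|uk k x t - us x t|%:E)) @ \oo --> 0%E) /\
    weak_sol O T g mus us.

(* Main.v *)
(** The proof is local near the initial time: only test functions compactly supported in
    [O * (-oo, T)] are used, so no boundary regularity, comparison principle or existence
    theory is needed.

    Let [u_k], [v_j] be the approximations attached to [mu1], [mu2], with limits [u], [v].
    Kato's inequality for [(u_k - v_j)^+] (proved by mollification and difference quotients,
    in which only convexity and translation invariance of the Lebesgue measure enter),
    together with the equation for [v_j - u_k] and Fatou's lemma as [j -> oo] and then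
    [k -> oo], gives for every test function [f >= 0]
      [\int (v - u)^+ (- d_t - Delta) f <= \int f(., 0) d(mu2 - mu1)].
    Likewise [\int (u - v_j)^+ (- d_t - Delta) f <= 0], since the initial datum [mu1s] of [u]
    is at most [mu1], again by Fatou's lemma.  Taking for [f] a function of [x] times a
    decreasing function of [t] concentrated at [t = 0], the terms without time derivative
    vanish in the limit and the initial traces remain: both conclusions hold against smooth
    functions of [x], hence for all Borel sets. *)

Require Import Defs.
From HB Require Import structures.
From mathcomp Require Import all_boot all_order all_algebra.
From mathcomp Require Import all_classical all_reals all_analysis.
From mathcomp Require Import measurable_realfun ring lra.
Import Order.TTheory GRing.Theory Num.Theory.
Import numFieldNormedType.Exports.
Local Open Scope classical_set_scope.
Local Open Scope ring_scope.
Set Implicit Arguments.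
Unset Strict Implicit.
Unset Printing Implicit Defensive.

(** The nonlinearities attached to the two measures are chosen independently, so [u_k] and [v_j]
    cannot be compared at equal index; sending [j] to infinity first leaves [g_k <= g = lim h_j],
    which gives the reaction terms the right sign in the limit. All solutions are extended by zero
    to times [t <= 0], so that the initial datum becomes a source carried by [t = 0]. For ordered
    data this source has a sign in the equation of [u_k - v_j]; that difference is then a
    subsolution across [t = 0], and Kato's inequality requires no analysis of initial values. For
    the opposite difference the sign is wrong, whence the detour through
    [(v - u)^+ = (u - v)^+ - (u - v)]. Fatou's lemma takes the form of dominated convergence for the
    positive part of a defect of reactions, bounded by the reaction of a fixed solution. In the last
    step the time derivative of the concentrating functions blows up and is controlled only from
    below for [t > 0]; this is why bounds on positive parts are what yields the traces. *)

Local Notation borel_fun f := (measurable_fun [set: BorelRV _ _] (f : BorelRV _ _ -> _)).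

(** * Borel structure and Lebesgue measure on row vectors *)

Section BorelMeasurability.
Context {R : realType}.

Lemma open_measurable_rV n (U : set 'rV[R]_n) :
  open U -> measurable (U : set (BorelRV R n)).
Proof. exact: sub_sigma_algebra. Qed.

Lemma continuous_measurable_rV n (f : 'rV[R]_n -> R) :
  continuous f -> borel_fun f.
Proof.
move=> cf; apply: (measurability _ (RGenOInfty.measurableE R)) => _ [_ [x ->] <-].
rewrite setTI; apply: open_measurable_rV; move/continuousP : cf; apply.
exact: interval_open.
Qed.

Lemma coord_measurable n (i : 'I_n) :
  measurable_fun [set: BorelRV R n] (fun z : BorelRV R n => z ord0 i).
Proof.
apply: (@continuous_measurable_rV n (fun z => z ord0 i)); exact: coord_continuous.
Qed.

Lemma ball_rV n (q z : 'rV[R]_n) (r : R) : 0 < r ->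
  ball q r z <-> forall i, `|q ord0 i - z ord0 i| < r.
Proof.
move=> r0; split; first by move=> [_ h] i; exact: h.
by move=> h; split => // i j; rewrite (ord1 i); exact: h.
Qed.

Lemma ratr_approx n (z : 'rV[R]_n) (r : R) : 0 < r ->
  exists q : 'rV[rat]_n, forall i, `|z ord0 i - ratr (q ord0 i)| < r.
Proof.
move=> r0.
have H (i : 'I_n) : exists q : rat, `|z ord0 i - ratr q| < r.
  have [|q] := @rat_in_itvoo R (z ord0 i - r) (z ord0 i + r); first lra.
  by rewrite in_itv/= => /andP[h1 h2]; exists q; rewrite ltr_norml; apply/andP; split; lra.
have [f Hf] := choice H.
by exists (\row_i f i) => i; rewrite mxE.
Qed.

(** Balls of row vectors are cubes, so every open set is a countable union of cubes with rational
    centre and radius; the preimage of such a cube is a finite intersection of coordinate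
    preimages. *)
Lemma measurable_fun_rV d (T : measurableType d) n (f : T -> BorelRV R n) :
  (forall i, measurable_fun [set: T] (fun x => f x ord0 i)) ->
  measurable_fun [set: T] f.
Proof.
move=> mf; apply: (measurability (@open 'rV[R]_n : set (set (BorelRV R n)))) => //.
move=> _ [U oU <-]; rewrite setTI.
pose B (p : 'rV[rat]_n * rat) : set T :=
  if `[< 0 < (ratr p.2 : R) /\ ball (map_mx ratr p.1 : 'rV[R]_n) (ratr p.2) `<=` U >]
  then f @^-1` (ball (map_mx ratr p.1 : 'rV[R]_n) (ratr p.2)) else set0.
have -> : f @^-1` U = \bigcup_(p : 'rV[rat]_n * rat) B p.
  apply/seteqP; split => x /=; last first.
    by move=> [p _]; rewrite /B; case: asboolP => // -[_ h]; exact: h.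
  move=> Ufx; have /nbhs_ballP[e /= e0 he] : nbhs (f x : 'rV[R]_n) U.
    exact: open_nbhs_nbhs.
  (* Since [2 * r < e], a cube of radius [r] whose centre is within [r] of [f x] stays inside
     [ball (f x) e]. *)
  have [|r] := @rat_in_itvoo R 0 (e / 2); first lra.
  rewrite in_itv/= => /andP[r0 re].
  have [q hq] := ratr_approx (f x : 'rV[R]_n) r0.
  exists (q, r) => //; rewrite /B /=; case: asboolP.
    move=> _ /=; apply/(ball_rV _ _ r0) => i; rewrite mxE distrC; exact: hq.
  case; split => // z /(ball_rV _ _ r0) hz.
  apply: he; apply/(ball_rV _ _ e0) => i.
  have := hz i; rewrite mxE => hzi; have hqi := hq i.
  have := ler_distD (ratr (q ord0 i)) (f x ord0 i) (z ord0 i); lra.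
apply: countable_bigcupT_measurable; [exact: countableP|move=> p].
rewrite /B; case: asboolP => // -[r0 _].
have -> : f @^-1` ball (map_mx ratr p.1 : 'rV[R]_n) (ratr p.2) =
   \bigcap_(i in [set: 'I_n]) ((fun x => f x ord0 i) @^-1`
      (ball (ratr (p.1 ord0 i) : R) (ratr p.2))).
  apply/seteqP; split => x /=.
    by move/(ball_rV _ _ r0) => h i _ /=; rewrite -ball_normE /= ; have := h i; rewrite mxE.
  move=> h; apply/(ball_rV _ _ r0) => i; rewrite mxE.
  by have := h i I; rewrite /= -ball_normE.
apply: fin_bigcap_measurable; first exact: finite_finset.
move=> i _; rewrite -[X in measurable X]setTI; apply: mf => //.
exact: measurable_ball.
Qed.

End BorelMeasurability.

Section WithSigmaFinite.
Context d (Y : measurableType d) (R : realType) (nu : {measure set Y -> \bar R}).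
Hypothesis snu : sigma_finite setT nu.

(** A copy of [nu] that takes the proof of sigma-finiteness as an argument, so that the sigma-finite
    structure can be declared on it as an instance. *)
Definition with_sigma_finite of sigma_finite setT nu : set Y -> \bar R := nu.

HB.instance Definition _ := Measure.on (with_sigma_finite snu).
HB.instance Definition _ :=
  Measure_isSigmaFinite.Build _ _ _ (with_sigma_finite snu) snu.

End WithSigmaFinite.

(** * Push-forwards, translations and products of measures *)

Section ProductTransport.
Context {R : realType}.
Local Open Scope ereal_scope.

Lemma pushforward_sigma_finite d d' (X : measurableType d) (Y : measurableType d')
    (mu : {measure set X -> \bar R}) (phi : X -> Y) (F : nat -> set Y) :
  measurable_fun setT phi -> \bigcup_i F i = setT ->
  (forall i, measurable (F i) /\ mu (phi @^-1` F i) < +oo) ->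
  exists M : {sigma_finite_measure set Y -> \bar R},
    forall f : Y -> \bar R, measurable_fun setT f -> (forall y, 0 <= f y) ->
      \int[M]_y f y = \int[mu]_x f (phi x).
Proof.
move=> mphi FT mF.
pose nu_of : {measure set Y -> \bar R} := pushforward mu phi.
pose nu := nu_of mphi.
have snu : sigma_finite setT nu by exists F.
pose M : {sigma_finite_measure set Y -> \bar R} := with_sigma_finite snu.
exists M => f mf f0; rewrite /M /= /with_sigma_finite /nu /nu_of /=.
by rewrite -[RHS](@ge0_integral_pushforward _ _ _ _ _ _ mphi mu setT f).
Qed.

Lemma integral_transport d d' (X : measurableType d) (Y : measurableType d')
    (mu : {measure set X -> \bar R}) (M : {measure set Y -> \bar R})
    (phi : X -> Y) :
  measurable_fun setT phi ->
  (forall f : Y -> \bar R, measurable_fun setT f -> (forall y, 0 <= f y) ->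
      \int[M]_y f y = \int[mu]_x f (phi x)) ->
  forall f : Y -> \bar R, M.-integrable setT f ->
    mu.-integrable setT (f \o phi) /\ \int[M]_y f y = \int[mu]_x f (phi x).
Proof.
move=> mphi H f /[dup] fi /integrableP[mf foo]; split.
  apply/integrableP; split; first exact: measurableT_comp.
  rewrite -(H (fun y => `|f y|))//; exact: measurableT_comp.
rewrite [LHS]integralE [RHS]integralE; congr (_ - _).
  rewrite (H f^\+)//; last exact: measurable_funepos.
  by under [RHS]eq_integral do rewrite (funepos_comp f phi)/=.
rewrite (H f^\-)//; last exact: measurable_funeneg.
by under [RHS]eq_integral do rewrite (funeneg_comp f phi)/=.
Qed.

(** Invariance is phrased with integrals of nonnegative functions, the form in which Tonelli's
    theorem hands it over to products. *)
Definition preserves d (X : measurableType d) (mu : {measure set X -> \bar R})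
    (s : X -> X) :=
  measurable_fun setT s /\
  forall f : X -> \bar R, measurable_fun setT f -> (forall x, 0 <= f x) ->
    \int[mu]_x f (s x) = \int[mu]_x f x.

Lemma preserves_prod d d' (X : measurableType d) (Y : measurableType d')
    (m1 : {sigma_finite_measure set X -> \bar R})
    (m2 : {sigma_finite_measure set Y -> \bar R}) s1 s2 :
  preserves m1 s1 -> preserves m2 s2 ->
  preserves (m1 \x m2)%E (fun p => (s1 p.1, s2 p.2)).
Proof.
move=> [ms1 H1] [ms2 H2]; split.
  by apply: measurable_fun_pair; apply: measurableT_comp.
move=> f mf f0.
have mfs : measurable_fun setT (fun p : X * Y => f (s1 p.1, s2 p.2)).
  apply: measurableT_comp => //.
  by apply: measurable_fun_pair; apply: measurableT_comp.
rewrite fubini_tonelli1// fubini_tonelli1// /fubini_F /=.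
transitivity (\int[m1]_x \int[m2]_y f (s1 x, y)).
  apply: eq_integral => x _; apply: (H2 (fun y => f (s1 x, y))) => //.
  exact: measurableT_comp.
apply: (H1 (fun x => \int[m2]_y f (x, y))).
  exact: (measurable_fun_fubini_tonelli_F f).
by move=> x; exact: integral_ge0.
Qed.

(** The push-forward under the shift still gives each half-open interval its length, and this
    determines Lebesgue measure. *)
Lemma lebesgue_preserves_shift (a : R) :
  preserves (@lebesgue_measure R) (fun s : measurableTypeR R => (s + a)%R).
Proof.
have ms : measurable_fun setT
    (fun s : measurableTypeR R => (s + a)%R : measurableTypeR R).
  exact: measurable_funD.
split => // f mf f0.
rewrite -[LHS](@ge0_integral_pushforward _ _ _ _ _ _ ms lebesgue_measure setT f)//.
pose nu_of : {measure set (measurableTypeR R) -> \bar R} :=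
  pushforward lebesgue_measure
    (fun s : measurableTypeR R => (s + a)%R : measurableTypeR R).
symmetry; apply: (@eq_measure_integral _ _ _ setT (nu_of ms)) => A mA _.
apply: (@lebesgue_measure_unique R (nu_of ms)) => // _ [[u v] _ <-].
rewrite /= /pushforward.
have -> : (fun s : R => (s + a)%R) @^-1` [set` `]u, v]] = [set` `](u - a)%R, (v - a)%R]].
  by apply/seteqP; split => x /=; rewrite !in_itv/= ltrBlDr lerBrDr.
rewrite !lebesgue_measure_itv/= !lte_fin ltrD2r; case: ifP => // _.
by rewrite -EFinB; congr (_%:E); ring.
Qed.

End ProductTransport.

(** * Translation-invariant measures on row vectors *)

Section NiceMeasure.
Context {R : realType}.

Definition cube {n} (r : R) : set 'rV[R]_n := [set z | forall i, `|z ord0 i| < r].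

(** The two features of Lebesgue measure on which the analysis rests: cubes have positive finite
    mass, and translations preserve integrals. *)
Definition nice n (M : {sigma_finite_measure set (BorelRV R n) -> \bar R}) :=
  (forall r, 0 < r -> (0 < M (cube r))%E /\ (M (cube r) < +oo)%E) /\
  forall a : 'rV[R]_n, preserves M (fun z : BorelRV R n => (z : 'rV[R]_n) + a).

Lemma measurable_cube n (r : R) : measurable (cube r : set (BorelRV R n)).
Proof.
have -> : cube r = \bigcap_(i in [set: 'I_n])
    ((fun z : BorelRV R n => z ord0 i) @^-1` `]- r, r[).
  apply/seteqP; split => z /= h i; first by move=> _; rewrite /= in_itv/= -ltr_norml.
  by have := h i I; rewrite /= in_itv/= -ltr_norml.
apply: fin_bigcap_measurable; first exact: finite_finset.
by move=> i _; rewrite -[X in measurable X]setTI; apply: coord_measurable.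
Qed.

Lemma measurable_rshift n (a : 'rV[R]_n) :
  measurable_fun setT (fun z : BorelRV R n => ((z : 'rV[R]_n) + a : BorelRV R n)).
Proof.
apply: measurable_fun_rV => i; under eq_fun do rewrite mxE.
by apply: measurable_funD => //; exact: coord_measurable.
Qed.

Lemma cube_cover n : \bigcup_(k : nat) cube k.+1%:R = [set: 'rV[R]_n].
Proof.
apply/seteqP; split => // z _.
exists (Num.bound `|z|) => // i.
have : ball (0 : 'rV[R]_n) (Num.bound `|z|).+1%:R z.
  rewrite -ball_normE /= sub0r normrN.
  apply: (@lt_le_trans _ _ (Num.bound `|z|)%:R); first exact: archi_boundP.
  by rewrite ler_nat.
by move/(ball_rV _ _ (ltr0Sn _ _)) => /(_ i); rewrite mxE sub0r normrN.
Qed.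

(** Used twice: to put one more space coordinate in front, as [iint] does, and to append the time
    coordinate, as [intQ] does. Both properties of [nice] are read off the product because [phi]
    turns cubes into products and translations into pairs of translations. *)
Lemma nice_prod d d' (X : measurableType d) (Y : measurableType d') n
    (m1 : {sigma_finite_measure set X -> \bar R})
    (m2 : {sigma_finite_measure set Y -> \bar R})
    (phi : X * Y -> BorelRV R n)
    (C1 : R -> set X) (C2 : R -> set Y)
    (s1 : 'rV[R]_n -> X -> X) (s2 : 'rV[R]_n -> Y -> Y) :
  measurable_fun setT phi ->
  (forall r, phi @^-1` cube r = C1 r `*` C2 r) ->
  (forall r, 0 < r ->
     [/\ measurable (C1 r), (0 < m1 (C1 r))%E & (m1 (C1 r) < +oo)%E]) ->
  (forall r, 0 < r ->
     [/\ measurable (C2 r), (0 < m2 (C2 r))%E & (m2 (C2 r) < +oo)%E]) ->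
  (forall a, preserves m1 (s1 a)) -> (forall a, preserves m2 (s2 a)) ->
  (forall a x y, (phi (x, y) : 'rV[R]_n) + a = phi (s1 a x, s2 a y)) ->
  exists M : {sigma_finite_measure set (BorelRV R n) -> \bar R},
    nice M /\
    (forall f : BorelRV R n -> \bar R, measurable_fun setT f ->
      (forall z, (0 <= f z)%E) ->
      (\int[M]_z f z = \int[m1 \x m2]_p f (phi p))%E).
Proof.
move=> mphi phiC C1P C2P P1 P2 phiD.
have phi_cube r : 0 < r -> (0 < (m1 \x m2) (phi @^-1` cube r))%E /\
    ((m1 \x m2) (phi @^-1` cube r) < +oo)%E.
  move=> r0; have [mC1 a1 b1] := C1P _ r0; have [mC2 a2 b2] := C2P _ r0.
  rewrite phiC product_measure1E//; split; first exact: mule_gt0.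
  by apply: lte_mul_pinfty => //; rewrite ge0_fin_numE.
have [|M MH] := @pushforward_sigma_finite _ _ _ _ _ (m1 \x m2)%E phi
    (fun k => cube k.+1%:R) mphi (cube_cover n).
  by move=> i; split; [exact: measurable_cube|have [] := phi_cube i.+1%:R (ltr0Sn _ _)].
exists M; split; last by move=> f mf f0; exact: MH.
split.
  move=> r r0; suff -> : M (cube r) = (m1 \x m2)%E (phi @^-1` cube r) by exact: phi_cube.
  have mc := @measurable_cube n r.
  have mphic : measurable (phi @^-1` cube r).
    by rewrite -[X in measurable X]setTI; exact: mphi.
  rewrite -[cube r in LHS]setIT -integral_indic// MH//=; last first.
    by apply/measurable_EFinP; apply: measurable_indic.
  transitivity (\int[m1 \x m2]_p (\1_(phi @^-1` cube r) p)%:E)%E.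
    by apply: eq_integral => p _; rewrite !indicE.
  by rewrite integral_indic ?setIT.
move=> a; split; first exact: measurable_rshift.
move=> f mf f0.
have mfa : measurable_fun setT (fun z : BorelRV R n => f ((z : 'rV[R]_n) + a)).
  exact: (measurableT_comp mf (measurable_rshift a)).
rewrite (MH _ mfa)// MH//.
have [_ H] := preserves_prod (P1 a) (P2 a).
have mfphi : measurable_fun setT (f \o phi) by exact: measurableT_comp.
rewrite -[RHS](H (f \o phi))//; last by move=> x; exact: f0.
by apply: eq_integral => -[x y] _; rewrite phiD.
Qed.

End NiceMeasure.

(** * Iterated integrals as integrals against a single measure *)

Section IteratedIntegral.
Context {R : realType}.

Lemma measurable_integral_param d d' (P : measurableType d) (Y : measurableType d')
    (m : {sigma_finite_measure set Y -> \bar R}) (K : P * Y -> \bar R) :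
  measurable_fun setT K -> measurable_fun setT (fun p => \int[m]_y K (p, y))%E.
Proof.
move=> mK.
have -> : (fun p => \int[m]_y K (p, y))%E =
    (fun p => \int[m]_y (K^\+) (p, y) - \int[m]_y (K^\-) (p, y))%E.
  apply/funext => p; rewrite integralE.
  under eq_integral do rewrite (funepos_comp K (fun y => (p, y)))/=.
  by under [X in (_ - X)%E = _]eq_integral do rewrite (funeneg_comp K (fun y => (p, y)))/=.
apply: emeasurable_funB.
  by apply: (measurable_fun_fubini_tonelli_F (K^\+)%E) => //; exact: measurable_funepos.
by apply: (measurable_fun_fubini_tonelli_F (K^\-)%E) => //; exact: measurable_funeneg.
Qed.

Lemma measurable_row_mx d (T : measurableType d) a b
    (f : T -> BorelRV R a) (g : T -> BorelRV R b) :
  measurable_fun setT f -> measurable_fun setT g ->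
  measurable_fun setT (fun x => row_mx (f x : 'rV[R]_a) (g x) : BorelRV R (a + b)).
Proof.
move=> mf mg; apply: measurable_fun_rV => i.
case: (split_ordP i) => j ->.
  under eq_fun do rewrite row_mxEl.
  exact: (measurableT_comp (coord_measurable j) mf).
under eq_fun do rewrite row_mxEr.
exact: (measurableT_comp (coord_measurable j) mg).
Qed.

Lemma measurable_const_mx d (T : measurableType d) n (f : T -> R) :
  measurable_fun setT f ->
  measurable_fun setT (fun x => const_mx (f x) : BorelRV R n).
Proof.
by move=> mf; apply: measurable_fun_rV => i; under eq_fun do rewrite mxE.
Qed.

Lemma measurable_lsubmx a b :
  measurable_fun setT (fun z : BorelRV R (a + b) => lsubmx (z : 'rV[R]_(a + b)) : BorelRV R a).
Proof.
by apply: measurable_fun_rV => i; under eq_fun do rewrite mxE; exact: coord_measurable.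
Qed.

(** The parameter space is arbitrary so that the induction on [n] can move the coordinate integrated
    last into it. *)
Lemma measurable_iint_param d (P : measurableType d) n
    (F : P * BorelRV R n -> \bar R) :
  measurable_fun setT F -> measurable_fun setT (fun p => iint (fun y => F (p, y))).
Proof.
elim: n d P F => [|n IH] d P F mF /=.
  by apply: (measurableT_comp mF); exact: measurable_fun_pair.
pose F' (q : (P * measurableTypeR R) * BorelRV R n) : \bar R :=
  F (q.1.1, row_mx (const_mx q.1.2 : 'rV[R]_1) q.2).
have mF' : measurable_fun setT F'.
  apply: (measurableT_comp mF); apply: measurable_fun_pair.
    exact: (measurableT_comp measurable_fst measurable_fst).
  apply: (@measurable_row_mx _ _ 1 n) => //.
  by apply: measurable_const_mx; exact: (measurableT_comp measurable_snd measurable_fst).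
exact: (measurable_integral_param lebesgue_measure (IH _ _ _ mF')).
Qed.

Lemma lebesgue_itv_fin (r : R) : 0 < r ->
  [/\ measurable (`]- r, r[%classic : set (measurableTypeR R)),
      (0 < lebesgue_measure (`](- r)%R, r[%classic : set R))%E &
      (lebesgue_measure (`](- r)%R, r[%classic : set R) < +oo)%E].
Proof.
move=> r0; have rr : - r < r by lra.
split => //; rewrite lebesgue_measure_itv/= lte_fin rr.
- by rewrite -EFinB lte_fin; lra.
- by rewrite -EFinB ltry.
Qed.

(** The two alternatives on [F] are those of Tonelli and Fubini. An iterated integral is linear only
    on well-behaved functions; replacing it by integration against [m] makes the usual integration
    theory available. *)
Lemma nice_iint_exists n :
  exists m : {sigma_finite_measure set (BorelRV R n) -> \bar R}, nice m /\
    forall F : BorelRV R n -> \bar R, measurable_fun setT F ->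
      (forall z, (0 <= F z)%E) \/ m.-integrable setT F ->
      iint F = (\int[m]_z F z)%E.
Proof.
elim: n => [|n [m [m_nice mE]]].
  have r0 (z : 'rV[R]_0) : z = 0 by apply/rowP => -[].
  (* Row vectors of length 0 form a single point, where [iint] evaluates its argument. *)
  exists (\d_(0 : BorelRV R 0)); split; last first.
    by move=> F mF _ /=; rewrite integral_dirac// diracE in_setT mul1e.
  split.
    by move=> r _; rewrite /= diracE mem_set ?lte01 ?ltry// => -[].
  move=> a; split; first exact: measurable_rshift.
  by move=> f mf f0; apply: eq_integral => x _; rewrite (r0 (_ + _)) (r0 x).
pose phi (p : measurableTypeR R * BorelRV R n) : BorelRV R n.+1 :=
  row_mx (const_mx p.1 : 'rV[R]_1) (p.2 : 'rV[R]_n).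
have mphi : measurable_fun setT phi.
  by apply: (@measurable_row_mx _ _ 1 n) => //; apply: measurable_const_mx.
have [|||||||M [M_nice ME]] := @nice_prod R _ _ _ _ n.+1 lebesgue_measure m phi
  (fun r => `]- r, r[%classic) (fun r => cube r)
  (fun a s => s + (a : 'rV[R]_(1 + n)) ord0 (lshift n (ord0 : 'I_1)))
  (fun a y => (y : 'rV[R]_n) + rsubmx (a : 'rV[R]_(1 + n))).
- exact: mphi.
- move=> r; apply/seteqP; split => -[s y] /=.
    move=> H; split => /=.
      have := H (lshift n (ord0 : 'I_1)); rewrite /phi /= (@row_mxEl _ _ 1 n) mxE.
      by rewrite in_itv/= -ltr_norml.
    by move=> i; have := H (rshift 1 i); rewrite /phi /= (@row_mxEr _ _ 1 n).
  move=> [/=]; rewrite in_itv/= -ltr_norml => Hs Hy i.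
  rewrite /phi; case: (@split_ordP 1 n i) => j ->.
    by rewrite (@row_mxEl _ _ 1 n) mxE.
  by rewrite (@row_mxEr _ _ 1 n).
- exact: lebesgue_itv_fin.
- move=> r r0; split; first exact: measurable_cube.
  + by have [] := m_nice.1 r r0.
  + by have [] := m_nice.1 r r0.
- by move=> a; exact: lebesgue_preserves_shift.
- by move=> a; exact: m_nice.2.
- move=> a s y; apply/rowP => i; rewrite mxE /phi.
  case: (@split_ordP 1 n i) => j ->.
    by rewrite !(@row_mxEl _ _ 1 n) !mxE (ord1 j).
  by rewrite !(@row_mxEr _ _ 1 n) !mxE.
exists M; split=> // F mF.
have mFphi : measurable_fun setT (F \o phi) by exact: measurableT_comp.
have mFs (s : R) : measurable_fun setT (fun y : BorelRV R n => F (phi (s, y))).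
  exact: (measurableT_comp mFphi (measurable_pair1 s)).
move=> [F0|iF] /=.
  rewrite ME// (fubini_tonelli1 (F \o phi))//; last by move=> ?; exact: F0.
  apply: eq_integral => s _; rewrite /fubini_F /=.
  by rewrite -(mE (fun y => F (phi (s, y))))//; left.
have [iFphi ->] := integral_transport mphi ME iF.
rewrite -[RHS](integral12_prod_meas1 iFphi).
apply: ae_eq_integral => //.
- exact: (measurable_iint_param mFphi).
- exact: measurable_fubini_F iFphi.
(* Slices of an integrable function are integrable only almost everywhere, so the induction
   hypothesis is applied only at such [s]. *)
apply: filterS (ae_integrable1 iFphi) => s /= iFs _.
by rewrite /fubini_F -(mE (fun y => F (phi (s, y))))//; right.
Qed.

(** One measure serves every [O] and [T]: since [F] vanishes outside the space-time region, the
    indicator of [O] and the bounds on [t] in [intQ] may be dropped. *)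
Lemma nice_intQ_exists N :
  exists M : {sigma_finite_measure set (BorelRV R (N + 1)) -> \bar R}, nice M /\
    forall (O : set 'rV[R]_N) (T : R) (F : BorelRV R (N + 1) -> \bar R),
      measurable (O : set (BorelRV R N)) -> measurable_fun setT F ->
      (forall z, ~ (O (lsubmx (z : 'rV[R]_(N + 1))) /\
                    0 < z ord0 (rshift N ord0) < T) -> F z = 0%E) ->
      (forall z, (0 <= F z)%E) \/ M.-integrable setT F ->
      intQ O T (fun x t => F (row_mx x (const_mx t))) = (\int[M]_z F z)%E.
Proof.
have [m [m_nice mE]] := nice_iint_exists N.
pose phi (p : BorelRV R N * measurableTypeR R) : BorelRV R (N + 1) :=
  row_mx (p.1 : 'rV[R]_N) (const_mx p.2 : 'rV[R]_1).
have mphi : measurable_fun setT phi.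
  by apply: measurable_row_mx => //; apply: measurable_const_mx.
have [|||||||M [M_nice ME]] := @nice_prod R _ _ _ _ (N + 1)%N m lebesgue_measure phi
  (fun r => cube r) (fun r => `]- r, r[%classic)
  (fun a y => (y : 'rV[R]_N) + lsubmx a)
  (fun a s => s + a ord0 (rshift N ord0)).
- exact: mphi.
- move=> r; apply/seteqP; split => -[y s] /=.
    move=> H; split => /=.
      by move=> i; have := H (lshift 1 i); rewrite /phi /= row_mxEl.
    have := H (rshift N ord0); rewrite /phi /= row_mxEr mxE.
    by rewrite in_itv/= -ltr_norml.
  move=> [/=]; rewrite in_itv/= -ltr_norml => Hy Hs i.
  rewrite /phi; case: (split_ordP i) => j ->.
    by rewrite row_mxEl.
  by rewrite row_mxEr mxE.
- move=> r r0; split; first exact: measurable_cube.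
  + by have [] := m_nice.1 r r0.
  + by have [] := m_nice.1 r r0.
- exact: lebesgue_itv_fin.
- by move=> a; exact: m_nice.2.
- by move=> a; exact: lebesgue_preserves_shift.
- move=> a y s; apply/rowP => i; rewrite mxE /phi.
  case: (split_ordP i) => j ->.
    by rewrite !row_mxEl !mxE.
  by rewrite !row_mxEr !mxE (ord1 j).
exists M; split=> // O T F mO mF F0 FP.
have mFphi : measurable_fun setT (F \o phi) by exact: measurableT_comp.
have mFs (y : BorelRV R N) : measurable_fun setT (fun t : measurableTypeR R => F (phi (y, t))).
  exact: (measurableT_comp mFphi (measurable_pair1 y)).
have inner (y : 'rV[R]_N) : ((\1_O y)%:E * \int[lebesgue_measure]_(t in `]0%R, T[%classic)
    F (row_mx y (const_mx t)) = \int[lebesgue_measure]_t F (phi (y, t)))%E.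
  have [yO|yO] := pselect (O y); last first.
    rewrite indicE memNset// mul0e [RHS]integral0_eq// => t _.
    by apply: F0; rewrite /phi row_mxKl => -[].
  rewrite indicE mem_set// mul1e [LHS]integral_mkcond.
  apply: eq_integral => t _; rewrite /patch; case: ifPn => // tT.
  apply/esym; apply: F0; rewrite /phi row_mxKl row_mxEr mxE => -[_ h].
  by move/negP : tT; apply; rewrite inE /= in_itv.
rewrite /intQ; under eq_fun do rewrite inner.
case: FP => [Fge|iF].
  rewrite ME// (fubini_tonelli1 (F \o phi))//; last by move=> ?; exact: Fge.
  apply: mE; last by left => z; apply: integral_ge0.
  exact: (measurable_integral_param lebesgue_measure mFphi).
have [iFphi ->] := integral_transport mphi ME iF.
rewrite -[RHS](integral12_prod_meas1 iFphi).
apply: mE; first exact: (measurable_integral_param lebesgue_measure mFphi).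
by right; exact: integrable_fubini_F iFphi.
Qed.

End IteratedIntegral.

(** * Real-valued integrals *)

Section RealIntegral.
Context d (T : measurableType d) {R : realType} (mu : {measure set T -> \bar R}).
Implicit Types f g h : T -> R.

Definition itg f : Prop := mu.-integrable [set: T] (EFin \o f).
Definition I f : R := (\int[mu]_x f x)%R.

Lemma itg_measurable f : itg f -> measurable_fun setT f.
Proof. by move=> fi; apply/measurable_EFinP; exact: (measurable_int mu fi). Qed.

Lemma itgE f : itg f -> (\int[mu]_x (f x)%:E)%E = (I f)%:E.
Proof. by move=> fi; rewrite /I /Rintegral fineK//; exact: integrable_fin_num. Qed.

Lemma itgP f : measurable_fun setT f -> (\int[mu]_x `|f x|%:E < +oo)%E -> itg f.
Proof. by move=> mf h; apply/integrableP; split => //; exact/measurable_EFinP. Qed.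

Lemma eq_itg f g : f =1 g -> itg f -> itg g.
Proof. by move=> /funext ->. Qed.

Lemma eq_I f g : f =1 g -> I f = I g.
Proof. by move=> /funext ->. Qed.

Lemma itg_le f g : measurable_fun setT f -> (forall x, `|f x| <= g x) -> itg g -> itg f.
Proof.
move=> mf fg gi; apply: (le_integrable _ _ _ gi) => //; first exact/measurable_EFinP.
by move=> x _ /=; rewrite lee_fin (le_trans (fg x))// ler_norm.
Qed.

Lemma itg0 : itg (fun=> 0).
Proof. exact: integrable0. Qed.

Lemma itgD f g : itg f -> itg g -> itg (fun x => f x + g x).
Proof. by move=> fi gi; apply: eq_integrable (integrableD _ fi gi). Qed.

Lemma itgB f g : itg f -> itg g -> itg (fun x => f x - g x).
Proof. by move=> fi gi; apply: eq_integrable (integrableB _ fi gi). Qed.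

Lemma itgZ k f : itg f -> itg (fun x => k * f x).
Proof. by move=> fi; apply: eq_integrable (integrableZl _ k fi). Qed.

Lemma itg_abs f : itg f -> itg (fun x => `|f x|).
Proof. by move=> fi; apply: eq_integrable (integrable_norm fi). Qed.

Lemma itg_sum n (F : 'I_n -> T -> R) : (forall i, itg (F i)) ->
  itg (fun x => \sum_(i < n) F i x).
Proof.
elim: n F => [|n IH] F iF.
  by under [X in itg X]eq_fun do rewrite big_ord0; exact: itg0.
by under [X in itg X]eq_fun do rewrite big_ord_recl; apply: itgD => //; apply: IH.
Qed.

Lemma itg_bound f g C : measurable_fun setT g -> (forall x, `|g x| <= C) ->
  itg f -> itg (fun x => f x * g x).
Proof.
move=> mg gC fi; apply: (@itg_le _ (fun x => C * `|f x|)).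
- by apply: measurable_funM => //; exact: itg_measurable.
- by move=> x; rewrite normrM mulrC ler_wpM2r.
- by apply: itgZ; exact: itg_abs.
Qed.

Lemma I_D f g : itg f -> itg g -> I (fun x => f x + g x) = I f + I g.
Proof. exact: RintegralD. Qed.

Lemma I_B f g : itg f -> itg g -> I (fun x => f x - g x) = I f - I g.
Proof. exact: RintegralB. Qed.

Lemma I_Z k f : itg f -> I (fun x => k * f x) = k * I f.
Proof. exact: RintegralZl. Qed.

Lemma I_0 : I (fun=> 0) = 0.
Proof. by rewrite /I Rintegral_cst// mul0r. Qed.

Lemma I_sum n (F : 'I_n -> T -> R) : (forall i, itg (F i)) ->
  I (fun x => \sum_(i < n) F i x) = \sum_(i < n) I (F i).
Proof.
elim: n F => [|n IH] F iF.
  by under eq_I do rewrite big_ord0; rewrite I_0 big_ord0.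
rewrite big_ord_recl -IH// -I_D//; last exact: itg_sum.
by under eq_I do rewrite big_ord_recl.
Qed.

Lemma I_le f g : itg f -> itg g -> (forall x, f x <= g x) -> I f <= I g.
Proof. by move=> fi gi fg; apply: le_Rintegral. Qed.

Lemma I_ge0 f : (forall x, 0 <= f x) -> 0 <= I f.
Proof. by move=> f0; apply: Rintegral_ge0 => x _; exact: f0. Qed.

Lemma I_abs f : itg f -> `|I f| <= I (fun x => `|f x|).
Proof. by move=> fi; apply: le_normr_Rintegral. Qed.

Lemma I_dct (F : nat -> T -> R) f g :
  (forall n, measurable_fun setT (F n)) -> measurable_fun setT f ->
  {ae mu, forall x, F ^~ x @ \oo --> f x} -> itg g ->
  (forall n x, `|F n x| <= g x) ->
  itg f /\ (fun n => I (F n)) @ \oo --> I f.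
Proof.
move=> mF mf Ff gi Fg.
have [] := @dominated_convergence _ _ _ mu setT measurableT (fun n => EFin \o F n)
   (EFin \o f) (EFin \o g).
- by move=> n; exact/measurable_EFinP.
- exact/measurable_EFinP.
- apply: filterS Ff => x Fx _; by apply: cvg_EFin; [exact: nearW|exact: Fx].
- exact: gi.
- by apply: aeW => x n _; rewrite lee_fin.
move=> fi _ H; split => //.
by move: H; rewrite /= itgE// => /fine_cvgP[_].
Qed.

Lemma itg_ae_dct (F : nat -> T -> R) f g :
  (forall n, measurable_fun setT (F n)) -> measurable_fun setT f ->
  {ae mu, forall x, F ^~ x @ \oo --> f x} -> itg g ->
  (forall n x, `|F n x - f x| <= g x) ->
  (fun n => I (fun x => `|F n x - f x|)) @ \oo --> (0 : R).
Proof.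
move=> mF mf Ff gi Fg.
rewrite -I_0; apply: (@I_dct _ _ g _ _ _ _ _).2 => //.
- by move=> n; apply: measurableT_comp => //; exact: measurable_funB.
- apply: filterS Ff => x Fx; rewrite -(normr0 R) -(subrr (f x)).
  by apply: cvg_norm; apply: cvgB => //; exact: cvg_cst.
- by move=> n x; rewrite normr_id.
Qed.

Lemma cvg_dist_I (F : nat -> T -> R) f :
  (forall n, itg (F n)) -> itg f ->
  (fun n => I (fun x => `|F n x - f x|)) @ \oo --> (0 : R) ->
  (fun n => I (F n)) @ \oo --> I f.
Proof.
move=> iF fi H; apply/cvgrPdist_le => e e0.
move/cvgrPdist_le : H => /(_ e e0); apply: filterS => n.
rewrite sub0r normrN ger0_norm; last exact: I_ge0.
apply: le_trans; rewrite distrC -I_B//; apply: I_abs; exact: itgB.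
Qed.

Lemma cvg_abs0_le (a b : nat -> R) : (forall n, `|a n| <= b n) ->
  b @ \oo --> (0 : R) -> a @ \oo --> (0 : R).
Proof.
move=> ab b0; apply/cvgrPdist_le => e e0.
move/cvgrPdist_le : b0 => /(_ e e0); apply: filterS => n.
rewrite !sub0r !normrN; apply: le_trans; apply: le_trans (ab n) (ler_norm _).
Qed.

Lemma cvg_subseq (u : nat -> R) (l : R) (s : nat -> nat) : (forall n, (n <= s n)%N) ->
  u @ \oo --> l -> (fun n => u (s n)) @ \oo --> l.
Proof.
move=> sle ul; apply/cvgrPdist_le => e e0.
move/cvgrPdist_le : ul => /(_ e e0) [n0 _ H]; exists n0 => // n /= n0n.
by apply: H => /=; exact: leq_trans (sle n).
Qed.

Lemma cvg_I_lip (F X : nat -> T -> R) f x (C : R) :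
  (forall n, itg (F n)) -> itg f -> (forall n, itg (X n)) -> itg x ->
  (forall n z, `|F n z - f z| <= C * `|X n z - x z|) ->
  (fun n => I (fun z => `|X n z - x z|)) @ \oo --> (0 : R) ->
  (fun n => I (F n)) @ \oo --> I f.
Proof.
move=> iF fi iX xi FX X0; apply: cvg_dist_I => //.
apply: (@cvg_abs0_le _ (fun n => C * I (fun z => `|X n z - x z|))); last first.
  by rewrite -[X in _ --> X](mulr0 C); exact: cvgM (cvg_cst _) X0.
move=> n; rewrite ger0_norm; last exact: I_ge0.
rewrite -I_Z; last by apply: itg_abs; exact: itgB.
by apply: I_le => //; [|apply: itgZ]; apply: itg_abs; exact: itgB.
Qed.

(** With distances at most [1 / 2 ^ (n + 1)] along [s], the series of [|F (s n) - f|] has a finite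
    integral, so it converges almost everywhere and its terms tend to 0. The map [s] is not claimed
    to be monotone; [n <= s n] suffices to carry limits along it. *)
Lemma L1_ae_subseq (F : nat -> T -> R) f :
  (forall n, itg (F n)) -> itg f ->
  (fun n => I (fun x => `|F n x - f x|)) @ \oo --> (0 : R) ->
  exists s : nat -> nat, (forall n, (n <= s n)%N) /\
    {ae mu, forall x, (fun n => F (s n) x) @ \oo --> f x}.
Proof.
move=> iF fi H.
have ex n : exists m, (n <= m)%N /\ I (fun x => `|F m x - f x|) <= 1 / (2 ^ (n + 1))%:R.
  have e0 : 0 < 1 / (2 ^ (n + 1))%:R :> R by rewrite divr_gt0// ltr0n expn_gt0.
  move/cvgrPdist_le : H => /(_ _ e0) [m _ Hm].
  exists (maxn n m); split; first exact: leq_maxl.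
  have := Hm (maxn n m) (leq_maxr _ _); rewrite sub0r normrN ger0_norm//.
  exact: I_ge0.
have [s Hs] := choice ex.
exists s; split; first by move=> n; have [] := Hs n.
pose G n x := `|F (s n) x - f x|.
have iG n : itg (G n) by apply: itg_abs; exact: itgB.
have mG n : measurable_fun setT (EFin \o G n) by apply/measurable_EFinP; exact: itg_measurable.
have sumG : mu.-integrable setT (fun x => \sum_(n <oo) (G n x)%:E)%E.
  apply/integrableP; split.
    by apply: ge0_emeasurable_sum => [n x *|n _]; [rewrite lee_fin /G|exact: mG].
  under eq_integral => x _.
    rewrite gee0_abs; last by apply: nneseries_ge0 => n *; rewrite lee_fin /G.
    over.
  rewrite integral_nneseries//; last by move=> n x _; rewrite lee_fin /G.
  apply: (@le_lt_trans _ _ (\sum_(n <oo) (1 / (2 ^ (n + 1))%:R)%:E)%E).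
    apply: lee_nneseries => [n *|n *].
      by apply: integral_ge0 => x _; rewrite lee_fin /G.
    by rewrite itgE// lee_fin; have [] := Hs n.
  have /cvg_lim -> // := @cvg_geometric_eseries_half R 1 0.
  by rewrite ltry.
apply: filterS (integrable_ae measurableT sumG) => x /(_ Logic.I) Hx.
have G0 : (fun n => G n x) @ \oo --> (0 : R).
  have G_ge0 n : (0 <= (G n x)%:E)%E by rewrite lee_fin /G.
  have /fine_cvgP[_] : (fun n => (G n x)%:E) @ \oo --> (0 : R)%:E.
    apply: (@squeeze_cvge _ _ _ _ (fun=> 0%E) _ (fun n => \sum_(n <= k <oo) (G k x)%:E)%E).
    - apply: nearW => n; rewrite G_ge0 /=.
      apply: le_trans (@nneseries_lim_ge _ (fun k => (G k x)%:E) xpredT n n.+1 _).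
        by rewrite big_nat1.
      by move=> k _ _.
    - exact: cvg_cst.
    - apply: nneseries_tail_cvg => //.
      by rewrite -ge0_fin_numE//; exact: nneseries_ge0.
  exact: cvg_trans.
apply/cvgrPdist_le => e e0.
move/cvgrPdist_le : G0 => /(_ e e0); apply: filterS => n.
by rewrite sub0r normrN /G normr_id distrC.
Qed.

End RealIntegral.

(** * Twice continuously differentiable functions *)

Section OneVariable.
Context {R : realType}.
Implicit Types g : R -> R.

Lemma is_derive1_continuous g (g' : R -> R) : (forall x : R, is_derive x 1 g (g' x)) -> continuous g.
Proof.
move=> dg x; apply: differentiable_continuous; apply/derivable1_diffP.
exact: ex_derive.
Qed.

Lemma mean_value_itv g (g' : R -> R) (a b : R) : (forall x : R, is_derive x 1 g (g' x)) -> a < b ->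
  exists2 c, a < c < b & g b - g a = g' c * (b - a).
Proof.
move=> dg ab; have cg := is_derive1_continuous dg.
have [c cab E] := MVT ab (fun x _ => dg x) (continuous_subspaceT cg).
by exists c => //; move: cab; rewrite in_itv.
Qed.

Lemma mean_value g (g' : R -> R) : (forall x : R, is_derive x 1 g (g' x)) ->
  forall h, exists2 xi, `|xi| <= `|h| & g h - g 0 = h * g' xi.
Proof.
move=> dg h; have [h0|h0|->] := ltgtP h 0; last by exists 0 => //; rewrite subrr mul0r.
- have [c /andP[c1 c2] E] := mean_value_itv dg h0; exists c; last by lra.
  by rewrite !ler0_norm; lra.
- have [c /andP[c1 c2] E] := mean_value_itv dg h0; exists c; last by lra.
  by rewrite !ger0_norm; lra.
Qed.

Lemma is_deriveNarg g (dg s : R) :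
  is_derive (- s) 1 g dg -> is_derive s 1 (fun s => g (- s)) (- dg).
Proof.
move=> Hg; have H : is_derive s 1 (g \o -%R) (dg * (- 1)).
  exact: is_derive1_comp.
by apply: is_derive_eq H _; rewrite mulrN1.
Qed.

(** The number [c] is chosen so that [H], the symmetric sum minus a parabola, vanishes at both 0 and
    [h]. Rolle's theorem gives [c1] with [g' c1 - g' (- c1) = 2 * c * c1], and the mean value
    theorem for [g'] on [[- c1, c1]] turns this into [g'' xi = c]. *)
Lemma second_mean_value g (g' g'' : R -> R) :
  (forall x : R, is_derive x 1 g (g' x)) -> (forall x : R, is_derive x 1 g' (g'' x)) ->
  forall h, 0 < h -> exists2 xi, `|xi| <= h & g h + g (- h) - 2 * g 0 = h ^+ 2 * g'' xi.
Proof.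
move=> dg dg' h h0.
pose c := (g h + g (- h) - 2 * g 0) / h ^+ 2.
pose H s := g s + g (- s) - (2 * g 0 + c * (s * s)).
have dH (s : R) : is_derive s 1 H (g' s - g' (- s) - 2 * c * s).
  have d1 := is_deriveNarg (dg (- s)).
  have d2 : is_derive s 1 (fun s : R => 2 * g 0 + c * (s * s)) (2 * c * s).
    apply: is_derive_eq; rewrite /GRing.scale /=; ring.
  by apply: is_derive_eq; rewrite /GRing.scale /=; ring.
have cH := is_derive1_continuous dH.
have H0 : H 0 = 0 by rewrite /H oppr0; ring.
have Hh : H h = 0 by rewrite /H /c; field; rewrite gt_eqF.
have H0h : H 0 = H h by rewrite H0 Hh.
have [c1] := Rolle h0 (fun x _ => ex_derive (is_derive := dH x)) (continuous_subspaceT cH) H0h.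
rewrite in_itv/= => /andP[c10 c1h] [_ dH0].
have E : g' c1 - g' (- c1) - 2 * c * c1 = 0 by rewrite -dH0; symmetry; apply: derive_val.
have cc : - c1 < c1 by lra.
have [xi /andP[x1 x2] E2] := mean_value_itv dg' cc.
exists xi; first by rewrite ler_norml; lra.
have c1n : c1 != 0 by rewrite gt_eqF.
have -> : g'' xi = c.
  apply: (mulfI (_ : 2 * c1 != 0)); first by rewrite mulf_neq0// pnatr_eq0.
  lra.
by rewrite /c; field; rewrite gt_eqF.
Qed.

Definition pospart (s : R) : R := Num.max 0 s.

Lemma pospart_ge0 s : 0 <= pospart s.
Proof. by rewrite /pospart le_max lexx. Qed.

Lemma pospart_gt0 s : (0 < pospart s) = (0 < s).
Proof. by rewrite /pospart lt_max ltxx. Qed.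

Lemma pospart_mul s : s * pospart s = pospart s ^+ 2.
Proof. by rewrite /pospart; case: (leP 0 s) => h; rewrite ?mulr0 ?expr0n// expr2. Qed.

Lemma pospart_sub s t : pospart (s - t) - pospart (t - s) = s - t.
Proof.
by rewrite /pospart; case: (leP 0 (s - t)); case: (leP 0 (t - s)) => ? ?; lra.
Qed.

Lemma pospart_dist s t : `|pospart s - pospart t| <= `|s - t|.
Proof.
rewrite /pospart; case: (leP 0 s) => hs; case: (leP 0 t) => ht; rewrite ?subr0 ?sub0r ?subrr//.
- by rewrite !ger0_norm; lra.
- by rewrite normrN (ger0_norm ht) ler0_norm; lra.
- by rewrite normr0.
Qed.

Lemma continuous_pospart : continuous pospart.
Proof.
move=> x; apply/cvgrPdist_le => e e0; near=> y.
apply: le_trans (pospart_dist _ _) _; near: y.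
by apply: cvgr_dist_le; [exact: cvg_id|].
Unshelve. all: by end_near. Qed.

Lemma pospart_sqr_taylor s h :
  `|pospart (s + h) ^+ 2 - pospart s ^+ 2 - 2 * h * pospart s| <= h ^+ 2.
Proof.
rewrite ler_norml /pospart; case: (leP 0 (s + h)) => a; case: (leP 0 s) => b;
  apply/andP; split; nra.
Qed.

Lemma is_derive_pospart2 (s : R) : is_derive s 1 (fun s => pospart s ^+ 2) (2 * pospart s).
Proof.
have H : h^-1 *: (((fun s => pospart s ^+ 2) \o shift s) (h *: (1 : R)) - pospart s ^+ 2)
    @[h --> 0^'] --> 2 * pospart s.
  apply/cvgrPdist_le => e e0; near=> h.
  have h0 : h != 0 by near: h; exact: nbhs_dnbhs_neq.
  rewrite distrC /GRing.scale /= mulr1 [h + s]addrC.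
  have -> : h^-1 * (pospart (s + h) ^+ 2 - pospart s ^+ 2) - 2 * pospart s =
     h^-1 * (pospart (s + h) ^+ 2 - pospart s ^+ 2 - 2 * h * pospart s).
    by field.
  rewrite normrM normfV ler_pdivrMl ?normr_gt0//.
  apply: le_trans (pospart_sqr_taylor _ _) _.
  rewrite -(@real_normK _ h) ?num_real// expr2 ler_wpM2l//.
  near: h; apply: dnbhs0_le; exact: e0.
by split; [apply/cvg_ex; exists (2 * pospart s)|exact/cvg_lim].
Unshelve. all: by end_near. Qed.

(** The cube is the lowest integer power of the positive part that is twice continuously
    differentiable, which is why all cut-off functions below are built from it. The identity
    [s * s_+ = s_+ ^ 2] reduces it to the square. *)
Lemma is_derive_pospart3 (s : R) : is_derive s 1 (fun s => pospart s ^+ 3) (3 * pospart s ^+ 2).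
Proof.
have -> : (fun s => pospart s ^+ 3) = (fun s => s * pospart s ^+ 2).
  by apply/funext => x; rewrite exprS [in RHS]expr2 mulrA pospart_mul; ring.
have d := is_derive_pospart2 s.
have H : is_derive s 1 ((id : R -> R) * (fun s => pospart s ^+ 2))
    (s *: (2 * pospart s) + pospart s ^+ 2 *: (1 : R)) by exact: is_deriveM.
apply: is_derive_eq H _; rewrite /GRing.scale /= mulr1 mulrCA pospart_mul; ring.
Qed.

End OneVariable.

(** * Twice continuously differentiable functions of several variables *)

Section C2Functions.
Context {R : realType} {n : nat}.
Implicit Types (f g : 'rV[R]_n -> R) (z v : 'rV[R]_n).

(** The bridge by which one-variable results, such as the mean value theorems, apply to partial
    derivatives. *)
Lemma is_derive_line f z v (s : R) d :
  is_derive (z + s *: v) v f d <-> is_derive s 1 (fun s => f (z + s *: v)) d.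
Proof.
have E : (fun h : R => h^-1 *: ((f \o shift (z + s *: v)) (h *: v) - f (z + s *: v))) =
   (fun h : R => h^-1 *: (((fun s => f (z + s *: v)) \o shift s) (h *: (1 : R)) - f (z + s *: v))).
  apply/funext => h /=; congr (_ *: (f _ - _)).
  have -> : h *: (1 : R) = h by exact: mulr1.
  by rewrite scalerDl; exact: addrCA.
by split => -[h1 h2]; split; move: h1 h2; rewrite /derivable /derive E.
Qed.

Definition C2 f (d1 : 'I_n -> 'rV[R]_n -> R) (d2 : 'I_n -> 'I_n -> 'rV[R]_n -> R) : Prop :=
  [/\ forall i z, is_derive z (unitv i) f (d1 i z),
      forall i j z, is_derive z (unitv j) (d1 i) (d2 i j z),
      continuous f, forall i, continuous (d1 i) & forall i j, continuous (d2 i j)].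

Definition smooth2 f := exists d1 d2, C2 f d1 d2.

Lemma smooth2_cst (c : R) : smooth2 (fun=> c).
Proof.
exists (fun _ _ => 0), (fun _ _ _ => 0).
by split => *; try exact: cst_continuous; exact: is_derive_cst.
Qed.

Lemma smooth2_add f g : smooth2 f -> smooth2 g -> smooth2 (fun z => f z + g z).
Proof.
move=> [f1 [f2 [a b c d e]]] [g1 [g2 [a' b' c' d' e']]].
exists (fun i z => f1 i z + g1 i z), (fun i j z => f2 i j z + g2 i j z).
split.
- by move=> i z; have := a i z; have := a' i z => ? ?; exact: is_deriveD.
- by move=> i j z; have := b i j z; have := b' i j z => ? ?; exact: is_deriveD.
- by move=> z; exact: cvgD (c z) (c' z).
- by move=> i z; exact: cvgD (d i z) (d' i z).
- by move=> i j z; exact: cvgD (e i j z) (e' i j z).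
Qed.

Lemma C2_mul f g (f1 g1 : 'I_n -> 'rV[R]_n -> R) (f2 g2 : 'I_n -> 'I_n -> 'rV[R]_n -> R) :
  C2 f f1 f2 -> C2 g g1 g2 ->
  C2 (fun z => f z * g z) (fun i z => f z * g1 i z + g z * f1 i z)
    (fun i j z => (f z * g2 i j z + g1 i z * f1 j z) + (g z * f2 i j z + f1 i z * g1 j z)).
Proof.
move=> [a b c d e] [a' b' c' d' e']; split.
- by move=> i z; have := a i z; have := a' i z => ? ?; exact: is_deriveM.
- move=> i j z; apply: is_deriveD; apply: is_deriveM.
- by move=> z; exact: cvgM (c z) (c' z).
- by move=> i z; exact: cvgD (cvgM (c z) (d' i z)) (cvgM (c' z) (d i z)).
- move=> i j z.
  exact: cvgD (cvgD (cvgM (c z) (e' i j z)) (cvgM (d' i z) (d j z)))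
              (cvgD (cvgM (c' z) (e i j z)) (cvgM (d i z) (d' j z))).
Qed.

Lemma smooth2_mul f g : smooth2 f -> smooth2 g -> smooth2 (fun z => f z * g z).
Proof.
by move=> [f1 [f2 fC]] [g1 [g2 gC]]; eexists; eexists; exact: (C2_mul fC gC).
Qed.

Lemma smooth2_scale (k : R) f : smooth2 f -> smooth2 (fun z => k * f z).
Proof. by move=> fs; apply: smooth2_mul => //; exact: smooth2_cst. Qed.

Lemma smooth2_prod m (F : 'I_m -> 'rV[R]_n -> R) :
  (forall i, smooth2 (F i)) -> smooth2 (fun z => \prod_(i < m) F i z).
Proof.
elim: m F => [|m IH] F sF.
  by under [X in smooth2 X]eq_fun do rewrite big_ord0; exact: smooth2_cst.
by under [X in smooth2 X]eq_fun do rewrite big_ord_recl; apply: smooth2_mul => //; apply: IH.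
Qed.

Lemma C2_coord (i0 : 'I_n) (g g' g'' : R -> R) :
  (forall s : R, is_derive s 1 g (g' s)) -> (forall s : R, is_derive s 1 g' (g'' s)) ->
  continuous g'' -> C2 (fun z => g (z ord0 i0))
    (fun i z => (i0 == i)%:R * g' (z ord0 i0))
    (fun i j z => (i0 == i)%:R * ((i0 == j)%:R * g'' (z ord0 i0))).
Proof.
move=> dg dg' cg''.
have cg := is_derive1_continuous dg; have cg' := is_derive1_continuous dg'.
have cc (k : R -> R) : continuous k -> continuous (fun z : 'rV[R]_n => k (z ord0 i0)).
  move=> ck z; apply: continuous_comp; [exact: coord_continuous|exact: ck].
have dd (k k' : R -> R) i z : (forall s : R, is_derive s 1 k (k' s)) ->
    is_derive z (unitv i) (fun z : 'rV[R]_n => k (z ord0 i0)) ((i0 == i)%:R * k' (z ord0 i0)).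
  move=> dk; rewrite -[z in is_derive z](addr0 z) -(scale0r (unitv i)).
  apply/is_derive_line.
  have -> : (fun s : R => k ((z + s *: unitv i) ord0 i0)) =
      k \o (fun s => z ord0 i0 + s * (i0 == i)%:R).
    by apply/funext => s /=; rewrite !mxE.
  have da : is_derive (0 : R) 1 (fun s : R => z ord0 i0 + s * (i0 == i)%:R) (i0 == i)%:R.
    by apply: is_derive_eq; rewrite /GRing.scale /=; ring.
  have H := dk (z ord0 i0 + 0 * (i0 == i)%:R).
  have Hc := (@is_derive1_comp _ k (fun s : R => z ord0 i0 + s * (i0 == i)%:R) 0 _ _ H da).
  apply: is_derive_eq Hc _.
  by rewrite mul0r addr0 mulrC.
split.
- by move=> i z; exact: dd.
- move=> i j z; apply: is_deriveZ; exact: dd.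
- exact: cc.
- by move=> i z; exact: cvgM (cvg_cst _) (cc _ cg' z).
- by move=> i j z; exact: cvgM (cvg_cst _) (cvgM (cvg_cst _) (cc _ cg'' z)).
Qed.

Lemma C2_reflect f d1 d2 (a : 'rV[R]_n) : C2 f d1 d2 ->
  C2 (fun z => f (a - z)) (fun i z => - d1 i (a - z)) (fun i j z => d2 i j (a - z)).
Proof.
move=> [h1 h2 h3 h4 h5].
have cs (k : 'rV[R]_n -> R) : continuous k -> continuous (fun z => k (a - z)).
  move=> ck z.
  have cz : continuous (fun z : 'rV[R]_n => a - z).
    move=> w; have Fw := @nbhs_filter 'rV[R]_n w.
    exact: (@cvgB _ _ _ _ Fw (cst a) id _ _ (@cvg_cst _ _ _ _ Fw) (fun _ => id)).
  exact: (continuous_comp (cz z) (ck _)).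
have ds (k : 'rV[R]_n -> R) i z d : is_derive (a - z) (unitv i) k d ->
    is_derive z (unitv i) (fun z => k (a - z)) (- d).
  move=> dk; rewrite -[z in is_derive z](addr0 z) -(scale0r (unitv i)).
  apply/is_derive_line.
  have -> : (fun s : R => k (a - (z + s *: unitv i))) =
     (fun s => (fun s => k ((a - z) + s *: unitv i)) (- s)).
    by apply/funext => s; rewrite scaleNr opprD addrA.
  apply: (@is_deriveNarg _ (fun s => k ((a - z) + s *: unitv i))).
  by apply/is_derive_line; rewrite oppr0 scale0r addr0.
split.
- by move=> i z; exact: ds.
- move=> i j z; rewrite -[d2 _ _ _]opprK; apply: is_deriveN; exact: ds.
- exact: cs.
- by move=> i z; exact: cvgN (cs _ (h4 i) z).
- by move=> i j; exact: cs.
Qed.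

(** Off the closed set [K] the function vanishes on a whole neighbourhood, so its derivatives vanish
    there; the argument is then repeated with [d1] in place of [f]. *)
Lemma C2_support f d1 d2 (K : set 'rV[R]_n) : C2 f d1 d2 -> closed K ->
  (forall z, f z != 0 -> K z) ->
  (forall i z, d1 i z != 0 -> K z) /\ (forall i j z, d2 i j z != 0 -> K z).
Proof.
move=> [h1 h2 _ _ _] cK.
have key (k : 'rV[R]_n -> R) v (k' : 'rV[R]_n -> R) :
    (forall z, is_derive z v k (k' z)) -> (forall z, k z != 0 -> K z) ->
    forall z, k' z != 0 -> K z.
  move=> dk kK z; apply: contra_neqP => nKz.
  have k0 : \near z, 0 = k z.
    have /open_nbhs_nbhs : open_nbhs z (~` K) by split => //; exact: closed_openC.
    by apply: filterS => y /= nKy; apply/esym/eqP; apply: contra_notT nKy; exact: kK.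
  have [_ <-] := dk z.
  have := near_eq_is_derive k0 (is_derive_cst (0 : R) z v).
  by move=> [_ ->].
move=> fK; have K1 i := key _ _ _ (h1 i) fK; split => // i j.
exact: key _ _ _ (h2 i j) (K1 i).
Qed.

Lemma continuous_support_bounded f (B : R) : continuous f ->
  (forall z, f z != 0 -> `|z| <= B) -> exists C, forall z, `|f z| <= C.
Proof.
move=> cf fB; pose K := [set z : 'rV[R]_n | `|z| <= B].
have cK : compact K.
  apply: bounded_closed_compact.
    by exists B; split; [exact: num_real|move=> M BM z /= /le_trans; apply; exact: ltW].
  have -> : K = Num.norm @^-1` [set x | x <= B] by [].
  apply: closed_comp; last exact: closed_le.
  by move=> z _; exact: norm_continuous.
have : compact (f @` K) by apply: continuous_compact => //; exact: continuous_subspaceT.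
move=> /compact_bounded [M [_ HM]]; exists (Num.max 0 (M + 1)) => z.
have [->|fz] := eqVneq (f z) 0; first by rewrite normr0 le_max lexx.
rewrite le_max; apply/orP; right; apply: (HM (M + 1)); first by rewrite ltrDl.
by exists z => //; exact: fB.
Qed.

End C2Functions.

(** * Difference quotients and mollification *)

Section DiscreteOperator.
Context {R : realType} {N : nat}.
Implicit Types (f g : 'rV[R]_(N + 1) -> R) (z v : 'rV[R]_(N + 1)).

Local Notation tau := (rshift N (ord0 : 'I_1)).
Local Notation sp i := (lshift 1 (i : 'I_N)).

(** A finite-difference form of [s * d/dt - Laplacian] with step [h]. Time enters through [f z]
    minus a neighbouring value, and the neighbouring values in space enter with a minus sign too:
    this is what convexity demands in [dop_convex]. The adjoint of [dop 1] under translation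
    invariance is [dop (-1)]. *)
Definition dop (s : R) f (h : R) z : R :=
  (f z - f (z - (h * s) *: unitv tau)) / h -
  \sum_(i < N) (f (z + h *: unitv (sp i)) + f (z - h *: unitv (sp i)) - 2 * f z) / h ^+ 2.

(* [heat s] is [s * d/dt - Laplacian]: the heat operator for [s = 1] and its
   formal adjoint for [s = -1]. *)
Definition heat (s : R) (d1 : 'I_(N + 1) -> 'rV[R]_(N + 1) -> R)
    (d2 : 'I_(N + 1) -> 'I_(N + 1) -> 'rV[R]_(N + 1) -> R) z : R :=
  s * d1 tau z - \sum_(i < N) d2 (sp i) (sp i) z.

Lemma cvg_fsum m (F : 'I_m -> nat -> R) (l : 'I_m -> R) :
  (forall i, F i @ \oo --> l i) ->
  (fun k => \sum_(i < m) F i k) @ \oo --> \sum_(i < m) l i.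
Proof.
elim: m F l => [|m IH] F l Fl.
  by rewrite big_ord0; under eq_fun do rewrite big_ord0; exact: cvg_cst.
rewrite big_ord_recl; under eq_fun do rewrite big_ord_recl.
by apply: cvgD; [exact: Fl|apply: IH => i; exact: Fl].
Qed.

Lemma cvg_near_point (D : 'rV[R]_(N + 1) -> R) z v (a : nat -> R) :
  continuous D ->
  (forall m, exists2 xi, `|xi| <= harmonic m & a m = D (z + xi *: v)) ->
  a @ \oo --> D z.
Proof.
move=> cD Ha; have {}Ha m : exists xi, `|xi| <= harmonic m /\ a m = D (z + xi *: v).
  by have [xi ? ?] := Ha m; exists xi.
have [xi Hxi] := choice Ha.
have -> : a = D \o (fun m => z + xi m *: v) by apply/funext => m; have [] := Hxi m.
have xi0 : xi @ \oo --> (0 : R).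
  apply: (@cvg_abs0_le R xi harmonic); last exact: cvg_harmonic.
  by move=> m; have [] := Hxi m.
apply: cvg_comp; last exact: cD.
apply/cvgrPdist_le => e e0.
have v1 : 0 < `|v| + 1 by rewrite ltr_wpDl.
move/cvgrPdist_le : xi0 => /(_ (e / (`|v| + 1))).
rewrite divr_gt0// => /(_ isT); apply: filterS => m.
rewrite sub0r normrN ler_pdivlMr// => H.
rewrite opprD addrA subrr sub0r normrN normrZ.
by apply: le_trans H; rewrite ler_wpM2l// lerDl.
Qed.

Lemma line_difference f d1 d2 (C2f : C2 f d1 d2) i z (r : R) :
  exists2 xi, `|xi| <= `|r| & f (z + r *: unitv i) - f z = r * d1 i (z + xi *: unitv i).
Proof.
have [h1 _ _ _ _] := C2f.
have := @mean_value R (fun r => f (z + r *: unitv i))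
  (fun r => d1 i (z + r *: unitv i)) _ r.
rewrite scale0r addr0; apply => x; exact/is_derive_line.
Qed.

Lemma line_second_difference f d1 d2 (C2f : C2 f d1 d2) i z (h : R) : 0 < h ->
  exists2 xi, `|xi| <= h & f (z + h *: unitv i) + f (z - h *: unitv i) - 2 * f z =
    h ^+ 2 * d2 i i (z + xi *: unitv i).
Proof.
move=> h0; have [h1 h2 _ _ _] := C2f.
have := @second_mean_value R (fun r => f (z + r *: unitv i))
  (fun r => d1 i (z + r *: unitv i)) (fun r => d2 i i (z + r *: unitv i)) _ _ h h0.
rewrite scale0r addr0 scaleNr; apply => x; exact/is_derive_line.
Qed.

Lemma dop_terms s f d1 d2 (C2f : C2 f d1 d2) z (h : R) : `|s| = 1 -> 0 < h ->
  (exists2 xi, `|xi| <= h & (f z - f (z - (h * s) *: unitv tau)) / h =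
     s * d1 tau (z + xi *: unitv tau)) /\
  (forall i, exists2 xi, `|xi| <= h &
     (f (z + h *: unitv (sp i)) + f (z - h *: unitv (sp i)) - 2 * f z) / h ^+ 2 =
     d2 (sp i) (sp i) (z + xi *: unitv (sp i))).
Proof.
move=> s1 h0; have hn : h != 0 by rewrite gt_eqF.
split.
  have [xi xih E] := line_difference C2f tau z (- (h * s)).
  exists xi; first by rewrite (le_trans xih)// normrN normrM s1 mulr1 gtr0_norm.
  rewrite -scaleNr -opprB E; field.
  by rewrite hn.
move=> i; have [xi xih E] := line_second_difference C2f (sp i) z h0.
by exists xi => //; rewrite E mulrC mulKf// expf_neq0.
Qed.

Lemma dop_bound s f d1 d2 (C : R) (h : R) z : C2 f d1 d2 -> `|s| = 1 -> 0 < h ->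
  (forall i z, `|d1 i z| <= C) -> (forall i j z, `|d2 i j z| <= C) ->
  `|dop s f h z| <= C + C *+ N.
Proof.
move=> C2f s1 h0 b1 b2.
have [[xi _ E1] E2] := dop_terms C2f z s1 h0.
rewrite /dop E1; apply: le_trans (ler_normB _ _) _; apply: lerD.
  by rewrite normrM s1 mul1r.
apply: le_trans (ler_norm_sum _ _ _) _.
apply: (@le_trans _ _ (\sum_(i < N) C)).
  by apply: ler_sum => i _; have [x _ ->] := E2 i.
by rewrite sumr_const card_ord.
Qed.

Lemma dop_cvg s f d1 d2 z : C2 f d1 d2 -> `|s| = 1 ->
  (fun m => dop s f (harmonic m) z) @ \oo --> heat s d1 d2 z.
Proof.
move=> C2f s1; have [_ _ _ c1 c2] := C2f.
have hp m : 0 < (harmonic m : R) by exact: harmonic_gt0.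
apply: cvgB.
  apply: (@cvg_near_point (fun z => s * d1 tau z) z (unitv tau)).
    by move=> w; exact: cvgM (cvg_cst _) (c1 _ w).
  by move=> m; have [] := dop_terms C2f z s1 (hp m).
apply: cvg_fsum => i.
apply: (@cvg_near_point (d2 (sp i) (sp i)) z (unitv (sp i))); first exact: c2.
by move=> m; have [_ /(_ i)] := dop_terms C2f z s1 (hp m).
Qed.

(* A chain rule for convex [j], which needs no regularity of [f] because [dop] is discrete. *)
Lemma dop_convex (j j' : R -> R) f (h : R) z : 0 < h ->
  (forall a b, j' a * (b - a) <= j b - j a) ->
  dop 1 (j \o f) h z <= j' (f z) * dop 1 f h z.
Proof.
move=> h0 jj; rewrite /dop mulrBr; apply: lerB.
  rewrite mulrA ler_pM2r ?invr_gt0//=.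
  have := jj (f z) (f (z - (h * 1) *: unitv tau)); lra.
rewrite mulr_sumr; apply: ler_sum => i _.
rewrite mulrA ler_pM2r ?invr_gt0 ?exprn_gt0//=.
have := jj (f z) (f (z + h *: unitv (sp i))).
have := jj (f z) (f (z - h *: unitv (sp i))); lra.
Qed.

End DiscreteOperator.

(** * Convolution with a bounded continuous kernel *)

Section Convolution.
Context {R : realType} {n : nat}.
Variable M : {sigma_finite_measure set (BorelRV R n) -> \bar R}.
Hypothesis M_nice : nice M.
Local Notation fct := ('rV[R]_n -> R).
Implicit Types (f g W K : 'rV[R]_n -> R) (z : 'rV[R]_n).

Lemma itg_shift f (a : 'rV[R]_n) : itg M f ->
  itg M (fun z => f (z + a)) /\ I M (fun z => f (z + a)) = I M f.
Proof.
move=> fi; have [ms H] := M_nice.2 a.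
have H' (h : BorelRV R n -> \bar R) : measurable_fun setT h -> (forall y, (0 <= h y)%E) ->
    (\int[M]_y h y = \int[M]_x h ((x : 'rV[R]_n) + a)%R)%E.
  by move=> mh h0; rewrite (H h).
have [h1 h2] := integral_transport ms H' fi.
by split => //; rewrite /I /Rintegral; congr fine; exact/esym.
Qed.

Definition convol W K z : R := I M (fun y => W y * K (z - y)).

Lemma measurable_conv_integrand W K :
  borel_fun W -> continuous K ->
  measurable_fun setT (fun p : BorelRV R n * BorelRV R n =>
    W p.2 * K ((p.1 : 'rV[R]_n) - (p.2 : 'rV[R]_n))).
Proof.
move=> mW cK; apply: measurable_funM.
  exact: (measurableT_comp mW measurable_snd).
apply: (measurableT_comp (continuous_measurable_rV cK)).
apply: measurable_fun_rV => i; under eq_fun do rewrite !mxE.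
apply: measurable_funB.
  exact: (measurableT_comp (coord_measurable i) measurable_fst).
exact: (measurableT_comp (coord_measurable i) measurable_snd).
Qed.

Lemma measurable_conv W K :
  borel_fun W -> continuous K ->
  borel_fun (convol W K).
Proof.
move=> mW cK.
have mK : measurable_fun setT (EFin \o (fun p : BorelRV R n * BorelRV R n =>
    W p.2 * K ((p.1 : 'rV[R]_n) - (p.2 : 'rV[R]_n)))).
  by apply/measurable_EFinP; exact: measurable_conv_integrand.
have := measurable_integral_param M mK.
move=> H; exact: (measurableT_comp (fine_measurable measurableT) H).
Qed.

Lemma continuous_reflect K z : continuous K ->
  continuous (fun y : 'rV[R]_n => K (z - y)).
Proof.
move=> ck y.
have cz : continuous (fun y : 'rV[R]_n => z - y).
  move=> w; have Fw := @nbhs_filter 'rV[R]_n w.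
  exact: (@cvgB _ _ _ _ Fw (cst z) id _ _ (@cvg_cst _ _ _ _ Fw) (fun _ => id)).
exact: (continuous_comp (cz y) (ck _)).
Qed.

Lemma itg_conv_integrand W K (C : R) z : itg M W -> continuous K ->
  (forall y, `|K y| <= C) -> itg M (fun y => W y * K (z - y)).
Proof.
move=> Wi cK KC; have mK : measurable_fun [set: BorelRV R n] (fun y : 'rV[R]_n => K (z - y)).
  exact: (continuous_measurable_rV (@continuous_reflect K z cK)).
exact: (itg_bound mK (fun y => KC (z - y)) Wi).
Qed.

Lemma conv_B W1 W2 K (C : R) z : itg M W1 -> itg M W2 -> continuous K ->
  (forall y, `|K y| <= C) ->
  convol (fun y => W1 y - W2 y) K z = convol W1 K z - convol W2 K z.
Proof.
move=> i1 i2 cK KC; rewrite /convol -I_B; [|exact: itg_conv_integrand KC..].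
by apply: eq_I => y; rewrite mulrBl.
Qed.

Lemma conv_D W1 W2 K (C : R) z : itg M W1 -> itg M W2 -> continuous K ->
  (forall y, `|K y| <= C) ->
  convol (fun y => W1 y + W2 y) K z = convol W1 K z + convol W2 K z.
Proof.
move=> i1 i2 cK KC; rewrite /convol -I_D; [|exact: itg_conv_integrand KC..].
by apply: eq_I => y; rewrite mulrDl.
Qed.

Lemma conv_Z W K k (C : R) z : itg M W -> continuous K ->
  (forall y, `|K y| <= C) -> convol (fun y => k * W y) K z = k * convol W K z.
Proof.
move=> i1 cK KC; rewrite /convol -I_Z; last exact: itg_conv_integrand KC.
by apply: eq_I => y; rewrite mulrA.
Qed.

(** Young's inequality: Tonelli exchanges the integrals, and translation invariance evaluates the
    inner integral of the kernel. *)
Lemma conv_L1 W K (C : R) : itg M W -> continuous K -> (forall y, 0 <= K y <= C) ->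
  itg M K -> itg M (convol W K) /\
  I M (fun z => `|convol W K z|) <= I M K * I M (fun y => `|W y|).
Proof.
move=> Wi cK K0C Ki.
have KC y : `|K y| <= C by have /andP[? ?] := K0C y; rewrite ger0_norm.
have K0 y : 0 <= K y by have /andP[] := K0C y.
have mW := itg_measurable Wi.
have mc := measurable_conv mW cK.
have aWi := itg_abs Wi.
have mWK : measurable_fun setT (fun p : BorelRV R n * BorelRV R n =>
    (`|W p.2| * K ((p.1 : 'rV[R]_n) - (p.2 : 'rV[R]_n)))%:E : \bar R).
  apply/measurable_EFinP; apply: (@measurable_conv_integrand (fun y => `|W y|)) => //.
  exact: (itg_measurable aWi).
have swap : (\int[M]_z \int[M]_y (`|W y| * K (z - y))%R%:E)%E =
    (I M K * I M (fun y => `|W y|))%:E.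
  have := @fubini_tonelli _ _ _ _ _ M M _ mWK.
  move=> -> /=; last by move=> p; rewrite lee_fin mulr_ge0.
  rewrite -I_Z// -itgE; last exact: itgZ.
  apply: eq_integral => y _.
  rewrite mulrC -I_Z//.
  have [i1 i2] := itg_shift (- y) (itgZ (`|W y|) Ki).
  by rewrite -i2 -itgE.
have ub : (\int[M]_z (`|convol W K z|)%:E <= (I M K * I M (fun y => `|W y|))%R%:E)%E.
  rewrite -swap; apply: ge0_le_integral => //.
  - by apply/measurable_EFinP; exact: measurableT_comp.
  - by apply: (measurable_fun_fubini_tonelli_F _ mWK) => p; rewrite lee_fin mulr_ge0.
  - move=> z _; have iz := itg_conv_integrand z Wi cK KC.
    have iz' := itg_conv_integrand z aWi cK KC.
    rewrite itgE// lee_fin; apply: le_trans (I_abs iz) _.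
    by apply: I_le => // [|y]; [exact: itg_abs|rewrite normrM (ger0_norm (K0 _))].
have ci : itg M (convol W K).
  apply: itgP => //; apply: le_lt_trans ub _; exact: ltry.
by split => //; rewrite -lee_fin -itgE//; exact: itg_abs.
Qed.

End Convolution.

(** * Convergence in L^1 of mollifications *)

Section Mollification.
Context {R : realType} {n : nat}.
Variable M : {sigma_finite_measure set (BorelRV R n) -> \bar R}.
Hypothesis M_nice : nice M.
Implicit Types (f g W : 'rV[R]_n -> R) (z : 'rV[R]_n).

(** Evenness allows [K (z - y)] to be written [K (y - z)], a mere translate of the kernel, whose
    mass is then known; [nice] speaks of translations and not of reflections. *)
Definition mollifier (K : nat -> 'rV[R]_n -> R) :=
  [/\ forall m, continuous (K m),
      forall m, exists C, forall y, 0 <= K m y <= C,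
      forall m y, K m (- y) = K m y,
      forall m, itg M (K m) /\ I M (K m) = 1 &
      forall m y, K m y != 0 -> cube (harmonic m) y].

Variable K : nat -> 'rV[R]_n -> R.
Hypothesis K_moll : mollifier K.

Let cK m : continuous (K m). Proof. by have [] := K_moll. Qed.
Let K0 m y : 0 <= K m y.
Proof. by have [_ /(_ m)[C /(_ y)/andP[]]] := K_moll. Qed.
Let Ki m : itg M (K m). Proof. by have [_ _ _ /(_ m)[]] := K_moll. Qed.
Let IK m : I M (K m) = 1. Proof. by have [_ _ _ /(_ m)[]] := K_moll. Qed.
Let Kbound m : exists C, forall y, `|K m y| <= C.
Proof.
have [_ /(_ m)[C HC] _ _ _] := K_moll; exists C => y.
by have /andP[? ?] := HC y; rewrite ger0_norm.
Qed.

Let conv_itg m f : itg M f -> itg M (convol M f (K m)) /\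
  I M (fun z => `|convol M f (K m) z|) <= I M (fun y => `|f y|).
Proof.
have [_ /(_ m)[C HC] _ _ _] := K_moll.
by move=> fi; have := conv_L1 M_nice fi (@cK m) HC (Ki m); rewrite IK mul1r.
Qed.

(** This class is stable under linear combinations and L^1 limits and is enlarged in turn from
    bounded open sets to bounded Borel sets, to simple functions and to all integrable functions. *)
Let approximable f := itg M f /\
  (fun m => I M (fun z => `|convol M f (K m) z - f z|)) @ \oo --> (0 : R).

(** An [e / 3] argument: mollification does not increase the L^1 norm, so replacing [f] by [g] costs
    the same amount before and after it. *)
Let approximable_lim f : itg M f ->
  (forall e, 0 < e -> exists g, approximable g /\ I M (fun z => `|f z - g z|) <= e) ->
  approximable f.
Proof.
move=> fi H; split => //; apply/cvgrPdist_le => e e0.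
have e3 : 0 < e / 3 by lra.
have [g [[gi gK] fg]] := H _ e3.
move/cvgrPdist_le : gK => /(_ _ e3); apply: filterS => m.
rewrite !sub0r !normrN !ger0_norm; [|exact: I_ge0..] => gm.
have [C KC] := Kbound m.
have fgi := itgB fi gi.
have [cfi _] := conv_itg m fi; have [cgi _] := conv_itg m gi.
have [_ cfg] := conv_itg m fgi.
have E z : convol M f (K m) z - f z =
    convol M (fun y => f y - g y) (K m) z + (convol M g (K m) z - g z) - (f z - g z).
  by rewrite (conv_B z fi gi (@cK m) KC); ring.
have H1 : itg M (fun z => `|convol M (fun y => f y - g y) (K m) z|).
  by apply: itg_abs; exact: (conv_itg m fgi).1.
have H2 : itg M (fun z => `|convol M g (K m) z - g z|) by apply: itg_abs; exact: itgB.
have H3 : itg M (fun z => `|f z - g z|) by exact: itg_abs.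
apply: (@le_trans _ _ (I M (fun z => `|convol M (fun y => f y - g y) (K m) z|
   + `|convol M g (K m) z - g z| + `|f z - g z|))).
  apply: I_le.
  - by apply: itg_abs; exact: itgB.
  - by apply: itgD => //; exact: itgD.
  - move=> z; rewrite E; apply: le_trans (ler_normB _ _) _.
    by rewrite lerD2r ler_normD.
rewrite I_D//; last exact: itgD.
rewrite I_D//; lra.
Qed.

Let approximable_D f g : approximable f -> approximable g ->
  approximable (fun z => f z + g z).
Proof.
move=> [fi fK] [gi gK]; split; first exact: itgD.
apply: (@cvg_abs0_le _ _ (fun m => I M (fun z => `|convol M f (K m) z - f z|) +
   I M (fun z => `|convol M g (K m) z - g z|))); last first.
  by rewrite -[X in _ --> X](addr0 (0 : R)); exact: cvgD.
move=> m; rewrite ger0_norm; last exact: I_ge0.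
have [cfi _] := conv_itg m fi; have [cgi _] := conv_itg m gi.
have [cfgi _] := conv_itg m (itgD fi gi).
have [C KC] := Kbound m.
rewrite -I_D; [|by apply: itg_abs; exact: itgB..].
apply: I_le.
- by apply: itg_abs; apply: itgB => //; exact: itgD.
- by apply: itgD; apply: itg_abs; exact: itgB.
- move=> z; rewrite (conv_D z fi gi (@cK m) KC) opprD addrACA; exact: ler_normD.
Qed.

Let approximable_Z k f : approximable f -> approximable (fun z => k * f z).
Proof.
move=> [fi fK]; split; first exact: itgZ.
have -> : (fun m => I M (fun z => `|convol M (fun z => k * f z) (K m) z - k * f z|)) =
    (fun m => `|k| * I M (fun z => `|convol M f (K m) z - f z|)).
  apply/funext => m; have [C KC] := Kbound m; have [cfi _] := conv_itg m fi.
  rewrite -I_Z; last by apply: itg_abs; exact: itgB.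
  by apply: eq_I => z; rewrite (conv_Z k z fi (@cK m) KC) -mulrBr normrM.
by rewrite -[X in _ --> X](mulr0 `|k|); apply: cvgM => //; exact: cvg_cst.
Qed.

Let approximable_sum (s : seq R) (F : R -> 'rV[R]_n -> R) :
  (forall y, approximable (F y)) -> approximable (fun z => \sum_(y <- s) F y z).
Proof.
move=> aF; elim: s => [|y s IH].
  under [X in approximable X]eq_fun do rewrite big_nil.
  have [y] : exists y : R, True by exists 0.
  have := approximable_Z 0 (aF 0).
  by under [X in approximable X]eq_fun do rewrite mul0r.
by under [X in approximable X]eq_fun do rewrite big_cons; exact: approximable_D.
Qed.

Lemma itg_indic_sub (A : set (BorelRV R n)) (r : R) : measurable A -> 0 < r ->
  itg M (\1_(A `&` cube r) : 'rV[R]_n -> R).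
Proof.
move=> mA r0; have mAr : measurable (A `&` cube r : set (BorelRV R n)).
  by apply: measurableI => //; exact: measurable_cube.
apply: itgP; first exact: measurable_indic.
under eq_integral do rewrite ger0_norm//.
rewrite integral_indic// setIT; apply: (@le_lt_trans _ _ (M (cube r))).
  by apply: le_measure; rewrite ?inE//; exact: measurable_cube.
by have [] := M_nice.1 r r0.
Qed.

Lemma ball0_cube (r : R) : 0 < r -> cube r = ball (0 : 'rV[R]_n) r.
Proof.
move=> r0; apply/seteqP; split => z.
  by move=> H; apply/(ball_rV _ _ r0) => i; rewrite mxE sub0r normrN; exact: H.
by move/(ball_rV _ _ r0) => H i; have := H i; rewrite mxE sub0r normrN.
Qed.

(** For [c = 1_A * K], with values in [[0, 1]] and integral at most that of [1_A], the distance to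
    [1_A] is [|A| + I c - 2 I (1_A c) <= 2 (|A| - I (1_A c))]. Only pointwise convergence on the
    open set [A] is therefore called for; points of its boundary never matter. *)
Let approximable_open (U : set 'rV[R]_n) (r : R) : open U -> 0 < r ->
  approximable (\1_(U `&` cube r)).
Proof.
move=> oU r0; pose A := U `&` cube r.
have oA : open A by apply: openI => //; rewrite ball0_cube//; exact: ball_open.
have Ai : itg M (\1_A : 'rV[R]_n -> R) by apply: itg_indic_sub => //; exact: open_measurable_rV.
split => //.
have mA : measurable_fun setT (\1_A : BorelRV R n -> R) by exact: itg_measurable Ai.
pose c m := convol M (\1_A) (K m).
have [ci cI] : (forall m, itg M (c m)) /\ forall m, I M (fun z => `|c m z|) <= I M (\1_A).
  split => m; have [h1 h2] := conv_itg m Ai => //.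
  by apply: le_trans h2 _; apply: I_le => //; [exact: itg_abs|move=> z; rewrite ger0_norm].
have c01 m z : 0 <= c m z <= 1.
  have [C KC] := Kbound m.
  have [_ _ Kev _ _] := K_moll.
  have [i1 i2] := itg_shift M_nice (- z) (Ki m).
  apply/andP; split; first by apply: I_ge0 => y; rewrite mulr_ge0.
  rewrite -(IK m) -i2; apply: I_le => //; first exact: itg_conv_integrand KC.
  by move=> y; rewrite -opprB Kev indicE; case: (_ \in _); rewrite ?mul1r// mul0r.
have cA z : A z -> (fun m => c m z) @ \oo --> (1 : R).
  move=> Az; have /nbhs_ballP[e /= e0 he] : nbhs z A by exact: open_nbhs_nbhs.
  apply/cvgrPdist_le => d d0.
  have /cvgrPdist_lt/(_ _ e0) := @cvg_harmonic R.
  apply: filterS => m; rewrite sub0r normrN ger0_norm ?harmonic_ge0// => hm.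
  suff -> : c m z = 1 by rewrite subrr normr0 ltW.
  have [_ _ Kev _ Ksupp] := K_moll.
  have [i1 i2] := itg_shift M_nice (- z) (Ki m).
  rewrite -(IK m) -i2; apply: eq_I => y; rewrite -(opprB y z) Kev.
  have [->|Kyz] := eqVneq (K m (y - z)) 0; first by rewrite mulr0.
  rewrite indicE mem_set ?mul1r//; apply: he; apply/ball_rV => // i.
  apply: le_lt_trans hm; rewrite distrC; have := Ksupp _ _ Kyz i.
  by rewrite !mxE; exact: ltW.
have prod_itg m : itg M (fun z => \1_A z * c m z).
  apply: (@itg_bound _ _ _ M \1_A (c m) 1) => //; first exact: itg_measurable.
  by move=> z; have /andP[? ?] := c01 m z; rewrite ger0_norm.
have lim : (fun m => I M (fun z => \1_A z * c m z)) @ \oo --> I M (\1_A).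
  have [] // := @I_dct _ _ _ M (fun m z => \1_A z * c m z) (\1_A) (\1_A).
  - by move=> m; exact: itg_measurable.
  - apply: aeW => z; rewrite indicE.
    rewrite [X in X @ _ --> _](_ : _ = fun m => (z \in A)%:R * c m z); last first.
      by apply/funext => m; rewrite ?indicE.
    case: (boolP (z \in A)) => [|_].
      by rewrite inE => /cA; under [X in _ -> X @ _ --> _]eq_fun do rewrite mul1r.
    by under eq_fun do rewrite mul0r; exact: cvg_cst.
  - move=> m z; have /andP[? ?] := c01 m z.
    by rewrite normrM ger0_norm// ger0_norm// ler_piMr.
apply: (@cvg_abs0_le _ _ (fun m => 2 * (I M (\1_A) - I M (fun z => \1_A z * c m z)))); last first.
  rewrite -[X in _ --> X](mulr0 (2 : R)) -(subrr (I M (\1_A))).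
  by apply: cvgM; [exact: cvg_cst|apply: cvgB => //; exact: cvg_cst].
move=> m; rewrite ger0_norm; last exact: I_ge0.
have E z : `|convol M \1_A (K m) z - \1_A z| = \1_A z + c m z - 2 * (\1_A z * c m z).
  rewrite -/(c m z) indicE; have /andP[c0 c1] := c01 m z.
  case: (_ \in _); rewrite /= ?mulr1n ?mulr0n.
    by rewrite ler0_norm; [ring|rewrite subr_le0].
  by rewrite subr0 ger0_norm//; ring.
under eq_I do rewrite E.
rewrite I_B; [|exact: itgD|exact: itgZ].
rewrite I_D// I_Z//.
have := cI m; rewrite (_ : I M (fun z => `|c m z|) = I M (c m)); first lra.
by congr I; apply/funext => z; have /andP[c0 _] := c01 m z; rewrite ger0_norm.
Qed.

(** By the pi-lambda theorem: open sets are stable under intersection and generate the Borel sets,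
    and the class [H] is stable under proper differences and increasing unions. Intersecting with a
    cube keeps all indicators integrable. *)
Let approximable_indic (A : set (BorelRV R n)) (r : R) : measurable A -> 0 < r ->
  approximable (\1_(A `&` cube r)).
Proof.
move=> mA r0; pose H : set (set 'rV[R]_n) :=
  [set B : set 'rV[R]_n | measurable (B : set (BorelRV R n)) /\ approximable (\1_(B `&` cube r))].
have Hseq (F : nat -> set 'rV[R]_n) : nondecreasing_seq F -> (forall k, H (F k)) ->
    H (\bigcup_k F k).
  move=> ndF HF.
  have mF k : measurable (F k : set (BorelRV R n)) by have [] := HF k.
  have mUF : measurable (\bigcup_k F k : set (BorelRV R n)) by exact: bigcup_measurable.
  split => //; apply: approximable_lim; first exact: itg_indic_sub.
  move=> e e0.
  have lim : (fun k => I M (fun z => `|\1_(F k `&` cube r) z - \1_(\bigcup_k F k `&` cube r) z|))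
      @ \oo --> (0 : R).
    apply: (@itg_ae_dct _ _ _ M (fun k => \1_(F k `&` cube r))
      (\1_(\bigcup_k F k `&` cube r)) (\1_(cube r))).
    - by move=> k; exact: (itg_measurable (itg_indic_sub (mF k) r0)).
    - exact: (itg_measurable (itg_indic_sub mUF r0)).
    - apply: aeW => z; rewrite !indicE.
      case: (boolP (z \in \bigcup_k F k `&` cube r)) => zU.
        move: zU; rewrite inE => -[[k _ Fkz] zr].
        apply/cvgrPdist_le => d d0; exists k => // m /= km.
        rewrite indicE mem_set ?subrr ?normr0 1?ltW//; split => //.
        by move/subsetPset : (ndF _ _ km); exact.
      rewrite [X in X @ _ --> _](_ : _ = fun=> 0); first exact: cvg_cst.
      apply/funext => k; rewrite indicE memNset// => -[Fkz zr].
      by move/negP : zU; apply; rewrite inE; split => //; exists k.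
    - by rewrite -[cube r]setTI; exact: itg_indic_sub.
    - move=> k z; rewrite !indicE !in_setI.
      case: (z \in cube r); rewrite ?andbF ?subrr ?normr0// !andbT.
      by do 2 case: (_ \in _); rewrite /= ?subrr ?subr0 ?sub0r ?normrN ?normr0 ?normr1.
  move/cvgrPdist_le : lim => /(_ _ e0) [k _ /(_ k (leqnn k))].
  rewrite /= sub0r normrN ger0_norm; last exact: I_ge0.
  move=> He; exists (\1_(F k `&` cube r)); split; first by have [] := HF k.
  by under eq_I do rewrite distrC.
suff : <<s (@open 'rV[R]_n) >> `<=` H by move=> /(_ A mA)[].
apply: lambda_system_subset => //; first by move=> B C; exact: openI.
  split => //.
  - split => //; rewrite setTI -(setTI (cube r)).
    by apply: approximable_open => //; exact: openT.
  - move=> B C CB [mB aB] [mC aC]; split; first exact: measurableD.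
    have := approximable_D aB (approximable_Z (-1) aC).
    congr approximable; apply/funext => z; rewrite !indicE (in_setI z B) (in_setI z C)
      (in_setI z (B `\` C)) classical_sets.in_setD.
    case: (boolP (z \in cube r)) => zr; rewrite ?andbF ?mulr0 ?addr0// !andbT.
    case: (boolP (z \in C)) => zC.
      by rewrite (mem_set (CB _ (set_mem zC))) /= mulr1 subrr.
    by rewrite mulr0 addr0 /= andbT.
by move=> U oU; split; [exact: open_measurable_rV|exact: approximable_open].
Qed.

Import HBSimple.

Lemma mollify_cvg f : itg M f ->
  (fun m => I M (fun z => `|convol M f (K m) z - f z|)) @ \oo --> (0 : R).
Proof.
move=> fi; suff : approximable f by case.
apply: approximable_lim => // e e0.
have e2 : 0 < e / 2 by lra.
have [s [si _ sf]] := approximation_sfun_integrable measurableT fi.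
have sii m : itg M (s m) by exact: si.
have {sf} [m fsm] : exists m, I M (fun z => `|f z - s m z|) <= e / 2.
  have : (fun m => I M (fun z => `|f z - s m z|)) @ \oo --> (0 : R).
    by move/fine_cvgP : sf => [_].
  move/cvgrPdist_le => /(_ _ e2) [m _ /(_ m (leqnn m))].
  by rewrite /= sub0r normrN ger0_norm; [exists m|exact: I_ge0].
(* The level set of the value 0 may have infinite mass; after truncation to a cube, every level set
   in the decomposition below is covered by [approximable_indic]. *)
pose g k z := s m z * \1_(cube k.+1%:R) z.
have mg k : measurable_fun setT (g k : BorelRV R n -> R).
  apply: measurable_funM; first exact: itg_measurable.
  by apply: measurable_indic; exact: measurable_cube.
have lim : (fun k => I M (fun z => `|g k z - s m z|)) @ \oo --> (0 : R).
  apply: (@itg_ae_dct _ _ _ M g (s m) (fun z => `|s m z|)) => //.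
  - apply: aeW => z.
    have : (\bigcup_(k : nat) cube k.+1%:R) z by rewrite cube_cover.
    move=> [k _ kz]; apply/cvgrPdist_le => d d0; exists k => // l /= kl.
    rewrite /g indicE mem_set ?mulr1 ?subrr ?normr0 1?ltW// => i.
    by apply: lt_le_trans (kz i) _; rewrite ler_nat ltnS.
  - exact: itg_abs.
  - move=> k z; rewrite /g indicE; case: (_ \in _); rewrite ?mulr1 ?mulr0 ?subrr ?normr0//.
    by rewrite sub0r normrN.
move/cvgrPdist_le : lim => /(_ _ e2) [k _ /(_ k (leqnn k))].
rewrite /= sub0r normrN ger0_norm; last exact: I_ge0.
move=> Hk; exists (g k); split; last first.
  have gi : itg M (g k).
    apply: (@itg_le _ _ _ M (g k) (fun z => `|s m z|)) => //; last exact: itg_abs.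
    by move=> z; rewrite /g normrM indicE; case: (_ \in _); rewrite ?normr1 ?mulr1// normr0 mulr0.
  apply: (@le_trans _ _ (I M (fun z => `|f z - s m z| + `|g k z - s m z|))).
    apply: I_le.
    - by apply: itg_abs; exact: itgB.
    - by apply: itgD; apply: itg_abs; exact: itgB.
    - by move=> z; rewrite (distrC (g k z)); exact: ler_distD.
  rewrite I_D; [lra|by apply: itg_abs; exact: itgB..].
have -> : g k = fun z : 'rV[R]_n => \sum_(y <- finmap.enum_fset (fset_set (range (s m))))
     y * \1_((s m @^-1` [set y]) `&` cube k.+1%:R) z.
  apply/funext => z; rewrite /g {1}(fimfunE (s m) z) fsbig_finite//= mulr_suml.
  by apply: eq_bigr => y _; rewrite indicI -mulrA.
by apply: approximable_sum => y; apply: approximable_Z; apply: approximable_indic.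
Qed.

End Mollification.

(** * Bump functions and supports *)

Section Bumps.
Context {R : realType} {n : nat}.
Implicit Types (a b z : 'rV[R]_n).

(** A piecewise polynomial cut-off, nonzero exactly on the open box with corners [a] and [b]. It is
    used as a mollifier and, later, to describe open sets. *)
Definition box_bump a b z : R :=
  \prod_(i < n) (pospart (z ord0 i - a ord0 i) ^+ 3 * pospart (b ord0 i - z ord0 i) ^+ 3).

Lemma is_derive_affine (c d s : R) : is_derive s 1 (fun s : R => c * s + d) c.
Proof. by apply: is_derive_eq; rewrite /GRing.scale /=; ring. Qed.

Lemma C2_pospart3 (i : 'I_n) (c d : R) :
  C2 (fun z => pospart (c * z ord0 i + d) ^+ 3)
    (fun k z => (i == k)%:R * (3 * c * pospart (c * z ord0 i + d) ^+ 2))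
    (fun k l z => (i == k)%:R * ((i == l)%:R * (6 * c ^+ 2 * pospart (c * z ord0 i + d)))).
Proof.
apply: (@C2_coord R n i (fun s => pospart (c * s + d) ^+ 3)
  (fun s => 3 * c * pospart (c * s + d) ^+ 2) (fun s => 6 * c ^+ 2 * pospart (c * s + d))).
- move=> s; have H := @is_derive1_comp _ (fun s => pospart s ^+ 3) (fun s : R => c * s + d)
    s _ _ (is_derive_pospart3 _) (is_derive_affine c d s).
  by apply: is_derive_eq H _; ring.
- move=> s; have H := @is_derive1_comp _ (fun s => pospart s ^+ 2) (fun s : R => c * s + d)
    s _ _ (is_derive_pospart2 _) (is_derive_affine c d s).
  have H2 := @is_deriveZ _ _ _ _ (3 * c) _ _ _ H.
  by apply: is_derive_eq H2 _; rewrite /GRing.scale /=; ring.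
- move=> s; apply: cvgM; first exact: cvg_cst.
  have ca := is_derive1_continuous (is_derive_affine c d).
  exact: (continuous_comp (ca s) (@continuous_pospart R _)).
Qed.

Lemma smooth2_pospart3 (i : 'I_n) (c d : R) :
  smooth2 (fun z => pospart (c * z ord0 i + d) ^+ 3).
Proof. by eexists; eexists; exact: C2_pospart3. Qed.

Lemma smooth2_bump a b : smooth2 (box_bump a b).
Proof.
apply: smooth2_prod => i; apply: smooth2_mul.
  have := smooth2_pospart3 i 1 (- a ord0 i).
  by under eq_fun do rewrite mul1r.
have := smooth2_pospart3 i (-1) (b ord0 i).
by under eq_fun do rewrite mulN1r addrC.
Qed.

Lemma bump_ge0 a b z : 0 <= box_bump a b z.
Proof. by apply: prodr_ge0 => i _; rewrite mulr_ge0// exprn_ge0// pospart_ge0. Qed.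

Lemma bump_neq0 a b z :
  box_bump a b z != 0 <-> forall i, a ord0 i < z ord0 i < b ord0 i.
Proof.
split=> [|H]; last first.
  apply/prodf_neq0 => i _; have /andP[? ?] := H i.
  by rewrite mulf_neq0// expf_neq0// gt_eqF// pospart_gt0 subr_gt0.
move=> /prodf_neq0 H i; have := H i isT.
rewrite mulf_eq0 negb_or !expf_eq0 /= => /andP[h1 h2].
have := pospart_ge0 (z ord0 i - a ord0 i); rewrite le_eqVlt eq_sym (negPf h1) /=.
have := pospart_ge0 (b ord0 i - z ord0 i); rewrite le_eqVlt eq_sym (negPf h2) /=.
by rewrite !pospart_gt0 !subr_gt0 => -> ->.
Qed.

End Bumps.

Section Supports.
Context {R : realType} {n : nat}.
Implicit Types (G : set 'rV[R]_n) (f : 'rV[R]_n -> R) (z : 'rV[R]_n).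

Lemma cube_norm (r : R) z : 0 < r -> cube r z -> `|z| < r.
Proof. by move=> r0; rewrite ball0_cube// -ball_normE /= sub0r normrN. Qed.

Lemma norm_cube (r : R) z : `|z| < r -> cube r z.
Proof.
move=> zr; have r0 : 0 < r by exact: le_lt_trans zr.
by rewrite ball0_cube// -ball_normE /= sub0r normrN.
Qed.

(** A compact subset of [G] when [r > 0], with an explicit margin [r] in the sup norm. Half of that
    margin is spent on mollification in the proof of Kato's inequality. *)
Definition inner G (r B : R) : set 'rV[R]_n :=
  [set z | `|z| <= B /\ ball z r `<=` G].

Definition supported G f := exists r B : R, 0 < r /\ forall z, f z != 0 -> inner G r B z.

Lemma ball_norm_lt z z' (r : R) : ball z r z' <-> `|z - z'| < r.
Proof. by rewrite -ball_normE. Qed.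

Lemma closed_inner G r B : closed (inner G r B).
Proof.
move=> z Hz; split.
  have cK : closed [set z : 'rV[R]_n | `|z| <= B].
    have -> : [set z : 'rV[R]_n | `|z| <= B] = Num.norm @^-1` [set x | x <= B] by [].
    apply: closed_comp; last exact: closed_le.
    by move=> ? _; exact: norm_continuous.
  apply: cK => U Uz; have [y [[yB _] Uy]] := Hz U Uz.
  by exists y.
move=> z' /ball_norm_lt zz'.
have e0 : 0 < r - `|z - z'| by lra.
have [y [[_ yG] zy]] := Hz _ (nbhsx_ballx z _ e0).
apply: yG; apply/ball_norm_lt; move/ball_norm_lt : zy => zy.
by have := ler_distD z y z'; rewrite (distrC y z); lra.
Qed.

Lemma measurable_inner G r B : measurable (inner G r B : set (BorelRV R n)).
Proof.
rewrite -[inner _ _ _]setCK; apply: measurableC; apply: open_measurable_rV.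
by apply: closed_openC; exact: closed_inner.
Qed.

Lemma inner_near G (r B e : R) z y : 0 < e -> inner G r B z -> `|z - y| < e ->
  inner G (r - e) (B + e) y.
Proof.
move=> e0 [zB zG] zy; split.
  by have := ler_normB z (z - y); rewrite subKr; lra.
move=> w /ball_norm_lt yw; apply: zG; apply/ball_norm_lt.
by have := ler_distD y z w; lra.
Qed.

(** Each derivative is continuous with support in the same compact set, hence bounded; summing the
    bounds over the finitely many indices gives one constant for all of them. *)
Lemma supported_C2 G f d1 d2 : C2 f d1 d2 -> supported G f ->
  exists r B C : R, [/\ 0 < r,
    forall z, f z != 0 -> inner G r B z,
    forall i z, d1 i z != 0 -> inner G r B z,
    forall i j z, d2 i j z != 0 -> inner G r B z &
    [/\ forall z, `|f z| <= C, forall i z, `|d1 i z| <= C &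
        forall i j z, `|d2 i j z| <= C]].
Proof.
move=> C2f [r [B [r0 Hf]]].
have [H1 H2] := C2_support C2f (@closed_inner G r B) Hf.
have [_ _ cf c1 c2] := C2f.
have [C0 HC0] : exists C, forall z, `|f z| <= C.
  by apply: (@continuous_support_bounded _ _ f B) => // z /Hf[].
have /choice[C1 HC1] : forall i, exists C, forall z, `|d1 i z| <= C.
  by move=> i; apply: (@continuous_support_bounded _ _ (d1 i) B) => // z /H1[].
have /choice[C2' HC2] : forall p : 'I_n * 'I_n, exists C, forall z, `|d2 p.1 p.2 z| <= C.
  by move=> p; apply: (@continuous_support_bounded _ _ (d2 p.1 p.2) B) => // z /H2[].
have S1 i : C1 i <= \sum_i `|C1 i|.
  by rewrite (bigD1 i)//= (le_trans (ler_norm _))// lerDl sumr_ge0.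
have S2 p : C2' p <= \sum_p `|C2' p|.
  by rewrite (bigD1 p)//= (le_trans (ler_norm _))// lerDl sumr_ge0.
have P0 : 0 <= `|C0| by []. have P1 : 0 <= \sum_i `|C1 i| by exact: sumr_ge0.
have P2 : 0 <= \sum_p `|C2' p| by exact: sumr_ge0.
exists r, B, (`|C0| + \sum_i `|C1 i| + \sum_p `|C2' p|); split => //; split.
- by move=> z; have := HC0 z; have := ler_norm C0; lra.
- by move=> i z; have := HC1 i z; have := S1 i; lra.
- by move=> i j z; have := HC2 (i, j) z; have := S2 (i, j) => /=; lra.
Qed.

Variable M : {sigma_finite_measure set (BorelRV R n) -> \bar R}.
Hypothesis M_nice : nice M.

Lemma itg_bounded_support f (B C : R) :
  borel_fun f ->
  (forall z, `|f z| <= C) -> (forall z, f z != 0 -> `|z| <= B) -> itg M f.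
Proof.
move=> mf fC fB; have B1 : 0 < `|B| + 1 by rewrite ltr_wpDl.
have ci := itg_indic_sub M_nice (@measurableT _ (BorelRV R n)) B1.
apply: (@itg_le _ _ _ M f (fun z => C * \1_(setT `&` cube (`|B| + 1)) z)) => //; last exact: itgZ.
move=> z; have C0 : 0 <= C by exact: le_trans (fC z).
have [->|fz] := eqVneq (f z) 0; first by rewrite normr0 mulr_ge0.
rewrite indicE mem_set ?mulr1//; split => //; apply: norm_cube.
by have := fB _ fz; have := ler_norm B; lra.
Qed.

(** Box bumps on cubes of side [2 * harmonic m], divided by their mass; the mass is positive because
    cubes have positive measure. *)
Lemma mollifier_exists : exists K : nat -> 'rV[R]_n -> R,
  mollifier M K /\ forall m, smooth2 (K m).
Proof.
pose h m : R := harmonic m.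
have h0 m : 0 < h m by exact: harmonic_gt0.
pose eta m := box_bump (const_mx (- h m) : 'rV[R]_n) (const_mx (h m)).
have eta_supp m z : eta m z != 0 -> cube (h m) z.
  move/bump_neq0 => H i; have := H i; rewrite !mxE ltr_norml; lra.
have eta_c m : continuous (eta m).
  by have [d1 [d2 []]] := smooth2_bump (const_mx (- h m) : 'rV[R]_n) (const_mx (h m)).
have eta_norm m z : eta m z != 0 -> `|z| <= h m.
  by move/eta_supp => /(cube_norm (h0 m))/ltW.
have eta_b m : exists C, forall z, `|eta m z| <= C.
  exact: (continuous_support_bounded (eta_c m) (eta_norm m)).
have eta_i m : itg M (eta m).
  have [C HC] := eta_b m.
  exact: (itg_bounded_support (continuous_measurable_rV (eta_c m)) HC (eta_norm m)).
have eta_pos m : 0 < I M (eta m).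
  have hm2 : 0 < h m / 2 by have := h0 m; lra.
  (* On the cube of half the size, both [z_i + h] and [h - z_i] are at least [h / 2], so [c] bounds
     the bump from below there. *)
  pose c := \prod_(i < n) ((h m / 2) ^+ 3 * (h m / 2) ^+ 3).
  have c0 : 0 < c by apply: prodr_gt0 => i _; rewrite mulr_gt0// exprn_gt0.
  have ci := itg_indic_sub M_nice (@measurableT _ (BorelRV R n)) hm2.
  have ic : I M (\1_(setT `&` cube (h m / 2)) : 'rV[R]_n -> R) = fine (M (cube (h m / 2))).
    rewrite /I /Rintegral integral_indic ?setTI ?setIT//; first exact: measurable_cube.
  apply: (@lt_le_trans _ _ (c * I M (\1_(setT `&` cube (h m / 2)) : 'rV[R]_n -> R))).
    rewrite ic mulr_gt0// fine_gt0//; have [-> ->] := M_nice.1 _ hm2; exact: isT.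
  rewrite -I_Z//; apply: I_le => //; first exact: itgZ.
  move=> z; rewrite indicE setTI; case: (boolP (z \in cube (h m / 2))) => zc; last first.
    by rewrite mulr0 bump_ge0.
  rewrite mulr1; apply: ler_prod => i _; move: zc; rewrite inE => /(_ i).
  rewrite ltr_norml !mxE => /andP[z1 z2]; apply/andP; split.
    by rewrite mulr_ge0// exprn_ge0// ltW.
  have hp (s : R) : h m / 2 <= s -> (h m / 2) ^+ 3 <= pospart s ^+ 3.
    by move=> hs; rewrite lerXn2r ?nnegrE ?pospart_ge0 ?(ltW hm2)// /pospart le_max hs orbT.
  by apply: ler_pM; [exact/exprn_ge0/ltW|exact/exprn_ge0/ltW|apply: hp; lra|apply: hp; lra].
exists (fun m z => (I M (eta m))^-1 * eta m z); split; last first.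
  by move=> m; apply: smooth2_scale; exact: smooth2_bump.
split.
- by move=> m z; exact: cvgM (cvg_cst _) (eta_c m z).
- move=> m; have [C HC] := eta_b m; exists ((I M (eta m))^-1 * C) => y.
  apply/andP; split; first by rewrite mulr_ge0 ?bump_ge0// invr_ge0 ltW.
  by rewrite ler_pM2l ?invr_gt0//; exact: le_trans (ler_norm _) (HC y).
- move=> m y; congr (_ * _); apply: eq_bigr => i _; rewrite !mxE mulrC.
  by congr (pospart _ ^+ 3 * pospart _ ^+ 3); ring.
- move=> m; split; first exact: itgZ.
  by rewrite I_Z// mulVf// gt_eqF.
- move=> m y; rewrite mulf_eq0 negb_or => /andP[_]; exact: eta_supp.
Qed.

End Supports.

(** * Discrete integration by parts, and the heat operator as a limit of differences *)

Section Kato.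
Context {R : realType} {N : nat}.
Variable M : {sigma_finite_measure set (BorelRV R (N + 1)) -> \bar R}.
Hypothesis M_nice : nice M.
Implicit Types (f g W F K : 'rV[R]_(N + 1) -> R) (z : 'rV[R]_(N + 1)).

Local Notation tau := (rshift N (ord0 : 'I_1)).
Local Notation sp i := (lshift 1 (i : 'I_N)).

Lemma dopE (s h : R) f z : dop s f h z =
  h^-1 * (f z - f (z - (h * s) *: unitv tau)) -
  \sum_(i < N) (h ^+ 2)^-1 * (f (z + h *: unitv (sp i)) + f (z - h *: unitv (sp i)) - 2 * f z).
Proof. by rewrite /dop mulrC; congr (_ - _); apply: eq_bigr => i _; rewrite mulrC. Qed.

Lemma itg_shiftN g (a : 'rV[R]_(N + 1)) : itg M g -> itg M (fun z => g (z - a)).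
Proof. by move=> gi; have [] := itg_shift M_nice (- a) gi. Qed.

Lemma itg_dop (s h : R) g : itg M g -> itg M (dop s g h).
Proof.
move=> gi; have -> : dop s g h = (fun z =>
    h^-1 * (g z - g (z - (h * s) *: unitv tau)) - \sum_(i < N) (h ^+ 2)^-1 *
    (g (z + h *: unitv (sp i)) + g (z - h *: unitv (sp i)) - 2 * g z)).
  by apply/funext => z; exact: dopE.
apply: itgB.
  by apply: itgZ; apply: itgB => //; exact: itg_shiftN.
apply: itg_sum => i; apply: itgZ; apply: itgB; last exact: itgZ.
by apply: itgD; [exact: (itg_shift M_nice _ gi).1|exact: itg_shiftN].
Qed.

(** Both sides expand into translates. The products [f z * g z] cancel, and what remains is a
    combination of the functions [term a], each of integral 0 by a translation by [- a]. *)
Lemma dop_adjoint (h C : R) g f : itg M g -> continuous f -> (forall z, `|f z| <= C) ->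
  I M (fun z => f z * dop 1 g h z) = I M (fun z => g z * dop (-1) f h z).
Proof.
move=> gi cf fC.
have mf := continuous_measurable_rV cf.
have P1 (a : 'rV[R]_(N + 1)) : itg M (fun z => f z * g (z + a)).
  apply: eq_itg (itg_bound mf fC (itg_shift M_nice a gi).1) => z; exact: mulrC.
have cshift (a : 'rV[R]_(N + 1)) : continuous (fun z : 'rV[R]_(N + 1) => f (z - a)).
  have cN : continuous (fun y : 'rV[R]_(N + 1) => f (- y)).
    by have := @continuous_reflect _ _ f 0 cf; under eq_fun do rewrite sub0r.
  have := @continuous_reflect _ _ (fun y => f (- y)) a cN.
  by under eq_fun do rewrite opprB.
pose term (a : 'rV[R]_(N + 1)) z := f z * g (z + a) - g z * f (z - a).
have P2 (a : 'rV[R]_(N + 1)) : itg M (fun z => g z * f (z - a)).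
  exact: (itg_bound (continuous_measurable_rV (cshift a)) (fun z => fC (z - a)) gi).
have Pt a : itg M (term a) by exact: itgB.
have It a : I M (term a) = 0.
  rewrite I_B//; apply/eqP; rewrite subr_eq0; apply/eqP.
  have [_ <-] := itg_shift M_nice (- a) (P1 a).
  by congr I; apply/funext => z; rewrite subrK mulrC.
have i1 : itg M (fun z => f z * dop 1 g h z).
  apply: eq_itg (itg_bound mf fC (itg_dop 1 h gi)) => z; exact: mulrC.
apply/eqP; rewrite -subr_eq0; apply/eqP.
pose e i : 'rV[R]_(N + 1) := h *: unitv (sp i).
pose t : 'rV[R]_(N + 1) := h *: unitv tau.
have E z : f z * dop 1 g h z - g z * dop (-1) f h z =
    - h^-1 * term (- t) z - \sum_(i < N) (h ^+ 2)^-1 * (term (e i) z + term (- e i) z).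
  rewrite !dopE mulr1 mulrN1 scaleNr opprK -/t !mulrBr !mulr_sumr.
  have -> : \sum_(i < N) (h ^+ 2)^-1 * (term (e i) z + term (- e i) z) =
     \sum_(i < N) f z * ((h ^+ 2)^-1 * (g (z + e i) + g (z - e i) - 2 * g z)) -
     \sum_(i < N) g z * ((h ^+ 2)^-1 * (f (z + e i) + f (z - e i) - 2 * f z)).
    rewrite -sumrB; apply: eq_bigr => i _; rewrite /term opprK; ring.
  rewrite /term opprK; ring.
have i2 : itg M (fun z => g z * dop (-1) f h z).
  have -> : (fun z => g z * dop (-1) f h z) = (fun z => f z * dop 1 g h z -
     (- h^-1 * term (- t) z - \sum_(i < N) (h ^+ 2)^-1 * (term (e i) z + term (- e i) z))).
    by apply/funext => z; rewrite -E; ring.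
  apply: itgB => //; apply: itgB; first exact: itgZ.
  by apply: itg_sum => i; apply: itgZ; exact: itgD.
rewrite -I_B//.
under [X in I M X]eq_fun do rewrite E.
rewrite I_B; [|exact: itgZ|by apply: itg_sum => i; apply: itgZ; exact: itgD].
rewrite I_Z// It mulr0 sub0r I_sum; last by move=> i; apply: itgZ; exact: itgD.
rewrite big1 ?oppr0// => i _.
by rewrite I_Z; [rewrite I_D// !It addr0 mulr0|exact: itgD].
Qed.

Lemma measurable_dop (s h : R) f :
  borel_fun f ->
  borel_fun (dop s f h).
Proof.
move=> mf.
have mfs (a : 'rV[R]_(N + 1)) : measurable_fun [set: BorelRV R (N + 1)]
    (fun z : BorelRV R (N + 1) => f ((z : 'rV[R]_(N + 1)) + a)).
  exact: (measurableT_comp mf (measurable_rshift a)).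
have -> : dop s f h = (fun z =>
    h^-1 * (f z - f (z - (h * s) *: unitv tau)) - \sum_(i < N) (h ^+ 2)^-1 *
    (f (z + h *: unitv (sp i)) + f (z - h *: unitv (sp i)) - 2 * f z)).
  by apply/funext => z; exact: dopE.
apply: measurable_funB.
  by apply: measurable_funM => //; apply: measurable_funB => //; exact: mfs.
apply: measurable_sum => i; apply: measurable_funM => //.
apply: measurable_funB; last exact: measurable_funM.
by apply: measurable_funD; exact: mfs.
Qed.

Lemma measurable_reflect (z : 'rV[R]_(N + 1)) :
  measurable_fun setT (fun y : BorelRV R (N + 1) =>
    (z - (y : 'rV[R]_(N + 1)) : BorelRV R (N + 1))).
Proof.
apply: measurable_fun_rV => i; under eq_fun do rewrite !mxE.
by apply: measurable_funB => //; exact: coord_measurable.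
Qed.

Lemma dop_conv (C h : R) W K z : itg M W -> continuous K -> (forall y, `|K y| <= C) ->
  dop 1 (convol M W K) h z = I M (fun y => W y * dop 1 K h (z - y)).
Proof.
move=> Wi cK KC.
have P a : itg M (fun y => W y * K (z + a - y)) by exact: itg_conv_integrand KC.
have P' a : itg M (fun y => W y * K (z - a - y)) by exact: itg_conv_integrand KC.
have P0 : itg M (fun y => W y * K (z - y)) by exact: itg_conv_integrand KC.
have -> : (fun y => W y * dop 1 K h (z - y)) = (fun y =>
    h^-1 * (W y * K (z - y) - W y * K (z - (h * 1) *: unitv tau - y)) -
    \sum_(i < N) (h ^+ 2)^-1 * (W y * K (z + h *: unitv (sp i) - y) +
       W y * K (z - h *: unitv (sp i) - y) - 2 * (W y * K (z - y)))).
  apply/funext => y; rewrite dopE mulrBr mulr_sumr; congr (_ - _).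
    by rewrite (addrAC z (- y)); ring.
  apply: eq_bigr => i _.
  by rewrite (addrAC z (- y)) (addrAC z (- y) (- _)); ring.
have Pi i : itg M (fun y => W y * K (z + h *: unitv (sp i) - y) +
       W y * K (z - h *: unitv (sp i) - y) - 2 * (W y * K (z - y))).
  by apply: itgB; [exact: itgD|exact: itgZ].
rewrite I_B; first last.
- by apply: itg_sum => i; exact: itgZ.
- by apply: itgZ; exact: itgB.
rewrite I_Z; last exact: itgB.
rewrite I_B// I_sum; last by move=> i; exact: itgZ.
rewrite dopE; congr (_ - _); apply: eq_bigr => i _.
rewrite I_Z// I_B; [|exact: itgD|exact: itgZ].
by rewrite I_D// I_Z.
Qed.

Lemma heat_continuous (s : R) f d1 d2 : C2 f d1 d2 -> continuous (@heat R N s d1 d2).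
Proof.
move=> [_ _ _ c1 c2].
have sumc m (G : 'I_m -> 'rV[R]_(N + 1) -> R) : (forall i, continuous (G i)) ->
    continuous (fun w => \sum_(i < m) G i w).
  elim: m G => [|m IH] G cG.
    by under eq_fun do rewrite big_ord0; exact: cst_continuous.
  under eq_fun do rewrite big_ord_recl.
  by move=> w; exact: cvgD (cG ord0 w) (IH _ (fun i => cG (lift ord0 i)) w).
have c1' : continuous (fun z => s * d1 tau z).
  by move=> w; exact: cvgM (cvg_cst _) (c1 _ w).
have c2' := sumc _ (fun i => d2 (sp i) (sp i)) (fun i => c2 _ _).
by move=> z; exact: cvgB (c1' z) (c2' z).
Qed.

Lemma heat_bound (s C : R) (d1 : 'I_(N + 1) -> 'rV[R]_(N + 1) -> R) d2 z : `|s| = 1 ->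
  (forall i z, `|d1 i z| <= C) -> (forall i j z, `|d2 i j z| <= C) ->
  `|@heat R N s d1 d2 z| <= C + C *+ N.
Proof.
move=> s1 b1 b2; apply: le_trans (ler_normB _ _) _; apply: lerD.
  by rewrite normrM s1 mul1r.
apply: le_trans (ler_norm_sum _ _ _) _.
apply: (@le_trans _ _ (\sum_(i < N) C)); first by apply: ler_sum => i _; exact: b2.
by rewrite sumr_const card_ord.
Qed.

(** Difference quotients of the convolution fall on the kernel and converge there with a uniform
    bound, so the limit is reached without differentiating the convolution itself. *)
Lemma cvg_dop_conv (C : R) W K k1 k2 z : itg M W -> C2 K k1 k2 ->
  (forall y, `|K y| <= C) -> (forall i y, `|k1 i y| <= C) -> (forall i j y, `|k2 i j y| <= C) ->
  (fun m => dop 1 (convol M W K) (harmonic m) z) @ \oo -->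
    I M (fun y => W y * heat 1 k1 k2 (z - y)).
Proof.
move=> Wi C2K KC k1C k2C.
have [_ _ cK _ _] := C2K.
have n1 : `|1 : R| = 1 by rewrite normr1.
have -> : (fun m => dop 1 (convol M W K) (harmonic m) z) =
    (fun m => I M (fun y => W y * dop 1 K (harmonic m) (z - y))).
  by apply/funext => m; exact: dop_conv KC.
have mh := continuous_measurable_rV (@continuous_reflect _ _ _ z (@heat_continuous 1 _ _ _ C2K)).
have mW := itg_measurable Wi.
apply: (@I_dct _ _ _ M (fun m y => W y * dop 1 K (harmonic m) (z - y)) _
   (fun y => (C + C *+ N) * `|W y|) _ _ _ _ _).2.
- move=> m; apply: measurable_funM => //.
  exact: (measurableT_comp (measurable_dop 1 (harmonic m) (continuous_measurable_rV cK))
    (measurable_reflect z)).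
- exact: measurable_funM.
- apply: aeW => y; apply: cvgM; first exact: cvg_cst.
  exact: dop_cvg.
- by apply: itgZ; exact: itg_abs.
- move=> m y; rewrite normrM mulrC ler_wpM2r//.
  by apply: dop_bound C2K _ _ _ _ => //; exact: harmonic_gt0.
Qed.

End Kato.

(** * Kato's inequality *)

Section KatoInequality.
Context {R : realType} {N : nat}.
Variable M : {sigma_finite_measure set (BorelRV R (N + 1)) -> \bar R}.
Hypothesis M_nice : nice M.
Implicit Types (f g W F K : 'rV[R]_(N + 1) -> R) (z : 'rV[R]_(N + 1)).
Variables (G : set 'rV[R]_(N + 1)) (W F : 'rV[R]_(N + 1) -> R).

Definition loc_itg F := forall r B : R, 0 < r -> itg M (fun z => F z * \1_(inner G r B) z).

Hypothesis Wi : itg M W.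
Hypothesis Fi : loc_itg F.
(** In the sense of distributions on [G]: the time derivative of [W] minus its Laplacian is at most
    [F]. *)
Hypothesis subsol : forall xi d1 d2, C2 xi d1 d2 -> supported G xi -> (forall z, 0 <= xi z) ->
  I M (fun z => W z * heat (-1) d1 d2 z) <= I M (fun z => F z * xi z).

Lemma loc_itg_mul F0 f (r B C : R) : loc_itg F0 -> 0 < r ->
  borel_fun f ->
  (forall z, `|f z| <= C) -> (forall z, f z != 0 -> inner G r B z) ->
  itg M (fun z => F0 z * f z).
Proof.
move=> F0i r0 mf fC fG; apply: eq_itg (itg_bound mf fC (F0i r B r0)) => z.
have [->|fz] := eqVneq (f z) 0; first by rewrite !mulr0.
by rewrite indicE mem_set ?mulr1//; exact: fG.
Qed.

Variables (j j' : R -> R).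
Hypothesis j_conv : forall a b, j' a * (b - a) <= j b - j a.
Hypothesis j'01 : forall a, 0 <= j' a <= 1.
Hypothesis cj' : continuous j'.
Hypothesis j0 : j 0 = 0.

Let j_lip a b : `|j b - j a| <= `|b - a|.
Proof.
have key x y : `|j' x * (y - x)| <= `|y - x|.
  by have /andP[? ?] := j'01 x; rewrite normrM ger0_norm// ler_piMl.
have h1 := j_conv a b; have h2 := j_conv b a.
have k1 := key a b; have k2 := key b a; rewrite (distrC a b) in k2.
have := ler_norm (- (j' b * (a - b))); rewrite normrN.
have := ler_norm (- (j' a * (b - a))); rewrite normrN.
by rewrite ler_norml => ? ?; apply/andP; split; lra.
Qed.

Let cj : continuous j.
Proof.
move=> x; apply/cvgrPdist_le => e e0; near=> y.
apply: le_trans (j_lip _ _) _; near: y.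
by apply: cvgr_dist_le; [exact: cvg_id|].
Unshelve. all: by end_near. Qed.

Let mj : measurable_fun setT j. Proof. exact: continuous_measurable_fun. Qed.
Let mj' : measurable_fun setT j'. Proof. exact: continuous_measurable_fun. Qed.

Let itg_j V : itg M V -> itg M (fun z => j (V z)).
Proof.
move=> Vi; apply: (@itg_le _ _ _ M (fun z => j (V z)) (fun z => `|V z|)).
- exact: (measurableT_comp mj (itg_measurable Vi)).
- by move=> z; have := j_lip 0 (V z); rewrite j0 !subr0.
- exact: itg_abs.
Qed.

Section FixedTest.
Variables (zeta : 'rV[R]_(N + 1) -> R) (d1 : 'I_(N + 1) -> 'rV[R]_(N + 1) -> R)
  (d2 : 'I_(N + 1) -> 'I_(N + 1) -> 'rV[R]_(N + 1) -> R).
Variables (r B C : R).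
Hypothesis zC2 : C2 zeta d1 d2.
Hypothesis z0 : forall z, 0 <= zeta z.
Hypothesis r0 : 0 < r.
Hypothesis zsupp : forall z, zeta z != 0 -> inner G r B z.
Hypothesis zC : forall z, `|zeta z| <= C.
Hypothesis d1C : forall i z, `|d1 i z| <= C.
Hypothesis d2C : forall i k z, `|d2 i k z| <= C.

(** [F] is only locally integrable and is cut off before being convolved. With a kernel supported in
    [cube (r / 2)], the cut-off is not seen at points where [zeta] is nonzero. *)
Let Ft z := F z * \1_(inner G (r / 2) (B + r / 2)) z.

Let r20 : 0 < r / 2. Proof. by rewrite divr_gt0. Qed.

Let Fti : itg M Ft. Proof. exact: Fi. Qed.

Let C0 : 0 <= C. Proof. exact: le_trans (zC 0). Qed.

Let mzeta : borel_fun zeta.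
Proof. by have [_ _ c _ _] := zC2; exact: continuous_measurable_rV. Qed.

Let zetai : itg M zeta.
Proof.
by apply: (itg_bounded_support M_nice (B := B) mzeta zC) => z /zsupp[].
Qed.

(** For [V = W * K] the inequality holds at each step [harmonic m]: [dop_adjoint] moves the operator
    off [zeta] and [dop_convex] applies the chain rule. Letting the step tend to 0 leaves [L], the
    heat operator applied to [V], which is bounded by testing the hypothesis on [W] with the
    translated, reflected kernel. *)
Let kato_mollified K : smooth2 K -> continuous K -> (forall y, 0 <= K y) ->
  (exists D, forall y, `|K y| <= D) -> itg M K ->
  (forall y, K y != 0 -> cube (r / 2) y) ->
  I M (fun z => j (convol M W K z) * heat (-1) d1 d2 z) <=
  I M (fun z => zeta z * j' (convol M W K z) * convol M Ft K z).
Proof.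
move=> [k1 [k2 KC2]] cK K0 [D0 KD0] Ki Ksupp.
have Knorm y : K y != 0 -> cube (r / 2) y by exact: Ksupp.
have Knorm' y : K y != 0 -> setT y /\ `|y| <= r / 2.
  by move/Ksupp => /(cube_norm r20)/ltW.
have Ksup : supported setT K.
  by exists 1, (r / 2); split => // y /Knorm'[_ ?]; split.
have [_ [_ [D [_ _ _ _ [KD k1D k2D]]]]] := supported_C2 KC2 Ksup.
set V := convol M W K.
have K0D y : 0 <= K y <= D by rewrite K0 (le_trans (ler_norm _) (KD y)).
have [Vi _] := conv_L1 M_nice Wi cK K0D Ki.
have [FKi _] := conv_L1 M_nice Fti cK K0D Ki.
have mV := itg_measurable Vi.
pose L z := I M (fun y => W y * heat 1 k1 k2 (z - y)).
have Llim z : (fun m => dop 1 V (harmonic m) z) @ \oo --> L z.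
  exact: cvg_dop_conv Wi KC2 KD k1D k2D.
have dopV m z : `|dop 1 V (harmonic m) z| <= (D + D *+ N) * I M (fun y => `|W y|).
  rewrite (dop_conv _ _ Wi cK KD).
  have dK y : `|dop 1 K (harmonic m) y| <= D + D *+ N.
    by apply: dop_bound KC2 _ _ _ _ => //; [exact: normr1|exact: harmonic_gt0].
  have WKi : itg M (fun y => W y * dop 1 K (harmonic m) (z - y)).
    apply: (@itg_bound _ _ _ M W (fun y => dop 1 K (harmonic m) (z - y)) (D + D *+ N)) => //.
    exact: (measurableT_comp (measurable_dop 1 (harmonic m) (continuous_measurable_rV cK))
      (measurable_reflect z)).
  apply: le_trans (I_abs WKi) _; rewrite -I_Z; last exact: itg_abs.
  apply: I_le; [exact: itg_abs|by apply: itgZ; exact: itg_abs|].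
  by move=> y; rewrite normrM mulrC ler_wpM2r.
have mj'V : borel_fun (fun z => j' (V z)).
  exact: (measurableT_comp mj' mV).
have heatC z : `|heat (-1) d1 d2 z| <= C + C *+ N.
  by apply: heat_bound => //; rewrite normrN1.
have mheat := continuous_measurable_rV (@heat_continuous _ _ (-1) _ _ _ zC2).
have left_lim : (fun m => I M (fun z => j (V z) * dop (-1) zeta (harmonic m) z)) @ \oo -->
    I M (fun z => j (V z) * heat (-1) d1 d2 z).
  have mjV : borel_fun (fun z => j (V z)) by exact: (measurableT_comp mj mV).
  apply: (@I_dct _ _ _ M (fun m z => j (V z) * dop (-1) zeta (harmonic m) z)
    (fun z => j (V z) * heat (-1) d1 d2 z) (fun z => (C + C *+ N) * `|V z|) _ _ _ _ _).2.
  - by move=> m; apply: measurable_funM => //; exact: measurable_dop.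
  - exact: measurable_funM.
  - apply: aeW => z; apply: cvgM; first exact: cvg_cst.
    by apply: dop_cvg zC2 _; rewrite normrN1.
  - by apply: itgZ; exact: itg_abs.
  - move=> m z; rewrite normrM mulrC; apply: ler_pM => //.
      by apply: dop_bound zC2 _ _ _ _ => //; [rewrite normrN1|exact: harmonic_gt0].
    by have := j_lip 0 (V z); rewrite j0 !subr0.
(* A bound on the difference quotients of [V] that depends neither on the step nor on the point;
   times the integrable [zeta], it dominates the right-hand sides. *)
pose E := (D + D *+ N) * I M (fun y => `|W y|).
have XE m z : `|j' (V z) * dop 1 V (harmonic m) z| <= E.
  have /andP[a0 a1] := j'01 (V z).
  rewrite normrM ger0_norm//; apply: le_trans (dopV m z).
  by rewrite ler_piMl.
have mdopV m := measurable_dop 1 (harmonic m) mV.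
have itg_right m : itg M (fun z => zeta z * j' (V z) * dop 1 V (harmonic m) z).
  apply: eq_itg (itg_bound (measurable_funM mj'V (mdopV m)) (XE m) zetai) => z.
  exact: mulrA.
have right_lim : (fun m => I M (fun z => zeta z * j' (V z) * dop 1 V (harmonic m) z)) @ \oo -->
    I M (fun z => zeta z * j' (V z) * L z) /\
    itg M (fun z => zeta z * j' (V z) * L z).
  have [] // := @I_dct _ _ _ M (fun m z => zeta z * j' (V z) * dop 1 V (harmonic m) z)
    (fun z => zeta z * j' (V z) * L z) (fun z => E * `|zeta z|).
  - by move=> m; exact: itg_measurable.
  - apply: measurable_funM; first exact: measurable_funM.
    exact: (@measurable_conv _ _ M W (heat 1 k1 k2) (itg_measurable Wi)
      (@heat_continuous _ _ 1 _ _ _ KC2)).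
  - by apply: aeW => z; apply: cvgM; [exact: cvg_cst|exact: Llim].
  - by apply: itgZ; exact: itg_abs.
  - by move=> m z; rewrite -mulrA normrM mulrC; apply: ler_pM.
have step m : I M (fun z => j (V z) * dop (-1) zeta (harmonic m) z) <=
    I M (fun z => zeta z * j' (V z) * dop 1 V (harmonic m) z).
  have [_ _ cz _ _] := zC2.
  rewrite -(dop_adjoint M_nice (harmonic m) (itg_j Vi) cz zC).
  apply: I_le => //.
    apply: eq_itg (itg_bound mzeta zC (itg_dop M_nice 1 (harmonic m) (itg_j Vi))) => z.
    exact: mulrC.
  move=> z; rewrite -mulrA; apply: ler_wpM2l => //.
  by apply: dop_convex => //; exact: harmonic_gt0.
apply: (@le_trans _ _ (I M (fun z => zeta z * j' (V z) * L z))).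
  by apply: (ler_cvg_to left_lim right_lim.1); apply: nearW => m; exact: step.
apply: I_le; first exact: right_lim.2.
  have zj'C z : `|zeta z * j' (V z)| <= C.
    have /andP[a0 a1] := j'01 (V z); rewrite normrM (ger0_norm a0).
    by apply: le_trans (zC z); rewrite ler_piMr.
  apply: eq_itg (itg_bound (measurable_funM mzeta mj'V) zj'C FKi) => z.
  exact: mulrC.
move=> z; have [->|zz] := eqVneq (zeta z) 0; first by rewrite !mul0r.
have /andP[j'0 _] := j'01 (V z).
apply: ler_wpM2l; first by rewrite mulr_ge0.
have xiC2 := C2_reflect z KC2.
have xi_near y : K (z - y) != 0 -> `|z - y| < r / 2.
  by move/Ksupp/(cube_norm r20).
have xi_supp y : K (z - y) != 0 -> inner G (r / 2) (B + r / 2) y.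
  move=> Ky; have := inner_near r20 (zsupp zz) (xi_near y Ky).
  by rewrite [X in inner _ X](_ : _ = r / 2); last lra.
have := subsol xiC2 _ (fun y => K0 _).
(* Reflection changes the sign of first derivatives and keeps the second ones, so the adjoint
   operator on the test function is the forward one on the kernel. *)
have -> : (fun y => W y * heat (-1) (fun i y => - k1 i (z - y)) (fun i l y => k2 i l (z - y)) y)
    = (fun y => W y * heat 1 k1 k2 (z - y)).
  by apply/funext => y; rewrite /heat mulN1r opprK mul1r.
have -> : (fun y => F y * K (z - y)) = (fun y => Ft y * K (z - y)).
  apply/funext => y; have [->|Ky] := eqVneq (K (z - y)) 0; first by rewrite !mulr0.
  by rewrite /Ft indicE mem_set ?mulr1//; exact: xi_supp.
by apply; exists (r / 2), (B + r / 2).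
Qed.

(** Removal of the mollification. On the left, [j] is 1-Lipschitz and L^1 convergence is enough; on
    the right, [j'] is merely continuous, so an almost everywhere convergent subsequence is
    extracted. *)
Let kato_fixed : I M (fun z => j (W z) * heat (-1) d1 d2 z) <=
  I M (fun z => zeta z * j' (W z) * Ft z).
Proof.
have [K [Kmoll Ksm]] := mollifier_exists M_nice.
have [cK Kb _ Ki Ksupp] := Kmoll.
have K0 m y : 0 <= K m y by have [D /(_ y)/andP[]] := Kb m.
have KD m : exists D, forall y, `|K m y| <= D.
  have [D HD] := Kb m; exists D => y; have /andP[? ?] := HD y.
  by rewrite ger0_norm.
pose V m := convol M W (K m).
pose FV m := convol M Ft (K m).
have Vi m : itg M (V m).
  by have [D HD] := Kb m; exact: (conv_L1 M_nice Wi (cK m) HD (Ki m).1).1.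
have FVi m : itg M (FV m).
  by have [D HD] := Kb m; exact: (conv_L1 M_nice Fti (cK m) HD (Ki m).1).1.
have VW := mollify_cvg M_nice Kmoll Wi.
have FVF := mollify_cvg M_nice Kmoll Fti.
have [s [sle VsW]] := L1_ae_subseq Vi Wi VW.
have mWj' := measurableT_comp mj' (itg_measurable Wi).
have mVj' m := measurableT_comp mj' (itg_measurable (Vi m)).
have zj'C (u : 'rV[R]_(N + 1) -> R) z : `|zeta z * j' (u z)| <= C.
  have /andP[a0 a1] := j'01 (u z); rewrite normrM (ger0_norm a0).
  by apply: le_trans (zC z); rewrite ler_piMr.
have heatC z : `|heat (-1) d1 d2 z| <= C + C *+ N.
  by apply: heat_bound => //; rewrite normrN1.
have mheat := continuous_measurable_rV (@heat_continuous _ _ (-1) _ _ _ zC2).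
have left_itg (u : 'rV[R]_(N + 1) -> R) : itg M u ->
    itg M (fun z => j (u z) * heat (-1) d1 d2 z).
  by move=> ui; exact: (itg_bound mheat heatC (itg_j ui)).
have left_lim : (fun k => I M (fun z => j (V (s k) z) * heat (-1) d1 d2 z)) @ \oo -->
    I M (fun z => j (W z) * heat (-1) d1 d2 z).
  apply: (@cvg_I_lip _ _ _ M (fun k z => j (V (s k) z) * heat (-1) d1 d2 z) (fun k => V (s k))
    (fun z => j (W z) * heat (-1) d1 d2 z) W (C + C *+ N) (fun k => left_itg _ (Vi (s k)))
    (left_itg _ Wi) (fun k => Vi (s k)) Wi _ (cvg_subseq sle VW)).
  by move=> k z; rewrite -mulrBl normrM mulrC; exact: ler_pM.
have right_itg (u : 'rV[R]_(N + 1) -> R) (f : 'rV[R]_(N + 1) -> R) :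
    borel_fun (fun z => j' (u z)) ->
    itg M f -> itg M (fun z => zeta z * j' (u z) * f z).
  move=> mu fi; apply: eq_itg (itg_bound (measurable_funM mzeta mu) (zj'C u) fi) => z.
  exact: mulrC.
have right1 : (fun k => I M (fun z => zeta z * j' (V (s k) z) * Ft z)) @ \oo -->
    I M (fun z => zeta z * j' (W z) * Ft z).
  apply: (@I_dct _ _ _ M (fun k z => zeta z * j' (V (s k) z) * Ft z)
    (fun z => zeta z * j' (W z) * Ft z) (fun z => C * `|Ft z|) _ _ _ _ _).2.
  - by move=> k; exact: (itg_measurable (right_itg _ _ (mVj' (s k)) Fti)).
  - exact: (itg_measurable (right_itg _ _ mWj' Fti)).
  - apply: filterS VsW => z Vz; apply: cvgM; last exact: cvg_cst.
    apply: cvgM; first exact: cvg_cst.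
    by apply: cvg_comp Vz _; exact: cj'.
  - by apply: itgZ; exact: itg_abs.
  - by move=> k z; rewrite normrM ler_wpM2r.
(* The two moving factors are treated one at a time: the convolution of [Ft] converges in L^1
   against a bounded factor, and [right1] then lets [j'] converge with [Ft] fixed. *)
have right2 : (fun k => I M (fun z => zeta z * j' (V (s k) z) * FV (s k) z) -
    I M (fun z => zeta z * j' (V (s k) z) * Ft z)) @ \oo --> (0 : R).
  apply: (@cvg_abs0_le _ _ (fun k => C * I M (fun z => `|FV (s k) z - Ft z|))).
    move=> k; rewrite -I_B; [|exact: (right_itg _ _ (mVj' (s k)))..].
    have i1 := itgB (right_itg _ _ (mVj' (s k)) (FVi (s k))) (right_itg _ _ (mVj' (s k)) Fti).
    apply: le_trans (I_abs i1) _.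
    rewrite -I_Z; last by apply: itg_abs; exact: itgB.
    apply: I_le; [exact: itg_abs|by apply: itgZ; apply: itg_abs; exact: itgB|].
    by move=> z; rewrite -mulrBr normrM ler_wpM2r.
  rewrite -[X in _ --> X](mulr0 C); apply: cvgM; first exact: cvg_cst.
  exact: (cvg_subseq sle FVF).
have right_lim := cvgD right2 right1; rewrite add0r in right_lim.
have {}right_lim : (fun k => I M (fun z => zeta z * j' (V (s k) z) * FV (s k) z)) @ \oo -->
    I M (fun z => zeta z * j' (W z) * Ft z).
  rewrite [X in X @ _ --> _](_ : _ = fun k =>
    (I M (fun z => zeta z * j' (V (s k) z) * FV (s k) z) -
      I M (fun z => zeta z * j' (V (s k) z) * Ft z)) +
    I M (fun z => zeta z * j' (V (s k) z) * Ft z)); first exact: right_lim.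
  by apply/funext => k; rewrite subrK.
apply: (ler_cvg_to left_lim right_lim).
(* From this index on, the kernels are supported in [cube (r / 2)], as [kato_mollified] requires. *)
have /cvgrPdist_lt/(_ _ r20) [k0 _ Hk0] := @cvg_harmonic R.
exists k0 => // k /= k0k.
apply: kato_mollified => //.
- exact: (Ki _).1.
- move=> y /Ksupp Hy i; apply: lt_le_trans (Hy i) _.
  have := Hk0 (s k) (leq_trans k0k (sle k)).
  by rewrite /= sub0r normrN ger0_norm ?harmonic_ge0// => /ltW.
Qed.

Lemma kato_fixed_test : I M (fun z => j (W z) * heat (-1) d1 d2 z) <=
  I M (fun z => F z * (zeta z * j' (W z))).
Proof.
apply: le_trans kato_fixed _; rewrite le_eqVlt; apply/orP; left; apply/eqP.
congr I; apply/funext => z; have [->|zz] := eqVneq (zeta z) 0; first by rewrite !mul0r mulr0.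
rewrite mulrC; congr (_ * _); rewrite /Ft indicE mem_set ?mulr1//.
have [zB zG] := zsupp zz; have rp := r0; split; first lra.
move=> y /ball_norm_lt zy; apply: zG; apply/ball_norm_lt; lra.
Qed.

End FixedTest.

Lemma kato_convex zeta d1 d2 : C2 zeta d1 d2 -> supported G zeta ->
  (forall z, 0 <= zeta z) ->
  I M (fun z => j (W z) * heat (-1) d1 d2 z) <= I M (fun z => F z * (zeta z * j' (W z))).
Proof.
move=> zC2 zs z0; have [r [B [C [r0 zsupp _ _ [zC d1C d2C]]]]] := supported_C2 zC2 zs.
exact: (kato_fixed_test zC2 z0 r0 zsupp zC d1C d2C).
Qed.

End KatoInequality.

(** * From convex functions to the positive part *)

Section KatoPositivePart.
Context {R : realType} {N : nat}.
Variable M : {sigma_finite_measure set (BorelRV R (N + 1)) -> \bar R}.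
Hypothesis M_nice : nice M.

(* [x - e + e^2 / (x + e)], with [x] the positive part of [t]: a C^1 convex
   approximation of the positive part. *)
Definition smooth_pos (e t : R) : R := pospart t - e + e ^+ 2 / (pospart t + e).
Definition smooth_pos' (e t : R) : R := 1 - (e / (pospart t + e)) ^+ 2.

(** In terms of the positive parts [x] and [y], the gap in the subgradient inequality is the
    explicit nonnegative fraction below. To return to [a] and [b]: the slope is 0 when [a <= 0], and
    otherwise [x = a] while [y >= b]. *)
Lemma smooth_pos_convex (e a b : R) : 0 < e ->
  smooth_pos' e a * (b - a) <= smooth_pos e b - smooth_pos e a.
Proof.
move=> e0; rewrite /smooth_pos /smooth_pos'.
set x := pospart a; set y := pospart b.
have x0 : 0 <= x by exact: pospart_ge0. have y0 : 0 <= y by exact: pospart_ge0.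
have xe : 0 < x + e by lra. have ye : 0 < y + e by lra.
have main : (1 - (e / (x + e)) ^+ 2) * (y - x) <=
    y - e + e ^+ 2 / (y + e) - (x - e + e ^+ 2 / (x + e)).
  rewrite -subr_ge0.
  have -> : y - e + e ^+ 2 / (y + e) - (x - e + e ^+ 2 / (x + e)) -
     (1 - (e / (x + e)) ^+ 2) * (y - x) = e ^+ 2 * (y - x) ^+ 2 / ((x + e) ^+ 2 * (y + e)).
    by field; rewrite !gt_eqF.
  by apply: divr_ge0; apply: mulr_ge0; rewrite ?sqr_ge0 ?(ltW ye).
apply: le_trans main.
have c0 : 0 <= 1 - (e / (x + e)) ^+ 2.
  have : e / (x + e) <= 1 by rewrite ler_pdivrMr// mul1r; lra.
  have : 0 <= e / (x + e) by rewrite divr_ge0// ltW.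
  by move=> ? ?; nra.
have [a0|a0] := leP a 0.
  have -> : x = 0 by rewrite /x /pospart max_l.
  by rewrite add0r divff ?gt_eqF// expr1n subrr !mul0r.
have xa : x = a by rewrite /x /pospart max_r// ltW.
rewrite -xa; apply: ler_wpM2l => //; rewrite lerD2r.
by rewrite /y /pospart le_max lexx orbT.
Qed.

Lemma smooth_pos'_01 (e a : R) : 0 < e -> 0 <= smooth_pos' e a <= 1.
Proof.
move=> e0; rewrite /smooth_pos'; have x0 := pospart_ge0 a.
have xe : 0 < pospart a + e by lra.
have : e / (pospart a + e) <= 1 by rewrite ler_pdivrMr// mul1r; lra.
have : 0 <= e / (pospart a + e) by rewrite divr_ge0// ltW.
by move=> ? ?; apply/andP; split; nra.
Qed.

Lemma continuous_smooth_pos' (e : R) : 0 < e -> continuous (smooth_pos' e).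
Proof.
move=> e0 x; apply: cvgB; first exact: cvg_cst.
have H : (fun t => e / (pospart t + e)) @ x --> e / (pospart x + e).
  apply: cvgM; first exact: cvg_cst.
  apply: cvgV; first by have x0 := pospart_ge0 x; rewrite gt_eqF//; lra.
  by apply: cvgD; [exact: continuous_pospart|exact: cvg_cst].
by under eq_fun do rewrite expr2; rewrite expr2; exact: cvgM.
Qed.

Lemma continuous_smooth_pos (e : R) : 0 < e -> continuous (smooth_pos e).
Proof.
move=> e0 x; apply: cvgD.
  by apply: cvgB; [exact: continuous_pospart|exact: cvg_cst].
apply: cvgM; first exact: cvg_cst.
apply: cvgV; first by have x0 := pospart_ge0 x; rewrite gt_eqF//; lra.
by apply: cvgD; [exact: continuous_pospart|exact: cvg_cst].
Qed.

Lemma smooth_pos_near (e t : R) : 0 < e -> `|smooth_pos e t - pospart t| <= e.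
Proof.
move=> e0; rewrite /smooth_pos; have x0 := pospart_ge0 t.
have xe : 0 < pospart t + e by lra.
have h1 : e ^+ 2 / (pospart t + e) <= e by rewrite ler_pdivrMr//; nra.
have h2 : 0 <= e ^+ 2 / (pospart t + e) by rewrite divr_ge0// ?sqr_ge0// ltW.
by rewrite ler_norml; apply/andP; split; lra.
Qed.

(** The slope is 0 for [t <= 0] at every stage, which selects the indicator of the strict
    inequality: the contact set contributes nothing to the limit. *)
Lemma smooth_pos'_cvg (t : R) :
  (fun m => smooth_pos' (harmonic m) t) @ \oo --> ((0 < t)%R%:R : R).
Proof.
rewrite /smooth_pos'; have [t0|t0] := ltP 0 t; last first.
  have -> : pospart t = 0 by rewrite /pospart max_l.
  rewrite [X in X @ _ --> _](_ : _ = fun=> 0); first exact: cvg_cst.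
  by apply/funext => m; rewrite add0r divff ?expr1n ?subrr// gt_eqF// harmonic_gt0.
have -> : pospart t = t by rewrite /pospart max_r// ltW.
rewrite -[X in _ --> X]subr0; apply: cvgB; first exact: cvg_cst.
have H : (fun m => harmonic m / (t + harmonic m)) @ \oo --> (0 : R).
  have -> : 0 = 0 / (t + 0) :> R by rewrite mul0r.
  apply: cvgM; first exact: cvg_harmonic.
  apply: cvgV; first by rewrite addr0 gt_eqF.
  by apply: cvgD; [exact: cvg_cst|exact: cvg_harmonic].
rewrite -[X in _ --> X](mulr0 (0 : R)); under eq_fun do rewrite expr2.
exact: cvgM.
Qed.

Lemma measurable_gt0_indic (W : 'rV[R]_(N + 1) -> R) :
  borel_fun W ->
  borel_fun (fun z => (0 < W z)%R%:R : R).
Proof.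
move=> mW.
have -> : (fun z : BorelRV R (N + 1) => (0 < W z)%R%:R : R) = \1_(W @^-1` `]0, +oo[).
  apply/funext => z; rewrite indicE; have [Wz|Wz] := ltP 0 (W z).
    by rewrite mem_set//= in_itv/= Wz.
  by rewrite memNset//= in_itv/= andbT; apply/negP; rewrite -leNgt.
apply: measurable_indic; rewrite -[X in measurable X]setTI.
by apply: mW => //; exact: measurable_itv.
Qed.

Lemma itg_pospart (W : 'rV[R]_(N + 1) -> R) : itg M W -> itg M (fun z => pospart (W z)).
Proof.
move=> Wi; apply: (@itg_le _ _ _ M (fun z => pospart (W z)) (fun z => `|W z|)).
- apply: (measurableT_comp _ (itg_measurable Wi)).
  by apply: continuous_measurable_fun; exact: continuous_pospart.
- by move=> z; have := pospart_dist (W z) 0; rewrite {2}/pospart maxxx !subr0.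
- exact: itg_abs.
Qed.

(** [kato_convex] is applied to [smooth_pos] with parameter [harmonic m]; the slopes lie in
    [[0, 1]], so the right side passes to the limit by dominated convergence. *)
Lemma kato (G : set 'rV[R]_(N + 1)) (W F : 'rV[R]_(N + 1) -> R) :
  itg M W -> loc_itg M G F ->
  borel_fun F ->
  (forall xi d1 d2, C2 xi d1 d2 -> supported G xi -> (forall z, 0 <= xi z) ->
    I M (fun z => W z * heat (-1) d1 d2 z) <= I M (fun z => F z * xi z)) ->
  forall zeta d1 d2, C2 zeta d1 d2 -> supported G zeta -> (forall z, 0 <= zeta z) ->
    I M (fun z => pospart (W z) * heat (-1) d1 d2 z) <=
    I M (fun z => F z * (zeta z * (0 < W z)%R%:R)).
Proof.
move=> Wi Fi mF subsol zeta d1 d2 zC2 zs z0.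
have [r [B [C [r0 zsupp d1supp d2supp [zC d1C d2C]]]]] := supported_C2 zC2 zs.
have h0 m : 0 < (harmonic m : R) by exact: harmonic_gt0.
have cpt m : I M (fun z => smooth_pos (harmonic m) (W z) * heat (-1) d1 d2 z) <=
    I M (fun z => F z * (zeta z * smooth_pos' (harmonic m) (W z))).
  apply: (kato_convex M_nice Wi Fi subsol) zC2 zs z0.
  - by move=> a b; exact: smooth_pos_convex.
  - by move=> a; exact: smooth_pos'_01.
  - exact: continuous_smooth_pos'.
  - rewrite /smooth_pos /pospart maxxx !add0r expr2 mulfK ?gt_eqF//; ring.
have mz : borel_fun zeta.
  by have [_ _ c _ _] := zC2; exact: continuous_measurable_rV.
have mW := itg_measurable Wi.
have mheat := continuous_measurable_rV (@heat_continuous _ _ (-1) _ _ _ zC2).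
have heatC z : `|heat (-1) d1 d2 z| <= C + C *+ N.
  by apply: heat_bound => //; rewrite normrN1.
have heat_supp z : heat (-1) d1 d2 z != 0 -> `|z| <= B.
  apply: contra_neqP => nzB.
  have d10 i : d1 i z = 0 by apply/eqP; apply: contra_notT nzB => /d1supp[].
  have d20 i k : d2 i k z = 0 by apply/eqP; apply: contra_notT nzB => /d2supp[].
  by rewrite /heat d10 mulr0 big1 ?subr0.
have heati : itg M (heat (-1) d1 d2) by exact: (itg_bounded_support M_nice mheat heatC heat_supp).
have posi := itg_pospart Wi.
have left_lim : (fun m => I M (fun z => smooth_pos (harmonic m) (W z) * heat (-1) d1 d2 z)) @ \oo -->
    I M (fun z => pospart (W z) * heat (-1) d1 d2 z).
  have msm m : borel_fun (fun z => smooth_pos (harmonic m) (W z)).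
    apply: (measurableT_comp _ mW); apply: continuous_measurable_fun.
    exact: continuous_smooth_pos.
  have smi m : itg M (fun z => smooth_pos (harmonic m) (W z) * heat (-1) d1 d2 z).
    have b z : `|smooth_pos (harmonic m) (W z)| <= `|pospart (W z)| + harmonic m.
      have := smooth_pos_near (W z) (h0 m).
      have := ler_normD (smooth_pos (harmonic m) (W z) - pospart (W z)) (pospart (W z)).
      by rewrite subrK; lra.
    apply: (@itg_le _ _ _ M _ (fun z => (C + C *+ N) * `|pospart (W z)| +
       harmonic m * `|heat (-1) d1 d2 z|)).
    - exact: measurable_funM.
    - move=> z; rewrite normrM; have := b z; have := heatC z.
      have := normr_ge0 (heat (-1) d1 d2 z).
      have := normr_ge0 (pospart (W z)); nra.
    - by apply: itgD; apply: itgZ; exact: itg_abs.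
  have phi : itg M (fun z => pospart (W z) * heat (-1) d1 d2 z).
    exact: (itg_bound mheat heatC posi).
  apply: cvg_dist_I => //.
  (* The uniform error [harmonic m] is not integrable over the whole space; it becomes so against
     [heat (-1) d1 d2], which is bounded with bounded support. *)
  apply: (@cvg_abs0_le _ _ (fun m => harmonic m * I M (fun z => `|heat (-1) d1 d2 z|))).
    move=> m; rewrite ger0_norm; last exact: I_ge0.
    rewrite -I_Z; last exact: itg_abs.
    apply: I_le.
    - by apply: itg_abs; exact: itgB.
    - by apply: itgZ; exact: itg_abs.
    - move=> z; rewrite -mulrBl normrM; apply: ler_wpM2r => //.
      exact: smooth_pos_near.
  rewrite -[X in _ --> X](mul0r (I M (fun z => `|heat (-1) d1 d2 z|))).
  by apply: cvgM; [exact: cvg_harmonic|exact: cvg_cst].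
have Fzi : itg M (fun z => F z * zeta z) by exact: (loc_itg_mul Fi r0 mz zC zsupp).
have mpos' e : 0 < e -> measurable_fun setT (smooth_pos' e).
  by move=> e0; apply: continuous_measurable_fun; exact: continuous_smooth_pos'.
have right_lim : (fun m => I M (fun z => F z * (zeta z * smooth_pos' (harmonic m) (W z)))) @ \oo -->
    I M (fun z => F z * (zeta z * (0 < W z)%R%:R)).
  apply: (@I_dct _ _ _ M (fun m z => F z * (zeta z * smooth_pos' (harmonic m) (W z)))
    (fun z => F z * (zeta z * (0 < W z)%R%:R)) (fun z => `|F z * zeta z|) _ _ _ _ _).2.
  - move=> m; apply: measurable_funM => //; apply: measurable_funM => //.
    exact: (measurableT_comp (mpos' _ (h0 m)) mW).
  - apply: measurable_funM => //; apply: measurable_funM => //.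
    exact: measurable_gt0_indic.
  - apply: aeW => z; apply: cvgM; first exact: cvg_cst.
    by apply: cvgM; [exact: cvg_cst|exact: smooth_pos'_cvg].
  - exact: itg_abs.
  - move=> m z; rewrite mulrA normrM ler_piMr//.
    by have /andP[a0 a1] := smooth_pos'_01 (W z) (h0 m); rewrite ger0_norm.
by apply: (ler_cvg_to left_lim right_lim); apply: nearW.
Qed.

End KatoPositivePart.

(** * Weak formulation *)

Section DistanceToBoundary.
Context {R : realType} {N : nat}.
Implicit Types (x y : 'rV[R]_N).

Lemma continuous_sum (T : topologicalType) m (F : 'I_m -> T -> R) :
  (forall i, continuous (F i)) -> continuous (fun x : T => \sum_(i < m) F i x).
Proof.
elim: m F => [|m IH] F cF.
  by under eq_fun do rewrite big_ord0; exact: cst_continuous.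
under eq_fun do rewrite big_ord_recl.
move=> w; apply: cvgD; first exact: cF.
by apply: (IH (fun i => F (lift ord0 i))) => i; exact: cF.
Qed.

Lemma continuous_eucl y : continuous (fun x => eucl x y).
Proof.
move=> x.
apply: (@continuous_comp _ _ _ (fun x => \sum_(i < N) (x ord0 i - y ord0 i) ^+ 2) Num.sqrt);
  last exact: sqrt_continuous.
apply: continuous_sum => i {}x.
have H : (fun x => x ord0 i - y ord0 i) @ x --> x ord0 i - y ord0 i.
  exact: cvgB (@coord_continuous _ _ _ ord0 i x) (cvg_cst _).
under eq_fun do rewrite expr2. exact: (cvgM H H).
Qed.

Lemma eucl_ge0 x y : 0 <= eucl x y.
Proof. exact: sqrtr_ge0. Qed.

Lemma eucl_ge (r : R) x y : 0 < r -> ~ ball x r y -> r <= eucl x y.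
Proof.
move=> r0 /(ball_rV _ _ r0)/existsNP[i /negP]; rewrite -leNgt => H.
apply: le_trans H _; rewrite -sqrtr_sqr /eucl ler_sqrt; last first.
  by apply: sumr_ge0 => k _; exact: sqr_ge0.
by rewrite (bigD1 i)//= lerDl; apply: sumr_ge0 => k _; exact: sqr_ge0.
Qed.

Lemma coord_norm_le x i : `|x ord0 i| <= `|x|.
Proof.
apply/ler_addgt0Pr => e e0.
have : `|x| < `|x| + e by rewrite ltrDl.
by move=> /norm_cube/(_ i)/ltW.
Qed.

(* A coordinate line through a point of the domain leaves it, hence crosses the boundary. *)
Lemma bdry_neq0 (O : set 'rV[R]_N) : (0 < N)%N -> bounded_domain O -> bdry O !=set0.
Proof.
move=> N0 [Oo [_ [[x Ox] Ob]]]; apply: contrapT => nb.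
have Oc : closed O.
  by move=> z cz; apply: contrapT => nOz; apply: nb; exists z; split.
pose l (s : R) := x + s *: unitv (Ordinal N0).
have cl : continuous l.
  by move=> s; exact: cvgD (cvg_cst _) (cvgZr_tmp cvg_id).
have : l @^-1` O = setT.
  have cT : connected [set: R] by apply/connected_intervalP.
  apply: cT.
  - by exists 0; rewrite /l /= scale0r addr0.
  - by exists (l @^-1` O); rewrite ?setTI//; move/continuousP : cl; apply.
  - by exists (l @^-1` O); rewrite ?setTI//; apply: closed_comp => // ? _; exact: cl.
have [B [_ /(_ (B + 1))]] := Ob; rewrite ltrDl ltr01 => /(_ isT) OB lO.
have Ol s : O (l s) by have : [set: R] s by []; rewrite -lO.
have : `|l (`|B| + `|x| + 2)| <= B + 1 by apply: OB; exact: Ol.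
have : `|(l (`|B| + `|x| + 2)) ord0 (Ordinal N0)| <= `|l (`|B| + `|x| + 2)|.
  exact: coord_norm_le.
have : `|x ord0 (Ordinal N0)| <= `|x| by exact: coord_norm_le.
rewrite /l !mxE !eqxx mulr1; have := ler_norm B; have := normr_ge0 x; have := normr_ge0 B.
move: (x ord0 _) => a ? ? ? /ler_normlP[? ?] ?.
have := ler_norm (a + (`|B| + `|x| + 2)); lra.
Qed.

Lemma rho_ge0 (O : set 'rV[R]_N) x : 0 <= rho O x.
Proof.
have [[d Sd]|S0] := pselect ([set d | exists2 y, bdry O y & d = eucl x y] !=set0).
  by apply: lb_le_inf; [exists d|move=> _ [y _ ->]; exact: eucl_ge0].
by rewrite /rho; move/set0P/negP/negPn/eqP : S0 => ->; rewrite inf0.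
Qed.

(** This removes the weight from the integrability of the reaction term. A nonempty boundary
    excludes the default value [inf set0 = 0]. *)
Lemma rho_inner (O : set 'rV[R]_N) (r B : R) x : bdry O !=set0 -> 0 < r ->
  inner O r B x -> r <= rho O x.
Proof.
move=> [y by_] r0 [_ xO]; apply: lb_le_inf; first by exists (eucl x y), y.
by move=> _ [w [_ nOw] ->]; apply: eucl_ge => // /xO.
Qed.

(** An infimum of continuous functions is upper semicontinuous: its strict sublevel sets are unions
    of open sets. *)
Lemma measurable_rho (O : set 'rV[R]_N) : bdry O !=set0 ->
  borel_fun (rho O).
Proof.
move=> [y0 by0]; apply: (measurability _ (RGenInftyO.measurableE R)) => _ [_ [a ->] <-].
rewrite setTI; apply: open_measurable_rV.
have -> : rho O @^-1` `]-oo, a[ = \bigcup_(y in bdry O) ((fun x => eucl x y) @^-1` `]-oo, a[).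
  apply/seteqP; split => x /=; rewrite in_itv/=.
    have ne : [set d | exists2 y, bdry O y & d = eucl x y] !=set0 by exists (eucl x y0), y0.
    by move=> /(inf_lt ne)[_ [y yO ->] ya]; exists y; rewrite //= in_itv.
  move=> [y yO] /=; rewrite in_itv/=; apply: le_lt_trans.
  by apply: ge_inf; [exists 0 => _ [w _ ->]; exact: eucl_ge0|exists y].
apply: bigcup_open => y _; move/continuousP : (@continuous_eucl y); apply.
exact: interval_open.
Qed.

Lemma inner_compact (O : set 'rV[R]_N) (r B : R) : compact (inner O r B).
Proof.
apply: bounded_closed_compact; last exact: closed_inner.
by exists B; split; [exact: num_real|move=> b Bb x [xB _]; exact: le_trans xB (ltW Bb)].
Qed.

Lemma inner_sub (O : set 'rV[R]_N) (r B : R) : 0 < r -> inner O r B `<=` O.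
Proof. by move=> r0 x [_]; apply; exact: (@ballxx _ _ x). Qed.

End DistanceToBoundary.

(** * Space-time functions and compactly supported test functions *)

Section WeakFormulation.
Context {R : realType} {N : nat}.
Implicit Types (x : 'rV[R]_N) (z : 'rV[R]_(N + 1)) (O : set 'rV[R]_N)
  (f : 'rV[R]_(N + 1) -> R) (nu mu : {measure set (BorelRV R N) -> \bar R}).

Local Notation tau := (rshift N (ord0 : 'I_1)).
Local Notation sp i := (lshift 1 (i : 'I_N)).

Definition spacetime x (t : R) : 'rV[R]_(N + 1) := row_mx x (const_mx t).

Definition slab O (T : R) : set 'rV[R]_(N + 1) :=
  [set z | O (lsubmx z) /\ 0 < z ord0 tau < T].

(** No lower bound on time: a test function compactly supported here may be nonzero at [t = 0] and
    thus sees the initial datum. *)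
Definition cylinder O (T : R) : set 'rV[R]_(N + 1) :=
  [set z | O (lsubmx z) /\ z ord0 tau < T].

(** The extension by zero, in particular to times [t <= 0], through which the datum acts as a source
    on [t = 0]. *)
Definition lift_slab O (T : R) (u : 'rV[R]_N -> R -> R) z : R :=
  u (lsubmx z) (rsubmx z ord0 ord0) * \1_(slab O T) z.

Lemma spacetime_l x t : lsubmx (spacetime x t) = x.
Proof. exact: row_mxKl. Qed.

Lemma spacetime_tau x t : spacetime x t ord0 tau = t.
Proof. by rewrite row_mxEr mxE. Qed.

Lemma spacetime_sp x t i : spacetime x t ord0 (sp i) = x ord0 i.
Proof. by rewrite row_mxEl. Qed.

Lemma lift_slab_out O T u z : ~ slab O T z -> lift_slab O T u z = 0.
Proof. by move=> nz; rewrite /lift_slab indicE memNset// mulr0. Qed.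

Lemma lift_slab_in O T u x t : O x -> 0 < t < T -> lift_slab O T u (spacetime x t) = u x t.
Proof.
move=> Ox tT; rewrite /lift_slab indicE mem_set ?mulr1; last first.
  by rewrite /slab /= spacetime_l spacetime_tau.
by rewrite spacetime_l mxE spacetime_tau.
Qed.

Lemma measurable_slab O T : open O -> measurable (slab O T : set (BorelRV R (N + 1))).
Proof.
move=> Oo.
have -> : slab O T = ((fun z : BorelRV R (N + 1) => lsubmx (z : 'rV[R]_(N + 1))) @^-1` O) `&`
    ((fun z : BorelRV R (N + 1) => z ord0 tau) @^-1` `]0, T[).
  by apply/seteqP; split => z [? zt]; split => //=; move: zt; rewrite /= in_itv.
apply: measurableI; rewrite -[X in measurable X]setTI; last exact: coord_measurable.
by apply: measurable_lsubmx => //; exact: open_measurable_rV.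
Qed.

Lemma measurable_lift_slab O T u : open O -> jmeas u ->
  borel_fun (lift_slab O T u).
Proof.
by move=> Oo mu; apply: measurable_funM => //; apply: measurable_indic; exact: measurable_slab.
Qed.

Lemma eq_intQ O (T : R) F F' :
  (forall x t, O x -> 0 < t < T -> F x t = F' x t) -> intQ O T F = intQ O T F'.
Proof.
move=> FF'; congr iint; apply/funext => x; have [Ox|nOx] := pselect (O x); last first.
  by rewrite indicE memNset// !mul0e.
congr (_ * _)%E; apply: eq_integral => t; rewrite inE /= in_itv/= => tT; exact: FF'.
Qed.

(* [W] is a weak solution with datum [nu], tested only with compactly supported functions. *)
Definition solves (M : {sigma_finite_measure set (BorelRV R (N + 1)) -> \bar R}) (G : set 'rV[R]_(N + 1))
    (h : R -> R) nu (W : 'rV[R]_(N + 1) -> R) :=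
  [/\ itg M W, loc_itg M G (h \o W) &
    forall f d1 d2, C2 f d1 d2 -> supported G f ->
      I M (fun z => W z * heat (-1) d1 d2 z) + I M (fun z => h (W z) * f z) =
      I nu (fun x => f (spacetime x 0))].

Lemma unitv_l (i : 'I_N) (s : R) x t :
  spacetime (x + s *: unitv i) t = spacetime x t + s *: unitv (sp i).
Proof.
apply/rowP => k; case: (split_ordP k) => j ->.
  rewrite spacetime_sp [RHS]mxE spacetime_sp [LHS]mxE [in LHS]mxE [in RHS]mxE.
  by rewrite [unitv _ _ _]mxE [unitv _ _ _]mxE (inj_eq (@lshift_inj _ _)).
rewrite (ord1 j) spacetime_tau [RHS]mxE spacetime_tau [in RHS]mxE [unitv _ _ _]mxE.
by rewrite eq_rlshift mulr0 addr0.
Qed.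

Lemma unitv_r (s : R) x t : spacetime x (t + s) = spacetime x t + s *: unitv tau.
Proof.
apply/rowP => k; case: (split_ordP k) => j ->.
  rewrite spacetime_sp [RHS]mxE spacetime_sp [in RHS]mxE [unitv _ _ _]mxE.
  by rewrite eq_lrshift mulr0 addr0.
rewrite (ord1 j) spacetime_tau [RHS]mxE spacetime_tau [in RHS]mxE [unitv _ _ _]mxE.
by rewrite !eqxx mulr1.
Qed.

Lemma is_derive_space f (d : R) i x t :
  is_derive (spacetime x t) (unitv (sp i)) f d ->
  is_derive x (unitv i) (fun y => f (spacetime y t)) d.
Proof.
rewrite -[spacetime x t](addr0) -(scale0r (unitv (sp i))) => /is_derive_line H.
rewrite -[x in is_derive x]addr0 -(scale0r (unitv i)); apply/is_derive_line.
by under eq_fun do rewrite unitv_l.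
Qed.

Lemma is_derive_time f (d : R) x t :
  is_derive (spacetime x t) (unitv tau) f d ->
  is_derive t 1 (fun s => f (spacetime x s)) d.
Proof.
have -> : spacetime x t = spacetime x 0 + t *: unitv tau by rewrite -unitv_r add0r.
move/is_derive_line; under eq_fun do rewrite -unitv_r add0r.
exact.
Qed.

Lemma continuous_spacetime : continuous (fun p : 'rV[R]_N * R => spacetime p.1 p.2).
Proof.
move=> p; apply/cvg_ballP => e e0; near=> q.
have [q1 q2] : ball p.1 e q.1 /\ ball p.2 e q.2.
  near: q; exists (ball p.1 e, ball p.2 e); last by move=> w [].
  by split; exact: nbhsx_ballx.
apply/(ball_rV _ _ e0) => k; case: (split_ordP k) => j ->.
  by rewrite !spacetime_sp; move/(ball_rV _ _ e0) : q1.
by rewrite (ord1 j) !spacetime_tau.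
Unshelve. all: by end_near. Qed.

Lemma itg_radon O nu (f : 'rV[R]_N -> R) (r B C : R) :
  (forall K : set 'rV[R]_N, compact K -> K `<=` O -> (nu K < +oo)%E) ->
  borel_fun f ->
  (forall x, `|f x| <= C) -> 0 < r -> (forall x, f x != 0 -> inner O r B x) -> itg nu f.
Proof.
move=> nuK mf fC r0 fO.
have ii : itg nu (fun x => \1_(inner O r B) x).
  apply: itgP; first by apply: measurable_indic; exact: measurable_inner.
  under eq_integral do rewrite ger0_norm//.
  rewrite integral_indic//; last exact: measurable_inner.
  by rewrite setIT; apply: nuK; [exact: inner_compact|exact: inner_sub].
apply: (@itg_le _ _ _ nu f (fun x => C * \1_(inner O r B) x)) => //; last exact: itgZ.
move=> x; have C0 : 0 <= C by exact: le_trans (fC x).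
have [->|fx] := eqVneq (f x) 0; first by rewrite normr0 mulr_ge0.
by rewrite indicE mem_set ?mulr1//; exact: fO.
Qed.

Lemma inner_cylinder O (T r B : R) z : 0 < r -> inner (cylinder O T) r B z ->
  inner O r B (lsubmx z).
Proof.
move=> r0 [zB zG]; split.
  apply/ler_addgt0Pr => e e0; apply/ltW/cube_norm.
    by rewrite ltr_wpDl// (le_trans _ zB).
  move=> i; rewrite mxE; apply: norm_cube.
  by rewrite (le_lt_trans zB)// ltrDl.
move=> y /(ball_rV _ _ r0) zy.
suff /zG[] : ball z r (spacetime y (z ord0 tau)) by rewrite spacetime_l.
apply/(ball_rV _ _ r0) => k; case: (split_ordP k) => j ->.
  by rewrite spacetime_sp; have := zy j; rewrite mxE.
by rewrite (ord1 j) spacetime_tau subrr normr0.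
Qed.

Lemma supported_trace O (T : R) f : supported (cylinder O T) f ->
  supported O (fun x => f (spacetime x 0)).
Proof.
move=> [r [B [r0 fG]]]; exists r, B; split => // x /fG/(inner_cylinder r0).
by rewrite spacetime_l.
Qed.

Lemma continuous_trace f : continuous f -> continuous (fun x => f (spacetime x 0)).
Proof.
move=> cf x.
have cs : {for x, continuous (fun y : 'rV[R]_N => spacetime y 0)}.
  have cp : (fun y : 'rV[R]_N => (y, 0 : R)) @ x --> (x, 0 : R).
    by apply: (@cvg_pair _ _ _ (nbhs x) (nbhs x) (nbhs (0 : R)));
      [exact: cvg_id|exact: (@cvg_cst _ (0 : R))].
  exact: (continuous_comp cp (@continuous_spacetime (x, 0))).
exact: (continuous_comp cs (cf (spacetime x 0))).
Qed.

Lemma itg_trace O (T : R) nu f : M1plus O nu -> continuous f -> supported (cylinder O T) f ->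
  itg nu (fun x => f (spacetime x 0)).
Proof.
move=> [_ [nuK _]] cf sf; have [r [B [r0 fO]]] := supported_trace sf.
have [C fC] := continuous_support_bounded (continuous_trace cf) (fun x fx => (fO x fx).1).
exact: itg_radon nuK (continuous_measurable_rV (continuous_trace cf)) fC r0 fO.
Qed.

(** The conclusion of [nice_intQ_exists], isolated so that iterated integrals are met only where
    weak solutions and L^1 convergence are translated. *)
Definition represents_intQ (M : {measure set (BorelRV R (N + 1)) -> \bar R}) :=
  forall O (T : R) (F : BorelRV R (N + 1) -> \bar R),
  measurable (O : set (BorelRV R N)) -> measurable_fun setT F ->
  (forall z, ~ slab O T z -> F z = 0%E) ->
  (forall z, (0 <= F z)%E) \/ M.-integrable setT F ->
  intQ O T (fun x t => F (spacetime x t)) = (\int[M]_z F z)%E.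

Section Represented.
Variable M : {sigma_finite_measure set (BorelRV R (N + 1)) -> \bar R}.
Hypothesis M_intQ : represents_intQ M.

Lemma intQ_I O (T : R) F : open O -> itg M F -> (forall z, ~ slab O T z -> F z = 0) ->
  intQ O T (fun x t => (F (spacetime x t))%:E) = (I M F)%:E.
Proof.
move=> Oo Fi F0; rewrite -itgE//; apply: (@M_intQ O T (EFin \o F)).
- exact: open_measurable_rV.
- exact: (measurable_int M Fi).
- by move=> z /F0 E /=; rewrite E.
- by right.
Qed.

Lemma intQ_itg O (T : R) (F : 'rV[R]_(N + 1) -> R) : open O ->
  borel_fun F ->
  (forall z, ~ slab O T z -> F z = 0) ->
  (intQ O T (fun x t => `|F (spacetime x t)|%:E) < +oo)%E -> itg M F.
Proof.
move=> Oo mF F0; rewrite (@M_intQ O T (fun z => `|F z|%:E)).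
- exact: itgP.
- exact: open_measurable_rV.
- by apply/measurable_EFinP; exact: measurableT_comp.
- by move=> z /F0 ->; rewrite normr0.
- by left => z; rewrite lee_fin.
Qed.

(** A test function compactly supported in the cylinder vanishes on the lateral boundary and at [T],
    so it is admissible in the weak formulation. On its support the weight is at least [r], which
    makes the reaction locally integrable; [g 0 = 0] makes the reaction vanish where the solution
    was extended by zero. *)
Lemma weak_sol_solves O (T : R) g nu u : (0 < N)%N -> bounded_domain O -> admissible g ->
  M1plus O nu -> weak_sol O T g nu u -> solves M (cylinder O T) g nu (lift_slab O T u).
Proof.
move=> N0 dO [cg [_ gneg]] nuO [mu [ui [gui wf]]]; have bO := bdry_neq0 N0 dO.
have Oo : open O by case: dO.
have g0 : g 0 = 0 by exact: gneg.
set W := lift_slab O T u.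
have mW : borel_fun W.
  exact: measurable_lift_slab.
have mgW : borel_fun (g \o W).
  apply: measurableT_comp => //; exact: continuous_measurable_fun.
have W0 z : ~ slab O T z -> W z = 0 by exact: lift_slab_out.
have Wi : itg M W.
  apply: (intQ_itg (T := T) Oo mW W0); rewrite (eq_intQ (F' := fun x t => `|u x t|%:E))//.
  by move=> x t Ox tT; rewrite /W lift_slab_in.
pose F z := g (W z) * rho O (lsubmx z).
have Fi : itg M F.
  apply: (intQ_itg (T := T) Oo).
  - apply: measurable_funM => //.
    exact: (measurableT_comp (measurable_rho bO) (@measurable_lsubmx _ N 1)).
  - by move=> z /W0; rewrite /F => ->; rewrite g0 mul0r.
  - rewrite (eq_intQ (F' := fun x t => (`|g (u x t)| * rho O x)%:E))//.
    move=> x t Ox tT; rewrite /F /W lift_slab_in// spacetime_l normrM.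
    by rewrite (ger0_norm (rho_ge0 _ _)).
have gWi : loc_itg M (cylinder O T) (g \o W).
  move=> r B r0; apply: (@itg_le _ _ _ M _ (fun z => r^-1 * `|F z|)).
  - by apply: measurable_funM => //; apply: measurable_indic; exact: measurable_inner.
  - move=> z /=; rewrite indicE; have [/set_mem zi|_] := boolP (z \in _); last first.
      by rewrite mulr0 normr0 mulr_ge0// invr_ge0 ltW.
    have rr := rho_inner bO r0 (inner_cylinder r0 zi).
    rewrite mulr1 /F normrM mulrC ler_pdivlMr// ler_wpM2l//.
    by rewrite (le_trans rr)// ler_norm.
  - by apply: itgZ; exact: itg_abs.
split => // f d1 d2 fC2 fG.
have [h1 h2 cf cd1 cd2] := fC2.
have cst (k : 'rV[R]_(N + 1) -> R) : continuous k ->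
    {within closure O `*` `[0, T], continuous (fun z : 'rV[R]_N * R => k (spacetime z.1 z.2))}.
  move=> ck; apply: continuous_subspaceT => z.
  exact: (continuous_comp (@continuous_spacetime z) (ck _)).
have fcyl z : ~ cylinder O T z -> f z = 0.
  have [r [B [r0 fi]]] := fG => nz; apply/eqP; apply: contra_notT nz => /fi.
  exact: inner_sub.
have C21f : C21 O T (fun x t => f (spacetime x t)) (fun x t => d1 tau (spacetime x t))
    (fun i x t => d1 (sp i) (spacetime x t)) (fun i j x t => d2 (sp i) (sp j) (spacetime x t)).
  split; last by split; [exact: cst|split; [exact: cst|split => *; exact: cst]].
  move=> x t _ _; split; first exact: is_derive_time.
  by move=> i; split => [|j]; exact: is_derive_space.
have f_van : vanish_l0 O T (fun x t => f (spacetime x t)).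
  split => [x t [_ nOx] _|x _]; apply: fcyl => -[]; rewrite spacetime_l//.
  by rewrite spacetime_tau ltxx.
have := wf _ _ _ _ C21f f_van.
have [r [B [C [r0 fi d1i d2i [fC d1C d2C]]]]] := supported_C2 fC2 fG.
have mf := continuous_measurable_rV cf.
have mheat := continuous_measurable_rV (@heat_continuous _ _ (-1) _ _ _ fC2).
have heatC z : `|heat (-1) d1 d2 z| <= C + C *+ N.
  by apply: heat_bound => //; rewrite normrN1.
have i1 : itg M (fun z => W z * heat (-1) d1 d2 z) by exact: itg_bound mheat heatC Wi.
have i2 : itg M (fun z => g (W z) * f z) by exact: (loc_itg_mul gWi r0 mf fC fi).
pose H z := W z * heat (-1) d1 d2 z + g (W z) * f z.
have Hi : itg M H by exact: itgD.
have H0 z : ~ slab O T z -> H z = 0 by move=> /W0; rewrite /H => ->; rewrite g0 !mul0r addr0.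
rewrite (eq_intQ (F' := fun x t => (H (spacetime x t))%:E)); last first.
  by move=> x t Ox tT; rewrite /H /W lift_slab_in// /heat; congr EFin; ring.
rewrite (intQ_I Oo Hi H0) /H.
rewrite I_D// => E; apply/EFin_inj; rewrite E -itgE; last exact: itg_trace nuO cf fG.
(* The trace of [f] vanishes outside [O], so the integral over [O] equals the one over the whole
   space. *)
rewrite [LHS]integral_mkcond; apply: eq_integral => x _; rewrite /patch; case: ifPn => // xO.
rewrite fcyl// => -[]; rewrite spacetime_l => Ox _; by rewrite mem_set in xO.
Qed.

End Represented.
End WeakFormulation.

(** * Comparison of approximations *)

Section Comparison.
Context {R : realType} {N : nat}.
Variable M : {sigma_finite_measure set (BorelRV R (N + 1)) -> \bar R}.
Hypothesis M_nice : nice M.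
Variable G : set 'rV[R]_(N + 1).
Implicit Types (g : R -> R) (h : nat -> R -> R) (f W u v y : 'rV[R]_(N + 1) -> R)
  (nu mu mus : {measure set (BorelRV R N) -> \bar R}).

Local Notation trace nu f := (I nu (fun x => f (spacetime x 0))).

Definition trace_le nu nu' := forall f d1 d2, C2 f d1 d2 -> supported G f ->
  (forall z, 0 <= f z) -> trace nu f <= trace nu' f.

Section Admissible.
Variable g : R -> R.
Hypothesis g_adm : admissible g.

Lemma admissible_ge0 s : 0 <= g s.
Proof.
have [_ [gm g0]] := g_adm; rewrite -(g0 (Num.min s 0)); last by rewrite ge_min lexx orbT.
by apply: gm; rewrite ge_min lexx.
Qed.

Lemma measurable_admissible W :
  borel_fun W ->
  borel_fun (fun z => g (W z)).
Proof.
move=> mW; apply: (measurableT_comp _ mW); apply: continuous_measurable_fun.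
by case: g_adm.
Qed.
End Admissible.

Section Test.
Variables (f : 'rV[R]_(N + 1) -> R) (d1 : 'I_(N + 1) -> 'rV[R]_(N + 1) -> R)
  (d2 : 'I_(N + 1) -> 'I_(N + 1) -> 'rV[R]_(N + 1) -> R).
Hypothesis fC2 : C2 f d1 d2.
Hypothesis f_supp : supported G f.

Lemma measurable_test : borel_fun f.
Proof. by have [_ _ cf _ _] := fC2; exact: continuous_measurable_rV. Qed.

Lemma heat_test : borel_fun (heat (-1) d1 d2) /\
  exists C, forall z, `|heat (-1) d1 d2 z| <= C.
Proof.
have [r [B [C [r0 fi d1i d2i [fC d1C d2C]]]]] := supported_C2 fC2 f_supp.
split; first exact: continuous_measurable_rV (@heat_continuous _ _ (-1) _ _ _ fC2).
by exists (C + C *+ N) => z; apply: heat_bound => //; rewrite normrN1.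
Qed.

Lemma itg_heat W : itg M W -> itg M (fun z => W z * heat (-1) d1 d2 z).
Proof. by move=> Wi; have [mH [C HC]] := heat_test; exact: itg_bound mH HC Wi. Qed.

Lemma itg_test W : loc_itg M G W -> itg M (fun z => W z * f z).
Proof.
move=> Wi; have [r [B [C [r0 fi _ _ [fC _ _]]]]] := supported_C2 fC2 f_supp.
exact: (loc_itg_mul Wi r0 measurable_test fC fi).
Qed.
End Test.

Lemma loc_itgB W W' : loc_itg M G W -> loc_itg M G W' -> loc_itg M G (fun z => W z - W' z).
Proof.
by move=> Wi Wi' r B r0; apply: eq_itg (itgB (Wi r B r0) (Wi' r B r0)) => z; rewrite mulrBl.
Qed.

(** The equality between distances lets one statement serve for both [u - V k] and [V k - u]. *)
Lemma pospart_L1_cvg (X Y : nat -> 'rV[R]_(N + 1) -> R) W y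
    (H : 'rV[R]_(N + 1) -> R) (C : R) :
  (forall k, itg M (X k)) -> itg M W -> (forall k, itg M (Y k)) -> itg M y ->
  (forall k z, `|X k z - W z| = `|Y k z - y z|) ->
  (fun k => I M (fun z => `|Y k z - y z|)) @ \oo --> (0 : R) ->
  borel_fun H ->
  (forall z, `|H z| <= C) ->
  (fun k => I M (fun z => pospart (X k z) * H z)) @ \oo --> I M (fun z => pospart (W z) * H z).
Proof.
move=> Xi Wi Yi yi XY Yy mH HC.
have pH V : itg M V -> itg M (fun z => pospart (V z) * H z).
  by move=> /itg_pospart; exact: itg_bound mH HC.
apply: (@cvg_I_lip _ _ _ M (fun k z => pospart (X k z) * H z) Y (fun z => pospart (W z) * H z)
  y C (fun k => pH _ (Xi k)) (pH _ Wi) Yi yi _ Yy) => k z.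
rewrite -mulrBl normrM mulrC -XY; apply: ler_pM => //; exact: pospart_dist.
Qed.

(** In the equation of [W1 - W2] the trace terms contribute the integral of [f (., 0)] against
    [nu1 - nu2], which is nonpositive for [f >= 0]. Dropping it shows that the difference is a
    subsolution on all of [G], initial time included, and [kato] applies. *)
Lemma kato_difference g1 g2 nu1 nu2 W1 W2 : admissible g1 -> admissible g2 ->
  solves M G g1 nu1 W1 -> solves M G g2 nu2 W2 -> trace_le nu1 nu2 ->
  forall f d1 d2, C2 f d1 d2 -> supported G f -> (forall z, 0 <= f z) ->
    I M (fun z => pospart (W1 z - W2 z) * heat (-1) d1 d2 z) <=
    I M (fun z => (g2 (W2 z) - g1 (W1 z)) * (f z * (0 < W1 z - W2 z)%R%:R)).
Proof.
move=> g1a g2a [W1i g1i s1] [W2i g2i s2] le12 f d1 d2 fC2 fs f0.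
have mW1 := itg_measurable W1i; have mW2 := itg_measurable W2i.
apply: (kato M_nice _ _ _ _ fC2 fs f0) => //.
- exact: itgB.
- exact: loc_itgB g2i g1i.
- by apply: measurable_funB; exact: measurable_admissible.
move=> xi e1 e2 xC2 xs x0.
have i1 := itg_heat xC2 xs W1i; have i2 := itg_heat xC2 xs W2i.
have j1 := itg_test xC2 xs g1i; have j2 := itg_test xC2 xs g2i.
have -> : (fun z => (W1 z - W2 z) * heat (-1) e1 e2 z) =
    (fun z => W1 z * heat (-1) e1 e2 z - W2 z * heat (-1) e1 e2 z).
  by apply/funext => z; rewrite mulrBl.
have -> : (fun z => (g2 (W2 z) - g1 (W1 z)) * xi z) =
    (fun z => g2 (W2 z) * xi z - g1 (W1 z) * xi z).
  by apply/funext => z; rewrite mulrBl.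
rewrite !I_B//; have := le12 _ _ _ xC2 xs x0; have := s1 _ _ _ xC2 xs; have := s2 _ _ _ xC2 xs.
by rewrite /=; lra.
Qed.

Section Limit.
Variables (g : R -> R) (h : nat -> R -> R).
Hypothesis g_adm : admissible g.
Hypothesis h_adm : forall k, admissible (h k).
Hypothesis h_nd : forall k s, h k s <= h k.+1 s.
Hypothesis h_cvg : forall s, (fun k => h k s) @ \oo --> g s.

Lemma h_le k s : h k s <= g s.
Proof.
rewrite -(cvg_lim _ (@h_cvg s))//; apply: (nondecreasing_cvgn_le (u_ := fun k => h k s)).
  by apply/nondecreasing_seqP => m; exact: h_nd.
by apply/cvg_ex; exists (g s); exact: (@h_cvg s).
Qed.

(* Since the [h_k] are monotone, it is enough to compare with [h_k y] for a fixed [y < x]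
   close to [x]. *)
Lemma defect_cvg (s : nat -> nat) (xn : nat -> R) (x b : R) : (forall n, (n <= s n)%N) ->
  xn @ \oo --> x -> b <= g x -> (fun n => pospart (b - h (s n) (xn n))) @ \oo --> (0 : R).
Proof.
move=> sle xx bg; have [cg _] := g_adm.
apply/cvgrPdist_le => e e0; have e20 : 0 < e / 2 by lra.
have [d /= d0 gd] := (@cvgrPdist_lt _ _ _ _ _ _ _).1 (cg x) _ e20.
have yd : ball_ Num.norm x d (x - d / 2).
  by rewrite /ball_ /= opprB addrC subrK ger0_norm; lra.
have := gd _ yd; set y := x - d / 2 => gy.
have d20 : 0 < d / 2 by lra.
near=> n; rewrite sub0r normrN ger0_norm ?pospart_ge0//.
have yx : y <= xn n.
  have : `|x - xn n| < d / 2 by near: n; move/cvgrPdist_lt : xx; apply.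
  by move=> /ltr_normlP[? ?]; rewrite /y; lra.
have hy : `|g y - h n y| < e / 2 by near: n; move/cvgrPdist_lt : (@h_cvg y); apply.
have h1 : h n y <= h (s n) y.
  by have /nondecreasing_seqP := fun k => h_nd k y; apply; exact: sle.
have h2 : h (s n) y <= h (s n) (xn n) by have [_ [hm _]] := h_adm (s n); exact: hm.
move: gy hy => /ltr_normlP[? ?] /ltr_normlP[? ?].
by rewrite /pospart ge_max (ltW e0)/=; lra.
Unshelve. all: by end_near. Qed.

Variables (mu mus : {measure set (BorelRV R N) -> \bar R}).
Variables (V : nat -> 'rV[R]_(N + 1) -> R) (v : 'rV[R]_(N + 1) -> R).
Hypothesis V_sol : forall k, solves M G (h k) mu (V k).
Hypothesis v_sol : solves M G g mus v.
Hypothesis V_cvg : (fun k => I M (fun z => `|V k z - v z|)) @ \oo --> (0 : R).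

Let Vi k : itg M (V k). Proof. by case: (V_sol k). Qed.
Let vi : itg M v. Proof. by case: v_sol. Qed.
Let mV k := itg_measurable (Vi k).
Let mv := itg_measurable vi.

(** The positive part of [g (v) - h (V)] is at most [g (v)], as reactions are nonnegative, and tends
    to 0 almost everywhere along a subsequence. So the limit of the reactions is at least [g (v)],
    and the equations leave a smaller datum to [v]. *)
Lemma reduced_trace_le : trace_le mus mu.
Proof.
move=> f d1 d2 fC2 fs f0.
have [s [sle sae]] := L1_ae_subseq Vi vi V_cvg.
have [_ gvi vs] := v_sol.
have mf := measurable_test fC2.
have gfi := itg_test fC2 fs gvi.
pose n j z := pospart (g (v z) - h (s j) (V (s j) z)) * f z.
have mn j : borel_fun (n j).
  apply: measurable_funM => //; apply: measurableT_comp.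
    by apply: continuous_measurable_fun; exact: continuous_pospart.
  by apply: measurable_funB; exact: measurable_admissible.
have nb j z : `|n j z| <= g (v z) * f z.
  rewrite /n normrM (ger0_norm (pospart_ge0 _)) (ger0_norm (f0 z)) ler_wpM2r//.
  rewrite /pospart ge_max (admissible_ge0 g_adm) /=.
  by rewrite gerBl (admissible_ge0 (h_adm _)).
have ni j : itg M (n j) by exact: (itg_le (mn j) (nb j) gfi).
have n0 : (fun j => I M (n j)) @ \oo --> (0 : R).
  rewrite -(I_0 M).
  apply: (@I_dct _ _ _ M n (fun=> 0) (fun z => g (v z) * f z) mn _ _ gfi nb).2 => //.
  apply: filterS sae => z zae; rewrite -[X in _ --> X](mul0r (f z)).
  by apply: cvgM; [exact: defect_cvg sle zae _|exact: cvg_cst].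
have [mH [C HC]] := heat_test fC2 fs.
have W0 : (fun j => I M (fun z => V (s j) z * heat (-1) d1 d2 z)) @ \oo -->
    I M (fun z => v z * heat (-1) d1 d2 z).
  apply: (@cvg_subseq _ (fun k => I M (fun z => V k z * heat (-1) d1 d2 z))) sle _.
  apply: (@cvg_I_lip _ _ _ M _ V _ v C) => // [k||k z]; try exact: (itg_heat fC2 fs).
  by rewrite -mulrBl normrM mulrC ler_wpM2r.
have lim := cvgB (cvgD W0 (cvg_cst (I M (fun z => g (v z) * f z)))) n0.
rewrite -(vs _ _ _ fC2 fs) -[leLHS]subr0.
apply: (ler_cvg_to (lim _ _ _) (cvg_cst _)); apply: nearW => j /=.
have [_ hVi Vs] := V_sol (s j); have hfi := itg_test fC2 fs hVi.
rewrite -(Vs _ _ _ fC2 fs) -addrA lerD2l lerBlDr -I_D//.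
apply: I_le => //; first exact: itgD.
move=> z /=; rewrite /n -mulrDl ler_wpM2r//.
have : g (v z) - h (s j) (V (s j) z) <= pospart (g (v z) - h (s j) (V (s j) z)).
  by rewrite /pospart le_max lexx orbT.
by lra.
Qed.

Section Against.
Variables (nu : {measure set (BorelRV R N) -> \bar R}) (u : 'rV[R]_(N + 1) -> R).
Variable g' : R -> R.
Hypothesis g'_adm : admissible g'.
Hypothesis g'_le : forall s, g' s <= g s.
Hypothesis u_sol : solves M G g' nu u.
Hypothesis nu_mu : trace_le nu mu.
Variables (f : 'rV[R]_(N + 1) -> R) (d1 : 'I_(N + 1) -> 'rV[R]_(N + 1) -> R)
  (d2 : 'I_(N + 1) -> 'I_(N + 1) -> 'rV[R]_(N + 1) -> R).
Hypothesis fC2 : C2 f d1 d2.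
Hypothesis f_supp : supported G f.
Hypothesis f_ge0 : forall z, 0 <= f z.

Let ui : itg M u. Proof. by case: u_sol. Qed.
Let mu' := itg_measurable ui.

Let itg_reaction k : itg M (fun z => (h k (V k z) - g' (u z)) *
  (f z * (0 < u z - V k z)%R%:R)).
Proof.
have [_ hVi _] := V_sol k; have [_ g'ui _] := u_sol.
have i1 := itg_test fC2 f_supp (loc_itgB hVi g'ui).
have mi : borel_fun (fun z => (0 < u z - V k z)%R%:R : R).
  by apply: measurable_gt0_indic; exact: measurable_funB.
apply: eq_itg (itg_bound mi (C := 1) _ i1) => z /=; first by rewrite mulrA.
by case: (0 < _); rewrite ?normr1 ?normr0.
Qed.

(** Where [u > V k], monotonicity gives [h k (V k) <= g (V k) <= g (u)], so the reaction term in
    Kato's inequality is nonpositive; L^1 convergence then carries the inequality to [v]. *)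
Lemma solution_below : (forall s, g' s = g s) ->
  I M (fun z => pospart (u z - v z) * heat (-1) d1 d2 z) <= 0.
Proof.
move=> g'E; have [mH [C HC]] := heat_test fC2 f_supp.
have lim : (fun k => I M (fun z => pospart (u z - V k z) * heat (-1) d1 d2 z)) @ \oo -->
    I M (fun z => pospart (u z - v z) * heat (-1) d1 d2 z).
  apply: (@pospart_L1_cvg (fun k z => u z - V k z) V (fun z => u z - v z) v
    (heat (-1) d1 d2) C (fun k => itgB ui (Vi k)) (itgB ui vi) Vi vi _ V_cvg mH HC) => k z.
  rewrite distrC; congr `|_|; ring.
apply: (ler_cvg_to lim (cvg_cst _)).
apply: nearW => k; apply: le_trans (kato_difference g'_adm (h_adm k) u_sol (V_sol k) nu_mu
  fC2 f_supp f_ge0) _.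
rewrite -[leRHS](I_0 M); apply: I_le; first exact: itg_reaction.
  exact: itg0.
move=> z; have [uV|uV] := ltP 0 (u z - V k z); last by rewrite !mulr0.
rewrite mulr1 mulr_le0_ge0// subr_le0 g'E (le_trans (h_le k _))//.
by have [_ [gm _]] := g_adm; apply: gm; rewrite ltW// -subr_gt0.
Qed.

(** The data are ordered the wrong way for Kato's inequality on [V - u]. It is used for [(u - V)^+],
    and the equations of [u] and [V] supply the rest through [(V - u)^+ = (u - V)^+ - (u - V)]. The
    reactions then survive only where [u <= V], as a defect that tends to 0. *)
Lemma solution_above :
  I M (fun z => pospart (v z - u z) * heat (-1) d1 d2 z) <= trace mu f - trace nu f.
Proof.
have [s [sle sae]] := L1_ae_subseq Vi vi V_cvg.
have [mH [C HC]] := heat_test fC2 f_supp.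
have [_ g'ui us] := u_sol; have g'fi := itg_test fC2 f_supp g'ui.
have mf := measurable_test fC2.
pose n j z := pospart (g' (u z) - h (s j) (V (s j) z)) *
  (f z * (1 - (0 < u z - V (s j) z)%R%:R)).
have mn j : borel_fun (n j).
  apply: measurable_funM; last first.
    apply: measurable_funM => //; apply: measurable_funB => //.
    by apply: measurable_gt0_indic; exact: measurable_funB.
  apply: (@measurableT_comp _ _ _ _ _ _ (@pospart R)).
    by apply: continuous_measurable_fun; exact: continuous_pospart.
  by apply: measurable_funB; exact: measurable_admissible.
have nb j z : `|n j z| <= g' (u z) * f z.
  have i01 : 0 <= (1 - (0 < u z - V (s j) z)%R%:R : R) <= 1.
    by case: (0 < _); rewrite ?subrr ?subr0 lexx ler01.
  move/andP : i01 => [i0 i1].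
  rewrite /n normrM (ger0_norm (pospart_ge0 _)) ger0_norm; last exact: mulr_ge0.
  apply: ler_pM; rewrite ?pospart_ge0 ?mulr_ge0 ?ler_piMr//.
  rewrite /pospart ge_max (admissible_ge0 g'_adm) /=.
  by rewrite gerBl (admissible_ge0 (h_adm _)).
have ni j : itg M (n j) by exact: (itg_le (mn j) (nb j) g'fi).
have n0 : (fun j => I M (n j)) @ \oo --> (0 : R).
  rewrite -(I_0 M).
  apply: (@I_dct _ _ _ M n (fun=> 0) (fun z => g' (u z) * f z) mn _ _ g'fi nb).2 => //.
  (* If [v z < u z], then eventually [V z < u z] and the second factor of [n] vanishes. Otherwise
     [g' (u) <= g (u) <= g (v)], and [defect_cvg] applies. *)
  apply: filterS sae => z zae; have [vu|uv] := ltP (v z) (u z); last first.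
    apply: (@cvg_abs0_le _ _ (fun j => pospart (g' (u z) - h (s j) (V (s j) z)) * f z)).
      move=> j; rewrite /n normrM (ger0_norm (pospart_ge0 _)) ler_wpM2l ?pospart_ge0//.
      by case: (0 < _); rewrite ?subrr ?subr0 ?mulr0 ?mulr1 ?normr0 ?ger0_norm.
    rewrite -[X in _ --> X](mul0r (f z)); apply: cvgM; last exact: cvg_cst.
    apply: defect_cvg sle zae _; apply: le_trans (g'_le _) _.
    by have [_ [gm _]] := g_adm; exact: gm.
  apply: cvg_near_cst; near=> j.
  suff : 0 < u z - V (s j) z by rewrite /n => ->; rewrite subrr !mulr0.
  rewrite subr_gt0; near: j; exact: cvgr_lt zae _ vu.
have lim1 : (fun j => I M (fun z => pospart (V (s j) z - u z) * heat (-1) d1 d2 z)) @ \oo -->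
    I M (fun z => pospart (v z - u z) * heat (-1) d1 d2 z).
  apply: (@pospart_L1_cvg (fun j z => V (s j) z - u z) (fun j => V (s j)) (fun z => v z - u z) v
    (heat (-1) d1 d2) C (fun j => itgB (Vi (s j)) ui) (itgB vi ui) (fun j => Vi (s j)) vi _
    (cvg_subseq sle V_cvg) mH HC) => j z; congr `|_|; ring.
have lim2 : (fun j => trace mu f - trace nu f + I M (n j)) @ \oo --> trace mu f - trace nu f.
  by rewrite -[X in _ --> X]addr0; apply: cvgD n0; exact: cvg_cst.
apply: (ler_cvg_to lim1 lim2); apply: nearW => j.
have [_ hVi Vs] := V_sol (s j); have hfi := itg_test fC2 f_supp hVi.
have uHi := itg_heat fC2 f_supp ui; have VHi := itg_heat fC2 f_supp (Vi (s j)).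
have WHi := itg_heat fC2 f_supp (itgB ui (Vi (s j))).
have pHi := itg_heat fC2 f_supp (itg_pospart (itgB ui (Vi (s j)))).
have K := kato_difference g'_adm (h_adm (s j)) u_sol (V_sol (s j)) nu_mu fC2 f_supp f_ge0.
rewrite -(us _ _ _ fC2 f_supp) -(Vs _ _ _ fC2 f_supp).
have -> : (fun z => pospart (V (s j) z - u z) * heat (-1) d1 d2 z) =
   (fun z => pospart (u z - V (s j) z) * heat (-1) d1 d2 z -
     (u z * heat (-1) d1 d2 z - V (s j) z * heat (-1) d1 d2 z)).
  apply/funext => z; rewrite -!mulrBl; congr (_ * _).
  by have := pospart_sub (u z) (V (s j) z); lra.
rewrite !I_B//; last exact: itgB.
have ri := itg_reaction j.
(* There is equality where [u > V]; where [u <= V] the left integrand is 0, and [n j] compensates a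
   possibly negative difference of reactions. *)
have : I M (fun z => (h (s j) (V (s j) z) - g' (u z)) * (f z * (0 < u z - V (s j) z)%R%:R)) <=
   I M (fun z => (h (s j) (V (s j) z) * f z - g' (u z) * f z) + n j z).
  apply: I_le; first exact: itg_reaction.
    by apply: itgD => //; exact: itgB.
  move=> z; rewrite -mulrBl /n; have f0 := f_ge0 z.
  case: (0 < _) => /=; first by rewrite subrr !mulr0 addr0 mulr1.
  rewrite subr0 mulr0 mulr0 mulr1 -mulrDl mulr_ge0//.
  have : g' (u z) - h (s j) (V (s j) z) <= pospart (g' (u z) - h (s j) (V (s j) z)).
    by rewrite /pospart le_max lexx orbT.
  by lra.
rewrite I_D//; last exact: itgB.
rewrite I_B//; move: K => /=; lra.
Unshelve. all: by end_near. Qed.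

End Against.
End Limit.

End Comparison.

(** * Concentration at the initial time *)

Section Concentration.
Context {R : realType} {N : nat}.
Implicit Types (x : 'rV[R]_N) (z : 'rV[R]_(N + 1)) (O : set 'rV[R]_N).

Local Notation tau := (rshift N (ord0 : 'I_1)).
Local Notation sp i := (lshift 1 (i : 'I_N)).

Let split_sp (i : 'I_N) : fintype.split (sp i) = inl i.
Proof. exact: (unsplitK (inl _ i)). Qed.

Let split_tau (j : 'I_1) : fintype.split (rshift N j) = inr j.
Proof. exact: (unsplitK (inr _ j)). Qed.

Lemma is_derive_lsubmx (q : 'rV[R]_N -> R) (q' : 'I_N -> 'rV[R]_N -> R) :
  (forall i x, is_derive x (unitv i) q (q' i x)) ->
  forall k z, is_derive z (unitv k) (fun z => q (lsubmx z))
    (if fintype.split k is inl i then q' i (lsubmx z) else 0).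
Proof.
move=> dq k z; rewrite -[z in is_derive z]addr0 -(scale0r (unitv k)); apply/is_derive_line.
case: (split_ordP k) => j ->.
  have -> : (fun s : R => q (lsubmx (z + s *: unitv (sp j)))) =
      (fun s => q (lsubmx z + s *: unitv j)).
    apply/funext => s; congr q; rewrite linearD linearZ /=; congr (_ + _ *: _).
    by apply/rowP => l; rewrite !mxE (inj_eq (@lshift_inj _ _)).
  by apply/is_derive_line; rewrite scale0r addr0; exact: dq.
have -> : (fun s : R => q (lsubmx (z + s *: unitv (rshift N j)))) = (fun=> q (lsubmx z)).
  apply/funext => s; congr q; rewrite linearD linearZ /=.
  suff -> : lsubmx (unitv (rshift N j) : 'rV[R]_(N + 1)) = 0 by rewrite scaler0 addr0.
  by apply/rowP => l; rewrite !mxE eq_lrshift andbF.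
exact: is_derive_cst.
Qed.

Lemma continuous_lsubmx : continuous (fun z => lsubmx z).
Proof.
move=> z; have Fz := @nbhs_filter _ z; apply/cvg_ballP => e e0.
apply: filterS (nbhsx_ballx z e e0) => w /(ball_rV _ _ e0) zw.
by apply/(ball_rV _ _ e0) => i; rewrite !mxE.
Qed.

Lemma C2_lsubmx (p : 'rV[R]_N -> R) p1 p2 : C2 p p1 p2 ->
  C2 (fun z => p (lsubmx z)) (fun k z => if fintype.split k is inl i then p1 i (lsubmx z) else 0)
    (fun k l z => if fintype.split k is inl i then
       if fintype.split l is inl j then p2 i j (lsubmx z) else 0 else 0).
Proof.
move=> [h1 h2 c c1 c2].
have cl (q : 'rV[R]_N -> R) : continuous q -> continuous (fun z => q (lsubmx z)).
  by move=> cq z; exact: (continuous_comp (@continuous_lsubmx z) (cq _)).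
split.
- exact: is_derive_lsubmx.
- move=> k l z; case: (fintype.split k) => i; last exact: is_derive_cst.
  by apply: is_derive_lsubmx => j x; exact: h2.
- exact: cl.
- by move=> k; case: (fintype.split k) => i; [exact: cl|exact: cst_continuous].
- move=> k l; case: (fintype.split k) => i; last exact: cst_continuous.
  by case: (fintype.split l) => j; [exact: cl|exact: cst_continuous].
Qed.

(* The time profile [(1 - s)_+^3 (s + 3)_+^3], with [s = c t], is decreasing for [t > 0]. *)
Lemma concentrating_test (p : 'rV[R]_N -> R) p1 p2 (c : R) : C2 p p1 p2 -> 0 < c ->
  exists d1 d2,
    C2 (fun z => p (lsubmx z) *
      (pospart (- c * z ord0 tau + 1) ^+ 3 * pospart (c * z ord0 tau + 3) ^+ 3)) d1 d2 /\
    forall z, heat (-1) d1 d2 z =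
      3 * c * p (lsubmx z) * (pospart (- c * z ord0 tau + 1) * pospart (c * z ord0 tau + 3)) ^+ 2 *
        (pospart (c * z ord0 tau + 3) - pospart (- c * z ord0 tau + 1)) -
      (pospart (- c * z ord0 tau + 1) * pospart (c * z ord0 tau + 3)) ^+ 3 *
        \sum_(i < N) p2 i i (lsubmx z).
Proof.
move=> pC2 c0; have := C2_mul (C2_lsubmx pC2) (C2_mul (C2_pospart3 tau (- c) 1) (C2_pospart3 tau c 3)).
move=> H; eexists; eexists; split; first exact: H.
move=> z; rewrite /heat /=.
rewrite split_tau !eqxx mulr_sumr -sumrN; rewrite -[X in _ = _ + X]sumrN.
congr (_ + _); first by rewrite !mul1r; ring.
apply: eq_bigr => i _; rewrite split_sp eq_rlshift !mul0r !mulr0; ring.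
Qed.

(** For [t > 0] the time derivative contributes to [heat (-1)] a nonnegative term of unbounded size,
    so the uniform bound on it is one-sided. All constants and supports are uniform in [m], as
    dominated convergence will demand. *)
Lemma concentrating_tests O (T : R) (p : 'rV[R]_N -> R) : 0 < T -> smooth2 p ->
  supported O p -> (forall x, 0 <= p x) ->
  exists Z D1 D2 (r B C : R), 0 < r /\
    [/\ forall m : nat, C2 (Z m) (D1 m) (D2 m),
        forall m z, Z m z != 0 -> inner (cylinder O T) r B z,
        forall m z, 0 <= Z m z <= C,
        forall m x, Z m (spacetime x 0) = p x &
        forall z, 0 < z ord0 tau ->
          (forall m, - C <= heat (-1) (D1 m) (D2 m) z) /\
          \forall m \near \oo, Z m z = 0 /\ heat (-1) (D1 m) (D2 m) z = 0].
Proof.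
(* At [t = 0] the profile equals [1 ^ 3 * 3 ^ 3 = 27], which this factor normalises. *)
move=> T0 ps psupp p0; pose q x := 27^-1 * p x.
have q0 x : 0 <= q x by rewrite mulr_ge0// invr_ge0.
have [q1 [q2 qC2]] : smooth2 q by exact: smooth2_scale.
have qsupp : supported O q.
  have [r [B [r0 H]]] := psupp; exists r, B; split => // x qx; apply: H.
  by apply: contra_neq qx; rewrite /q => ->; rewrite mulr0.
have [r [B [C [r0 qi q1i q2i [qC q1C q2C]]]]] := supported_C2 qC2 qsupp.
(* The profile vanishes once [c m * t >= 1]: the summand [2 / T] brings this before [T / 2], the
   summand [m + 1] before [harmonic m]. *)
pose c (m : nat) : R := m%:R + 1 + 2 / T.
have T20 : 0 < 2 / T by rewrite divr_gt0.
have c1 m : 1 < c m by rewrite /c; have : 0 <= m%:R :> R := ler0n _ _; lra.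
have c0 m : 0 < c m by exact: lt_trans (c1 m).
have [D1 D1P] := choice (fun m => concentrating_test qC2 (c0 m)).
have [D2 D2P] := choice D1P.
pose a m z := pospart (- c m * z ord0 tau + 1).
pose b m z := pospart (c m * z ord0 tau + 3).
have a0 m z : 0 <= a m z by exact: pospart_ge0.
have b0 m z : 0 <= b m z by exact: pospart_ge0.
(* Where both factors are positive, the product is [(1 - s) * (s + 3) = 4 - (s + 1) ^ 2]; its cube
   yields the bound 64. *)
have ab4 m z : a m z * b m z <= 4.
  rewrite /a /b mulNr; move: (c m * _) => s; have := sqr_ge0 (s + 1); rewrite /pospart expr2.
  by case: (leP 0 (- s + 1)) => ?; case: (leP 0 (s + 3)) => ? ?; nra.
have ab0 m z : 0 <= a m z * b m z by exact: mulr_ge0.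
have ab64 m z : (a m z * b m z) ^+ 3 <= 64.
  have -> : 64 = 4 ^+ 3 :> R by ring.
  by apply: lerXn2r; rewrite ?nnegrE.
have C0 : 0 <= C by exact: le_trans (qC 0).
have CN0 : 0 <= C *+ N by exact: mulrn_wge0.
exists (fun m z => q (lsubmx z) * (a m z ^+ 3 * b m z ^+ 3)), D1, D2.
(* The profile lives in [-3 < c t < 1] with [c > 1], so [|t| < 3]; supports that end by [T / 2] keep
   a margin [T / 2] below [T]. *)
exists (Num.min r (T / 2)), (`|B| + 4), (64 * (C + C *+ N)).
have rm : 0 < Num.min r (T / 2) by rewrite lt_min r0; lra.
split=> //; split.
- by move=> m; have [] := D2P m.
- move=> m z; rewrite mulf_eq0 negb_or => /andP[/qi[zB zO]].
  rewrite mulf_eq0 negb_or !expf_eq0 /= => /andP[az bz].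
  have {}az : c m * z ord0 tau < 1.
    have : 0 < a m z by rewrite lt_neqAle eq_sym az a0.
    by rewrite pospart_gt0 mulNr; lra.
  have {}bz : - 3 < c m * z ord0 tau.
    have : 0 < b m z by rewrite lt_neqAle eq_sym bz b0.
    by rewrite pospart_gt0; lra.
  have c1m := c1 m.
  have zT : z ord0 tau <= T / 2.
    have [z0|z0] := leP 0 (z ord0 tau); last by lra.
    rewrite -[leRHS]mulr1 -ler_pdivrMl; last lra.
    rewrite invf_div; apply: le_trans (ltW az).
    by rewrite ler_wpM2r// /c; have : 0 <= m%:R :> R := ler0n _ _; lra.
  have zl : - 3 < z ord0 tau < 1 by apply/andP; split; nra.
  split.
    apply/ltW/cube_norm => [|k]; first by rewrite ltr_wpDl.
    have Bl := ler_norm B; case: (split_ordP k) => j ->.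
      have := coord_norm_le (lsubmx z) j; rewrite mxE; lra.
    by rewrite (ord1 j) ltr_norml; have := normr_ge0 B; lra.
  move=> w /(ball_rV _ _ rm) zw; split.
    apply: zO; apply/(ball_rV _ _ r0) => i; rewrite !mxE.
    by apply: lt_le_trans (zw (sp i)) _; rewrite ge_min lexx.
  have := zw tau; rewrite lt_min => /andP[_ /ltr_normlP[? ?]]; lra.
- move=> m z; rewrite -exprMn mulr_ge0 ?exprn_ge0//=.
  apply: (@le_trans _ _ (C * 64)); last lra.
  apply: ler_pM; rewrite ?exprn_ge0//.
  exact: le_trans (ler_norm _) (qC _).
- move=> m x; rewrite /a /b spacetime_tau spacetime_l !mulr0 !add0r /q.
  by rewrite /pospart !max_r//; field.
- move=> z z0; split => [m|].
    have [_ ->] := D2P m; rewrite -/(a m z) -/(b m z).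
    have ba : a m z <= b m z.
      have := mulr_gt0 (c0 m) z0; rewrite /a /b mulNr; move: (c m * _) => s s0.
      rewrite /pospart; case: (leP 0 (- s + 1)) => ?; case: (leP 0 (s + 3)) => ?; lra.
    have h1 : 0 <= 3 * c m * q (lsubmx z) * (a m z * b m z) ^+ 2 * (b m z - a m z).
      have := c0 m; have := q0 (lsubmx z) => ? ?.
      by rewrite !mulr_ge0 ?sqr_ge0 ?subr_ge0// ltW.
    have h2 : `|\sum_(i < N) q2 i i (lsubmx z)| <= C *+ N.
      apply: le_trans (ler_norm_sum _ _ _) _.
      by rewrite -[X in _ *+ X]card_ord -sumr_const; apply: ler_sum => i _; exact: q2C.
    have h3 : (a m z * b m z) ^+ 3 * \sum_(i < N) q2 i i (lsubmx z) <= 64 * (C *+ N).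
      apply: le_trans (ler_norm _) _; rewrite normrM ger0_norm ?exprn_ge0//.
      by apply: ler_pM; rewrite ?exprn_ge0.
    lra.
  have [m0 _ Hm0] := (@cvgrPdist_lt _ _ _ _ _ _ _).1 (@cvg_harmonic R) _ z0.
  exists m0 => // m /Hm0; rewrite /= sub0r normrN ger0_norm ?harmonic_ge0// => hm.
  have am : a m z = 0.
    rewrite /a /pospart max_l// mulNr.
    have : 1 <= (m%:R + 1) * z ord0 tau.
      have m1 : 0 < m%:R + 1 :> R by rewrite ltr_wpDl.
      by rewrite mulrC -ler_pdivrMr// div1r natr1; exact: ltW.
    by rewrite /c; nra.
  have [_ ->] := D2P m; rewrite -/(a m z) -/(b m z) am.
  by split; rewrite ?mul0r ?expr0n ?mul0r ?mulr0 ?mul0r ?subrr.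
Qed.

End Concentration.

(** * Recovering initial traces from bounds on positive parts *)

Section InitialTrace.
Context {R : realType} {N : nat}.
Variable M : {sigma_finite_measure set (BorelRV R (N + 1)) -> \bar R}.
Hypothesis M_nice : nice M.

Lemma trace_difference_le (O : set 'rV[R]_N) (T : R) (g : R -> R)
    (nu1 nu2 : {measure set (BorelRV R N) -> \bar R}) (u v : 'rV[R]_(N + 1) -> R)
    (p : 'rV[R]_N -> R) (D : R) :
  0 < T -> admissible g ->
  solves M (cylinder O T) g nu1 u -> solves M (cylinder O T) g nu2 v ->
  (forall z : 'rV[R]_(N + 1), z ord0 (rshift N ord0) <= 0 -> u z = 0 /\ v z = 0) ->
  smooth2 p -> supported O p -> (forall x, 0 <= p x) ->
  (forall f d1 d2, C2 f d1 d2 -> supported (cylinder O T) f -> (forall z, 0 <= f z) ->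
    (forall x, f (spacetime x 0) = p x) ->
    I M (fun z => pospart (v z - u z) * heat (-1) d1 d2 z) <= D) ->
  I nu2 p - I nu1 p <= D.
Proof.
move=> T0 g_adm [ui gui us] [vi gvi vs] uv0 ps psupp p0 vu_le.
have [Z [D1 [D2 [r [B [C [r0 [ZC2 Zi ZC Zp Z0]]]]]]]] := concentrating_tests T0 ps psupp p0.
have Zs m : supported (cylinder O T) (Z m) by exists r, B; split => //; exact: Zi.
have Zge m z : 0 <= Z m z by have /andP[] := ZC m z.
have ZabsC m z : `|Z m z| <= C by rewrite ger0_norm//; have /andP[] := ZC m z.
have trE (nu : {measure set (BorelRV R N) -> \bar R}) m : I nu (fun x => Z m (spacetime x 0)) = I nu p.
  by apply: eq_I => x; exact: Zp.
have mheat m := (heat_test (ZC2 m) (Zs m)).1.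
have uvi := itgB ui vi.
have pos0 : pospart 0 = 0 :> R by rewrite /pospart maxxx.
have pos_cont := @continuous_pospart R.
have mpos : measurable_fun setT (@pospart R) by exact: continuous_measurable_fun.
pose n m z := pospart (u z - v z) * pospart (- heat (-1) (D1 m) (D2 m) z).
have uv_out (z : 'rV[R]_(N + 1)) : ~ 0 < z ord0 (rshift N (ord0 : 'I_1)) -> u z = 0 /\ v z = 0.
  by move/negP; rewrite -leNgt; exact: uv0.
have C0 : 0 <= C by exact: le_trans (ZabsC 0 0).
have mn m : borel_fun (n m).
  apply: measurable_funM; first exact: (itg_measurable (itg_pospart uvi)).
  by apply: measurableT_comp => //; exact: measurableT_comp.
have nb m z : `|n m z| <= C * pospart (u z - v z).
  rewrite /n normrM (ger0_norm (pospart_ge0 _)) (ger0_norm (pospart_ge0 _)) mulrC.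
  have [z0|/uv_out[-> ->]] := pselect (0 < z ord0 (rshift N (ord0 : 'I_1))); last first.
    by rewrite subr0 pos0 !mulr0.
  apply: ler_wpM2r; first exact: pospart_ge0.
  by have [/(_ m) ? _] := Z0 z z0; rewrite /pospart ge_max C0 lerNl.
have nCi : itg M (fun z => C * pospart (u z - v z)) by apply: itgZ; exact: itg_pospart.
have n0 : (fun m => I M (n m)) @ \oo --> (0 : R).
  rewrite -[X in _ --> X](I_0 M).
  apply: (@I_dct _ _ _ M n (fun=> 0) _ mn _ _ nCi nb).2 => //.
  apply: aeW => z; have [z0|/uv_out[uz vz]] := pselect (0 < z ord0 (rshift N (ord0 : 'I_1))).
    have [_ near0] := Z0 z z0; apply: cvg_near_cst; apply: filterS near0 => m [_ h0].
    by rewrite /n h0 oppr0 pos0 mulr0.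
  apply: cvg_near_cst; apply: nearW => m.
  by rewrite /n uz vz subr0 pos0 mul0r.
pose e m z := (g (v z) - g (u z)) * Z m z.
have vui := loc_itgB gvi gui.
have e0 : (fun m => I M (e m)) @ \oo --> (0 : R).
  rewrite -[X in _ --> X](I_0 M).
  apply: (@I_dct _ _ _ M e (fun=> 0)
    (fun z => C * `|(g (v z) - g (u z)) * \1_(inner (cylinder O T) r B) z|) _ _ _ _ _).2 => //.
  - by move=> m; exact: (itg_measurable (itg_test (ZC2 m) (Zs m) vui)).
  - apply: aeW => z; apply: cvg_near_cst.
    have [z0|/uv_out[uz vz]] := pselect (0 < z ord0 (rshift N (ord0 : 'I_1))).
      by have [_ near0] := Z0 z z0; apply: filterS near0 => m [h0 _]; rewrite /e h0 mulr0.
    by apply: nearW => m; rewrite /e uz vz subrr mul0r.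
  - by apply: itgZ; apply: itg_abs; exact: vui.
  - move=> m z; rewrite /e; have [->|Zz] := eqVneq (Z m z) 0.
      by rewrite mulr0 normr0 mulr_ge0.
    rewrite indicE mem_set; last exact: (Zi _ _ Zz).
    by rewrite mulr1 normrM mulrC ler_wpM2r.
have lim : (fun m => D + I M (n m) + I M (e m)) @ \oo --> D.
  rewrite -[X in _ --> X]addr0 -[X in _ --> X + _]addr0.
  by apply: cvgD e0; apply: cvgD n0; exact: cvg_cst.
apply: (ler_cvg_to (cvg_cst _) lim); apply: nearW => m.
have Hm := vu_le _ _ _ (ZC2 m) (Zs m) (Zge m) (Zp m).
have iv := itg_heat (ZC2 m) (Zs m) vi; have iu := itg_heat (ZC2 m) (Zs m) ui.
have ip := itg_heat (ZC2 m) (Zs m) (itg_pospart (itgB vi ui)).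
have gvZ := itg_test (ZC2 m) (Zs m) gvi; have guZ := itg_test (ZC2 m) (Zs m) gui.
have eE : I M (e m) = I M (fun z => g (v z) * Z m z) - I M (fun z => g (u z) * Z m z).
  by rewrite -I_B//; apply: eq_I => z; rewrite /e mulrBl.
(* With [H] the heat term, [(v - u) H = (v - u)^+ H + (u - v)^+ (- H)], and [- H] is at most its
   positive part. *)
have main : I M (fun z => v z * heat (-1) (D1 m) (D2 m) z - u z * heat (-1) (D1 m) (D2 m) z) <=
    I M (fun z => pospart (v z - u z) * heat (-1) (D1 m) (D2 m) z + n m z).
  have ni : itg M (n m) by exact: (itg_le (mn m) (nb m) nCi).
  apply: I_le; [exact: itgB|exact: itgD|move=> z].
  rewrite -mulrBl -[X in X * _ <= _]pospart_sub mulrBl /n lerD2l -mulrN ler_wpM2l ?pospart_ge0//.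
  by rewrite /pospart le_max lexx orbT.
rewrite I_B// I_D// in main; last exact: (itg_le (mn m) (nb m) nCi).
rewrite -(trE nu1 m) -(trE nu2 m) -(us _ _ _ (ZC2 m) (Zs m)) -(vs _ _ _ (ZC2 m) (Zs m)).
by move: eE => /= ->; lra.
Qed.

End InitialTrace.

(** * From smooth functions to Borel sets *)

Section Density.
Context {R : realType} {N : nat}.
Implicit Types (x z : 'rV[R]_N) (p : 'rV[R]_N -> R) (A U V O : set 'rV[R]_N).

Definition box (a b : 'rV[R]_N) : set 'rV[R]_N := [set z | box_bump a b z != 0].

(** Boxes with rational centre and radius [harmonic k], enumerated through [unpickle]. Each keeps a
    positive distance to the complement of [V], so functions supported in one of them are legitimate
    tests. *)
Lemma open_box_cover V : (0 < N)%N -> open V -> exists a b : nat -> 'rV[R]_N,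
  V = \bigcup_n box (a n) (b n) /\
  forall n, exists r B : R, 0 < r /\ box (a n) (b n) `<=` inner V r B.
Proof.
move=> N0 oV.
pose q n : 'rV[rat]_N * nat := odflt (0, 0%N) (unpickle n).
pose c n : 'rV[R]_N := map_mx ratr (q n).1.
pose e n : R := harmonic (q n).2.
have e0 n : 0 < e n by exact: harmonic_gt0.
(* Twice the radius is required to fit, which leaves the margin [e n] around the box itself. *)
pose good n := `[< ball (c n) (2 * e n) `<=` V >].
(* A bad index receives the corners 1 and 0 in the wrong order, hence an empty box since [N > 0]. *)
pose a n := if good n then c n - const_mx (e n) else const_mx 1.
pose b n := if good n then c n + const_mx (e n) else const_mx 0.
have box_in n z : box (a n) (b n) z -> ball (c n) (2 * e n) `<=` V /\ ball (c n) (e n) z.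
  rewrite /box /= => /bump_neq0; rewrite /a /b /good; case: asboolP => [gn|_] H.
    split=> //; apply/(ball_rV _ _ (e0 n)) => i; have := H i; rewrite !mxE.
    by move=> /andP[? ?]; rewrite ltr_norml; apply/andP; split; lra.
  by have := H (Ordinal N0); rewrite !mxE => /andP[? ?]; exfalso; lra.
have inner_n n : box (a n) (b n) `<=` inner V (e n) (`|c n| + e n).
  move=> z /box_in[gn /ball_norm_lt cz]; split.
    by have := ler_normB (c n) (c n - z); rewrite subKr; lra.
  move=> w /ball_norm_lt zw; apply/gn/ball_norm_lt.
  by have := ler_distD z (c n) w; lra.
exists a, b; split; last by move=> n; exists (e n), (`|c n| + e n).
apply/seteqP; split => x; last by move=> [n _ /inner_n]; exact: inner_sub.
move=> Vx; have /nbhs_ballP[d /= d0 dV] : nbhs x V by exact: open_nbhs_nbhs.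
have d30 : 0 < d / 3 by lra.
have [k _ /(_ k (leqnn k))] := (@cvgrPdist_lt _ _ _ _ _ _ _).1 (@cvg_harmonic R) _ d30.
rewrite sub0r normrN ger0_norm ?harmonic_ge0// => kd.
have k0 : 0 < harmonic k :> R by exact: harmonic_gt0.
have [y xy] := ratr_approx x k0.
have qE : q (pickle (y, k)) = (y, k) by rewrite /q pickleK.
have gn : good (pickle (y, k)).
  have k20 : 0 < 2 * harmonic k :> R by lra.
  apply/asboolP => z; rewrite /c /e qE /= => /(ball_rV _ _ k20) yz.
  apply: dV; apply/(ball_rV _ _ d0) => i; have := yz i; rewrite mxE => yzi; have xyi := xy i.
  have := ler_distD (ratr (y ord0 i)) (x ord0 i) (z ord0 i); lra.
exists (pickle (y, k)) => //; apply/bump_neq0 => i.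
rewrite /a /b gn /c /e qE !mxE; have /ltr_normlP[? ?] := xy i.
by apply/andP; split; lra.
Qed.

Lemma smooth2_exp p m : smooth2 p -> smooth2 (fun x => p x ^+ m).
Proof.
move=> ps; elim: m => [|m IH].
  by under [X in smooth2 X]eq_fun do rewrite expr0; exact: smooth2_cst.
by under [X in smooth2 X]eq_fun do rewrite exprS; exact: smooth2_mul.
Qed.

Lemma smooth2_1B p : smooth2 p -> smooth2 (fun x => 1 - p x).
Proof.
move=> ps; have := smooth2_add (smooth2_cst 1) (smooth2_scale (-1) ps).
by under [X in smooth2 X -> _]eq_fun do rewrite mulN1r.
Qed.

Lemma measurable_smooth2 p : smooth2 p ->
  borel_fun p.
Proof. by move=> [? [? [_ _ cp _ _]]]; exact: continuous_measurable_rV. Qed.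

(* [1 - (1 - k)^m] increases to the indicator function of [k > 0]. *)
Lemma box_approx (a b : 'rV[R]_N) : (0 < N)%N -> exists chi : nat -> 'rV[R]_N -> R,
  [/\ forall m, smooth2 (chi m), forall m x, 0 <= chi m x <= 1,
      forall m x, chi m x != 0 -> box a b x &
      forall x, (fun m => chi m x) @ \oo --> (\1_(box a b) x : R)].
Proof.
move=> N0; have [f1 [f2 fC2]] := smooth2_bump a b; have [_ _ cf _ _] := fC2.
have fsupp x : box_bump a b x != 0 -> `|x| <= `|a| + `|b|.
  move=> /bump_neq0 H; apply/ler_addgt0Pr => e e0; apply/ltW/cube_norm => [|i].
    by rewrite ltr_wpDl// addr_ge0.
  have /andP[? ?] := H i; have := coord_norm_le a i; have := coord_norm_le b i.
  move=> /ler_normlP[? ?] /ler_normlP[? ?].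
  have := normr_ge0 a; have := normr_ge0 b.
  by rewrite ltr_norml => ? ?; apply/andP; split; lra.
have [C fC] := continuous_support_bounded cf fsupp.
have C0 : 0 <= C by exact: le_trans (fC 0).
have C1 : 0 < C + 1 by lra.
pose k x := (C + 1)^-1 * box_bump a b x.
have k01 x : 0 <= k x < 1.
  rewrite /k mulr_ge0 ?invr_ge0 ?bump_ge0//; last lra.
  by rewrite ltr_pdivrMl// mulr1; have := fC x; have := ler_norm (box_bump a b x); lra.
exists (fun m x => 1 - (1 - k x) ^+ m); split.
- move=> m; apply: smooth2_1B; apply: smooth2_exp; apply: smooth2_1B.
  by apply: smooth2_scale; exact: smooth2_bump.
- move=> m x; have /andP[? ?] := k01 x.
  have : 0 <= (1 - k x) ^+ m by rewrite exprn_ge0//; lra.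
  have : (1 - k x) ^+ m <= 1 by rewrite exprn_ile1//; lra.
  by move=> ? ?; apply/andP; split; lra.
- move=> m x; rewrite /box /=; apply: contra_neq => f0.
  by rewrite /k f0 mulr0 subr0 expr1n subrr.
- move=> x; rewrite indicE; have [/set_mem xb|xb] := boolP (x \in box a b).
    rewrite -[X in _ --> X]subr0; apply: cvgB; first exact: cvg_cst.
    have /andP[kx0 kx1] := k01 x.
    have kx : 0 < k x by rewrite lt_neqAle eq_sym kx0 andbT mulf_neq0// invr_eq0 gt_eqF.
    by apply: cvg_expr; rewrite ger0_norm; lra.
  have f0 : box_bump a b x = 0.
    by apply/eqP; apply: contraNT xb => f0; rewrite mem_set.
  by apply: cvg_near_cst; apply: nearW => m; rewrite /k f0 mulr0 subr0 expr1n subrr.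
Qed.

Variables (al be : {measure set (BorelRV R N) -> \bar R}).

Section FiniteRegion.
Variable U : set 'rV[R]_N.
Hypothesis mU : measurable (U : set (BorelRV R N)).
Hypothesis al_fin : (al U < +oo)%E.
Hypothesis be_fin : (be U < +oo)%E.

Let itg_region (mu : {measure set (BorelRV R N) -> \bar R}) (f : BorelRV R N -> R) C :
  (mu U < +oo)%E -> measurable_fun setT f -> (forall x, `|f x| <= C) ->
  itg mu (fun x => f x * \1_U x).
Proof.
move=> muU mf fC; apply: eq_itg (itg_bound mf fC (_ : itg mu (\1_U))) => [x|]; first exact: mulrC.
apply: itgP; first exact: measurable_indic.
under eq_integral do rewrite ger0_norm//.
by rewrite integral_indic// setIT.
Qed.

(** The two L^1 norms over [U] are added because a single smooth function must be close to an
    indicator for both measures at once. *)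
Definition region_dist (f : BorelRV R N -> R) : R :=
  I al (fun x => `|f x| * \1_U x) + I be (fun x => `|f x| * \1_U x).

Let rd_ge0 f : 0 <= region_dist f.
Proof. by rewrite addr_ge0//; apply: I_ge0 => x; rewrite mulr_ge0. Qed.

Let rdD_le (f g h : BorelRV R N -> R) (C : R) : measurable_fun setT f -> measurable_fun setT g ->
  measurable_fun setT h ->
  (forall x, `|f x| <= C) -> (forall x, `|g x| <= C) -> (forall x, `|h x| <= C) ->
  (forall x, U x -> `|f x| <= `|g x| + `|h x|) ->
  region_dist f <= region_dist g + region_dist h.
Proof.
move=> mf mg mh fC gC hC fgh.
have i (mu : {measure set (BorelRV R N) -> \bar R}) (k : BorelRV R N -> R) : (mu U < +oo)%E ->
    measurable_fun setT k -> (forall x, `|k x| <= C) -> itg mu (fun x => `|k x| * \1_U x).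
  move=> muU mk kC; apply: (itg_region muU (C := C)); first exact: measurableT_comp.
  by move=> x; rewrite normr_id.
rewrite /region_dist addrACA -!I_D; [|exact: i..].
apply: lerD; apply: I_le; try exact: i; try (by apply: itgD; exact: i);
  move=> x; rewrite -mulrDl indicE; have [/set_mem Ux|] := boolP (x \in U);
  by rewrite ?mulr1 ?mulr0//; exact: fgh.
Qed.

Let rd_cvg (F : nat -> BorelRV R N -> R) : (forall n, measurable_fun setT (F n)) ->
  (forall n x, `|F n x| <= 1) -> (forall x, (fun n => F n x) @ \oo --> (0 : R)) ->
  (fun n => region_dist (F n)) @ \oo --> (0 : R).
Proof.
move=> mF F1 F0.
have key (mu : {measure set (BorelRV R N) -> \bar R}) : (mu U < +oo)%E ->
    (fun n => I mu (fun x => `|F n x| * \1_U x)) @ \oo --> (0 : R).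
  move=> muU; rewrite -[X in _ --> X](I_0 mu).
  apply: (@I_dct _ _ _ mu (fun n x => `|F n x| * \1_U x) (fun=> 0) (fun x => 1 * \1_U x)
    _ _ _ _ _).2 => //.
  - move=> n; apply: measurable_funM; first exact: measurableT_comp.
    exact: measurable_indic.
  - apply: aeW => x; rewrite -[X in _ --> X](mul0r (\1_U x)); apply: cvgM; last exact: cvg_cst.
    by rewrite -(normr0 R); apply: cvg_norm.
  - by apply: (itg_region muU (C := 1)) => // x; rewrite normr1.
  - by move=> n x; rewrite normrM normr_id ler_pM// ger0_norm.
by rewrite -[X in _ --> X]addr0; apply: cvgD; exact: key.
Qed.

(** These sets form a sigma-algebra: [1 - p] serves for complements, the product [p * q] for
    intersections, and dominated convergence on the finite region for countable unions. Boxes belong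
    to it by [box_approx], hence so do all open sets. *)
Definition approximable_set (A : set (BorelRV R N)) := measurable A /\
  forall d : R, 0 < d -> exists2 p, smooth2 p /\ (forall x, 0 <= p x <= 1) &
    region_dist (fun x => p x - \1_A x) <= d.

Let indic01 (A : set (BorelRV R N)) x : 0 <= (\1_A x : R) <= 1.
Proof. by rewrite indicE; case: (_ \in _); rewrite lexx ler01. Qed.

Let sub_le1 (s t : R) : 0 <= s <= 1 -> 0 <= t <= 1 -> `|s - t| <= 1.
Proof. by move=> /andP[? ?] /andP[? ?]; rewrite ler_norml; apply/andP; split; lra. Qed.

Let msub p (A : set (BorelRV R N)) : smooth2 p -> measurable A ->
  measurable_fun setT (fun x : BorelRV R N => p x - \1_A x).
Proof.
by move=> /measurable_smooth2 mp mA; apply: measurable_funB => //; exact: measurable_indic.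
Qed.

Lemma approximable_setC A : approximable_set A -> approximable_set (~` A).
Proof.
move=> [mA H]; split; first exact: measurableC.
move=> d /H[p [ps p01] pd]; exists (fun x => 1 - p x).
  split; first exact: smooth2_1B.
  by move=> x; have /andP[? ?] := p01 x; apply/andP; split; lra.
apply: le_trans pd; rewrite le_eqVlt; apply/orP; left; apply/eqP.
congr (_ + _); apply: eq_I => x; congr (_ * _); rewrite !indicE in_setC;
  by case: (x \in A) => /=; rewrite -[in RHS]normrN; congr `|_|; ring.
Qed.

Lemma approximable_setI A B : approximable_set A -> approximable_set B ->
  approximable_set (A `&` B).
Proof.
move=> [mA HA] [mB HB]; split; first exact: measurableI.
move=> d d0; have d20 : 0 < d / 2 by lra.
have [p [ps p01] pd] := HA _ d20; have [q [qs q01] qd] := HB _ d20.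
have ms := smooth2_mul ps qs.
have pq01 x : 0 <= p x * q x <= 1.
  by have /andP[? ?] := p01 x; have /andP[? ?] := q01 x; apply/andP; split; nra.
exists (fun x => p x * q x) => //; rewrite (splitr d); apply: le_trans (lerD pd qd).
apply: (@rdD_le _ _ _ 1) => [|||x|x|x|]; try exact: sub_le1; try exact: msub.
  by apply: msub => //; exact: measurableI.
move=> x _; have /andP[p0 p1] := p01 x; have /andP[q0 q1] := q01 x.
have -> : \1_(A `&` B) x = \1_A x * \1_B x :> R by rewrite !indicE in_setI -natrM mulnb.
have /andP[a0 a1] := indic01 A x.
have -> : p x * q x - \1_A x * \1_B x = (p x - \1_A x) * q x + \1_A x * (q x - \1_B x) by ring.
apply: le_trans (ler_normD _ _) _; rewrite !normrM.
by apply: lerD; [rewrite ler_piMr// ger0_norm|rewrite ler_piMl// ger0_norm].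
Qed.

Lemma approximable_limit (F : nat -> set (BorelRV R N)) (A : set (BorelRV R N)) :
  (forall n, approximable_set (F n)) -> measurable A ->
  (forall x, (fun n => \1_(F n) x : R) @ \oo --> (\1_A x : R)) -> approximable_set A.
Proof.
move=> aF mA FA; split=> // d d0; have d20 : 0 < d / 2 by lra.
have lim : (fun n => region_dist (fun x => \1_(F n) x - \1_A x)) @ \oo --> (0 : R).
  apply: rd_cvg.
  - by move=> n; apply: measurable_funB; apply: measurable_indic => //; case: (aF n).
  - by move=> n x; exact: sub_le1.
  - by move=> x; rewrite -(subrr (\1_A x : R)); apply: cvgB (FA x) (cvg_cst _).
have [n _ /(_ n (leqnn n))] := (@cvgrPdist_le _ _ _ _ _ _ _).1 lim _ d20.
rewrite /= sub0r normrN ger0_norm ?rd_ge0// => nd.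
have [mFn /(_ _ d20)[p [ps p01] pd]] := aF n.
exists p => //; rewrite (splitr d); apply: le_trans (lerD pd nd).
apply: (@rdD_le _ _ _ 1) => [|||x|x|x|]; try exact: sub_le1; try exact: msub.
- by apply: measurable_funB; exact: measurable_indic.
- move=> x _; have := ler_normD (p x - \1_(F n) x) (\1_(F n) x - \1_A x).
  by rewrite addrA subrK.
Qed.

Lemma region_dist_smooth_limit (chi : nat -> 'rV[R]_N -> R) (A : set (BorelRV R N)) (d : R) :
  (forall m, smooth2 (chi m)) -> (forall m x, 0 <= chi m x <= 1) -> measurable A ->
  (forall x, (fun m => chi m x) @ \oo --> (\1_A x : R)) -> 0 < d ->
  exists m, region_dist (fun x => chi m x - \1_A x) <= d.
Proof.
move=> cs c01 mA cA d0.
have lim : (fun n => region_dist (fun x => chi n x - \1_A x)) @ \oo --> (0 : R).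
  apply: rd_cvg.
  - by move=> n; exact: msub.
  - by move=> n x; exact: sub_le1.
  - by move=> x; rewrite -(subrr (\1_A x : R)); apply: cvgB (cA x) (cvg_cst _).
have [n _ /(_ n (leqnn n))] := (@cvgrPdist_le _ _ _ _ _ _ _).1 lim _ d0.
by rewrite /= sub0r normrN ger0_norm ?rd_ge0// => nd; exists n.
Qed.

(** On the region where distances are measured the indicator of [U] is 1, so a cut-off close to it
    changes [p] little. *)
Lemma region_dist_mul p q (A : set (BorelRV R N)) : smooth2 p -> smooth2 q ->
  (forall x, 0 <= p x <= 1) -> (forall x, 0 <= q x <= 1) -> measurable A ->
  region_dist (fun x => p x * q x - \1_A x) <=
  region_dist (fun x => p x - \1_A x) + region_dist (fun x => q x - \1_U x).
Proof.
move=> ps qs p01 q01 mA; have pqs := smooth2_mul ps qs.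
have pq01 x : 0 <= p x * q x <= 1.
  by have /andP[? ?] := p01 x; have /andP[? ?] := q01 x; apply/andP; split; nra.
apply: (@rdD_le _ _ _ 1) => [|||x|x|x|x Ux]; try exact: sub_le1; try exact: msub.
rewrite [\1_U x]indicE mem_set//; have /andP[p0 p1] := p01 x.
have -> : p x * q x - \1_A x = (p x - \1_A x) + p x * (q x - 1) by ring.
apply: le_trans (ler_normD _ _) _; rewrite lerD2l normrM.
by rewrite ler_piMl// ger0_norm.
Qed.

Lemma measurable_box a b : measurable (box a b : set (BorelRV R N)).
Proof.
apply: open_measurable_rV; have [? [? [_ _ cf _ _]]] := smooth2_bump a b.
apply: (@open_comp _ _ (box_bump a b) [set s | s != 0]); last exact: open_neq.
by move=> ? _; exact: cf.
Qed.

Lemma approximable_set0 : approximable_set set0.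
Proof.
split=> // d d0; exists (fun=> 0).
  by split; [exact: smooth2_cst|move=> x; rewrite lexx ler01].
rewrite /region_dist; under eq_I do rewrite indic0 subrr normr0 mul0r.
by under [X in _ + X]eq_I do rewrite indic0 subrr normr0 mul0r; rewrite !I_0 addr0 ltW.
Qed.

Lemma approximable_bigcup (F : nat -> set (BorelRV R N)) :
  (forall n, approximable_set (F n)) -> approximable_set (\bigcup_n F n).
Proof.
move=> aF; apply: (@approximable_limit (fun n => \big[setU/set0]_(i < n) F i)).
- elim=> [|n IH].
    by rewrite big_ord0; exact: approximable_set0.
  rewrite big_ord_recr /= -[_ `|` _]setCK setCU; apply: approximable_setC.
  by apply: approximable_setI; apply: approximable_setC.
- by apply: bigcup_measurable => n _; case: (aF n).
- move=> x; rewrite indicE; have [/set_mem[n _ Fx]|nx] := boolP (x \in \bigcup_n F n).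
    apply: cvg_near_cst; exists n.+1 => // m /= nm; rewrite indicE mem_set//.
    by rewrite -bigcup_mkord; exists n.
  apply: cvg_near_cst; apply: nearW => m; rewrite indicE memNset//.
  rewrite -bigcup_mkord => -[k _ Fx]; move: nx; rewrite mem_set//.
  by exists k.
Qed.

Lemma measurable_approximable (A : set (BorelRV R N)) : (0 < N)%N -> measurable A ->
  approximable_set A.
Proof.
move=> N0; apply: (@smallest_sub _ _ _ approximable_set).
  split.
  - exact: approximable_set0.
  - by move=> B aB; rewrite setTD; exact: approximable_setC.
  - exact: approximable_bigcup.
move=> V oV; have [a [b [-> _]]] := open_box_cover N0 oV.
apply: approximable_bigcup => n.
have [chi [cs c01 _ clim]] := box_approx (a n) (b n) N0.
split=> [|d d0]; first exact: measurable_box.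
have [m cd] := region_dist_smooth_limit cs c01 (measurable_box _ _) clim d0.
by exists (chi m).
Qed.

End FiniteRegion.

Variable O : set 'rV[R]_N.
Hypothesis N0 : (0 < N)%N.
Hypothesis oO : open O.
Hypothesis al_radon : forall K : set 'rV[R]_N, compact K -> K `<=` O -> (al K < +oo)%E.
Hypothesis be_radon : forall K : set 'rV[R]_N, compact K -> K `<=` O -> (be K < +oo)%E.
Hypothesis al_le_be : forall p, smooth2 p -> supported O p -> (forall x, 0 <= p x) ->
  I al p <= I be p.

(** The hypothesis on smooth functions is applied to one function close to the indicator of [A] for
    both measures; the box has finite mass because it lies in a compact subset of [O]. *)
Lemma box_measure_le a b (r B : R) (A : set (BorelRV R N)) : 0 < r ->
  box a b `<=` inner O r B -> measurable A -> A `<=` box a b -> (al A <= be A)%E.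
Proof.
move=> r0 bi mA Ab; have mU := measurable_box a b.
have mi : measurable (inner O r B : set (BorelRV R N)) by exact: measurable_inner.
have fin (mu : {measure set (BorelRV R N) -> \bar R}) :
    (forall K : set 'rV[R]_N, compact K -> K `<=` O -> (mu K < +oo)%E) ->
    (mu (box a b) < +oo)%E.
  move=> muO; apply: (@le_lt_trans _ _ (mu (inner O r B))).
    by apply: le_measure; rewrite ?inE.
  by apply: muO; [exact: inner_compact|exact: inner_sub].
have alU := fin al al_radon; have beU := fin be be_radon.
have finA (mu : {measure set (BorelRV R N) -> \bar R}) : (mu (box a b) < +oo)%E ->
    (mu A < +oo)%E.
  by apply: le_lt_trans; apply: le_measure; rewrite ?inE.
have indi (mu : {measure set (BorelRV R N) -> \bar R}) (S : set (BorelRV R N)) :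
    measurable S -> (mu S < +oo)%E -> itg mu (\1_S) /\ (I mu (\1_S))%:E = mu S.
  move=> mS muS; have i1 : itg mu (\1_S).
    apply: itgP; first exact: measurable_indic.
    under eq_integral do rewrite ger0_norm//.
    by rewrite integral_indic// setIT.
  by split=> //; rewrite -itgE// integral_indic// setIT.
have [iA alE] := indi al A mA (finA al alU); have [jA beE] := indi be A mA (finA be beU).
rewrite -alE -beE lee_fin; apply/ler_addgt0Pr => e e0.
have e20 : 0 < e / 2 by lra.
have [_ /(_ _ e20)[p [ps p01] pd]] := measurable_approximable mU alU beU N0 mA.
have [chi [cs c01 csupp clim]] := box_approx a b N0.
have [m cd] := region_dist_smooth_limit mU alU beU cs c01 mU clim e20.
(* The approximant [p] of the indicator of [A] has no support restriction; the cut-off [chi m]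
   confines it to the box, hence to a compact subset of [O]. *)
pose q x := p x * chi m x.
have qs : smooth2 q by exact: smooth2_mul.
have q0 x : 0 <= q x.
  by have /andP[? _] := p01 x; have /andP[? _] := c01 m x; exact: mulr_ge0.
have q1 x : `|q x| <= 1.
  have /andP[? ?] := p01 x; have /andP[? ?] := c01 m x.
  by rewrite ger0_norm// mulr_ile1.
have qb x : q x != 0 -> inner O r B x.
  by rewrite mulf_eq0 negb_or => /andP[_ /csupp]; exact: bi.
have qsupp : supported O q by exists r, B.
have mq := measurable_smooth2 qs.
have qal : itg al q by exact: itg_radon al_radon mq q1 r0 qb.
have qbe : itg be q by exact: itg_radon be_radon mq q1 r0 qb.
pose w x : R := `|q x - \1_A x|.
have wal : itg al w by apply: itg_abs; exact: itgB.
have wbe : itg be w by apply: itg_abs; exact: itgB.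
have h1 : I al (\1_A) <= I al q + I al w.
  rewrite -I_D//; apply: I_le => //; first exact: itgD.
  by move=> x; rewrite /w; have := ler_norm (- (q x - \1_A x)); rewrite normrN; lra.
have h2 : I be q <= I be (\1_A) + I be w.
  rewrite -I_D//; apply: I_le => //; first exact: itgD.
  by move=> x; rewrite /w; have := ler_norm (q x - \1_A x); lra.
have h3 : I al w + I be w <= e.
  have wE (mu : {measure set (BorelRV R N) -> \bar R}) :
      I mu w = I mu (fun x => `|q x - \1_A x| * \1_(box a b) x).
    apply: eq_I => x; rewrite [\1_(box a b) x]indicE.
    have [|xb] := boolP (x \in box a b); first by rewrite mulr1.
    have nb : ~ box a b x by move/mem_set; exact/negP.
    rewrite /w /q indicE memNset; last by move/Ab.
    suff -> : chi m x = 0 by rewrite !mulr0 subrr normr0.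
    by apply/eqP; apply: contra_notT nb => /csupp.
  rewrite (splitr e) !wE; apply: le_trans (lerD pd cd).
  exact: (region_dist_mul mU alU beU ps (cs m) p01 (c01 m) mA).
have := al_le_be qs qsupp q0; lra.
Qed.

(** The measures may be infinite on [O], so [A] is cut into countably many disjoint pieces, each
    inside a box, and the inequalities are summed. *)
Lemma tests_measure_le (A : set (BorelRV R N)) : al (~` O) = 0%E -> measurable A ->
  (al A <= be A)%E.
Proof.
move=> alO mA; have [a [b [OE inn]]] := open_box_cover N0 oO.
have mO : measurable (O : set (BorelRV R N)) by exact: open_measurable_rV.
pose F n := box (a n) (b n) : set (BorelRV R N).
have mF n : measurable (F n) by exact: measurable_box.
have mS n : measurable (seqDU F n).
  by apply: measurableD => //; apply: bigsetU_measurable.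
have AOE : A `&` O = \bigcup_n (A `&` seqDU F n).
  by rewrite -setI_bigcupr -seqDU_bigcup_eq -OE.
have mAS n : measurable (A `&` seqDU F n) by exact: measurableI.
have tAS : trivIset setT (fun n => A `&` seqDU F n).
  by apply: trivIset_setIl; exact: trivIset_seqDU.
have mAO : measurable (A `&` O) by exact: measurableI.
apply: (@le_trans _ _ (al (A `&` O))).
  rewrite (measureDI al mA mO) [X in (X + _)%E](_ : _ = 0%E) ?add0e//.
  apply: subset_measure0 alO => [||x []//]; [exact: measurableD|exact: measurableC].
apply: (@le_trans _ _ (be (A `&` O))); last by apply: le_measure; rewrite ?inE.
rewrite AOE in mAO *; rewrite !measure_semi_bigcup//.
apply: lee_nneseries => // n _; have [r [B [r0 bi]]] := inn n.
by apply: (box_measure_le r0 bi (mAS n)) => x [_ []].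
Qed.

End Density.

(** * Reduced measures *)

Section ReducedMeasures.
Context {R : realType} {N : nat}.
Variable M : {sigma_finite_measure set (BorelRV R (N + 1)) -> \bar R}.
Hypothesis M_nice : nice M.
Hypothesis M_intQ : represents_intQ M.
Variables (O : set 'rV[R]_N) (T : R) (g : R -> R).
Hypothesis N0 : (0 < N)%N.
Hypothesis O_dom : bounded_domain O.
Hypothesis T0 : 0 < T.
Hypothesis g_adm : admissible g.
Implicit Types (mu mus : {measure set (BorelRV R N) -> \bar R}) (p : 'rV[R]_N -> R).

Let G : set 'rV[R]_(N + 1) := cylinder O T.

Definition approximation mu mus (h : nat -> R -> R) (V : nat -> 'rV[R]_(N + 1) -> R)
    (v : 'rV[R]_(N + 1) -> R) :=
  [/\ forall k, admissible (h k), forall k s, h k s <= h k.+1 s,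
      forall s, (fun k => h k s) @ \oo --> g s &
  [/\ forall k, solves M G (h k) mu (V k), solves M G g mus v,
      (fun k => I M (fun z => `|V k z - v z|)) @ \oo --> (0 : R) &
      forall z : 'rV[R]_(N + 1), z ord0 (rshift N ord0) <= 0 -> v z = 0]].

Lemma reduced_measure_approximation mu mus : M1plus O mu -> reduced_measure O T g mu mus ->
  exists h V v, approximation mu mus h V v.
Proof.
move=> muO [musO [h [_ [uk [us [_ [ha [_ [hnd [hcvg [uks [L1 uss]]]]]]]]]]]].
have Oo : open O by case: O_dom.
have Vs k := weak_sol_solves M_intQ N0 O_dom (ha k) muO (uks k).
have vs := weak_sol_solves M_intQ N0 O_dom g_adm musO uss.
exists h, (fun k => lift_slab O T (uk k)), (lift_slab O T us); do 2!split => //.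
- pose F k z := `|lift_slab O T (uk k) z - lift_slab O T us z|.
  have Fi k : itg M (F k).
    by apply: itg_abs; apply: itgB; [case: (Vs k)|case: vs].
  have F0 k z : ~ slab O T z -> F k z = 0.
    by move=> nz; rewrite /F !lift_slab_out// subrr normr0.
  suff /fine_cvgP[_ //] : (fun k => (I M (F k))%:E) @ \oo --> (0 : R)%:E.
  have -> : (fun k => (I M (F k))%:E) = fun k => intQ O T (fun x t => `|uk k x t - us x t|%:E).
    apply/funext => k; rewrite -(intQ_I M_intQ Oo (Fi k) (@F0 k)).
    by apply: eq_intQ => x t Ox tT; rewrite /F !lift_slab_in.
  exact: L1.
- move=> z z0; apply: lift_slab_out => -[_ /andP[]].
  by rewrite ltNge z0.
Qed.

Lemma measure_le_trace_le mu mu' : M1plus O mu -> M1plus O mu' ->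
  (forall A : set (BorelRV R N), measurable A -> (mu A <= mu' A)%E) -> trace_le G mu mu'.
Proof.
move=> muO mu'O le f d1 d2 [_ _ cf _ _] fs f0.
have i := itg_trace muO cf fs; have i' := itg_trace mu'O cf fs.
rewrite -lee_fin -!itgE//; apply: ge0_le_measure_integral => //.
  by move=> x; rewrite lee_fin.
exact: (measurable_int mu i).
Qed.

Lemma M1plus_radon mu : M1plus O mu ->
  forall K : set 'rV[R]_N, compact K -> K `<=` O -> (mu K < +oo)%E.
Proof. by case=> _ []. Qed.

Section TwoMeasures.
Variables (mu1 mu2 mu1s mu2s : {measure set (BorelRV R N) -> \bar R}).
Hypothesis mu1O : M1plus O mu1.
Hypothesis mu2O : M1plus O mu2.
Hypothesis mu12 : forall A : set (BorelRV R N), measurable A -> (mu1 A <= mu2 A)%E.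
Hypothesis red1 : reduced_measure O T g mu1 mu1s.
Hypothesis red2 : reduced_measure O T g mu2 mu2s.

(** The first bound tests [v1] against the approximations of [v2] with [D = 0]; the second tests the
    approximations of [v1] against those of [v2], where the original data leave the difference
    [mu2 - mu1] as [D]. *)
Lemma reduced_measure_tests p : smooth2 p -> supported O p -> (forall x, 0 <= p x) ->
  I mu1s p - I mu2s p <= 0 /\ I mu2s p - I mu1s p <= I mu2 p - I mu1 p.
Proof.
move=> ps psupp p0; have tr12 := measure_le_trace_le mu1O mu2O mu12.
have [h1 [V1 [v1 [h1a h1nd h1cvg [V1s v1s V1cvg v1out]]]]] :=
  reduced_measure_approximation mu1O red1.
have [h2 [V2 [v2 [h2a h2nd h2cvg [V2s v2s V2cvg v2out]]]]] :=
  reduced_measure_approximation mu2O red2.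
split.
  apply: (trace_difference_le T0 g_adm v2s v1s _ ps psupp p0) => [z z0|f d1 d2 fC2 fs f0 _].
    by split; [exact: v2out|exact: v1out].
  apply: (solution_below M_nice g_adm h2a h2nd h2cvg V2s v2s V2cvg g_adm v1s _ fC2 fs f0) => //.
  (* The datum of [v1] lies below that of [V2]: [mu1s] is at most [mu1] on test functions, and [mu1]
     at most [mu2]. *)
  move=> xi e1 e2 xiC2 xis xi0; apply: le_trans (tr12 _ _ _ xiC2 xis xi0).
  exact: (reduced_trace_le g_adm h1a h1nd h1cvg V1s v1s V1cvg xiC2 xis xi0).
apply: (trace_difference_le T0 g_adm v1s v2s _ ps psupp p0) => [z z0|f d1 d2 fC2 fs f0 fp].
  by split; [exact: v1out|exact: v2out].
have [v1i _ _] := v1s; have [v2i _ _] := v2s.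
have V1i k : itg M (V1 k) by case: (V1s k).
have [mH [C HC]] := heat_test fC2 fs.
have lim : (fun k => I M (fun z => pospart (v2 z - V1 k z) * heat (-1) d1 d2 z)) @ \oo -->
    I M (fun z => pospart (v2 z - v1 z) * heat (-1) d1 d2 z).
  apply: (@pospart_L1_cvg _ _ M (fun k z => v2 z - V1 k z) V1 (fun z => v2 z - v1 z) v1
    (heat (-1) d1 d2) C (fun k => itgB v2i (V1i k)) (itgB v2i v1i) V1i v1i _ V1cvg mH HC) => k z.
  rewrite distrC; congr `|_|; ring.
(* The index of the first sequence moves last: [solution_above] has already replaced the second
   sequence by its limit [v2], and it relies on [h1 k <= g]. *)
apply: (ler_cvg_to lim (cvg_cst _)); apply: nearW => k.
have := solution_above M_nice g_adm h2a h2nd h2cvg V2s v2s V2cvg (h1a k)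
  (h_le h1nd h1cvg k) (V1s k) tr12 fC2 fs f0.
have trE (mu : {measure set (BorelRV R N) -> \bar R}) :
    I mu (fun x => f (spacetime x 0)) = I mu p by apply: eq_I => x; exact: fp.
by rewrite !trE.
Qed.

(** The second inequality is handled as an order between the measures [mu2s + mu1] and [mu2 + mu1s],
    so no difference of possibly infinite values occurs and [tests_measure_le] covers both
    conclusions. *)
Lemma reduced_measure_le (A : set (BorelRV R N)) : measurable A ->
  (mu1s A <= mu2s A)%E /\ (mu2s A + mu1 A <= mu2 A + mu1s A)%E.
Proof.
move=> mA; have Oo : open O by case: O_dom.
have [mu1sO _] := red1; have [mu2sO _] := red2.
have r1 := M1plus_radon mu1O; have r2 := M1plus_radon mu2O.
have r1s := M1plus_radon mu1sO; have r2s := M1plus_radon mu2sO.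
split.
  apply: (tests_measure_le N0 Oo r1s r2s) => //; last by case: mu1sO.
  by move=> p ps psupp p0; have [? _] := reduced_measure_tests ps psupp p0; rewrite -subr_le0.
rewrite -!measure_addE; apply: (tests_measure_le N0 Oo) => //.
- by move=> K cK KO; rewrite -[X in (X < _)%E]/(measure_add mu2s mu1 K) measure_addE lte_add_pinfty ?r2s ?r1.
- by move=> K cK KO; rewrite -[X in (X < _)%E]/(measure_add mu2 mu1s K) measure_addE lte_add_pinfty ?r2 ?r1s.
- move=> p ps psupp p0; have [_] := reduced_measure_tests ps psupp p0.
  have [p1 [p2 pC2]] := ps; have [_ _ cp _ _] := pC2.
  have [r [B [C [r0 pi _ _ [pC _ _]]]]] := supported_C2 pC2 psupp.
  have mp := measurable_smooth2 ps.
  have i (mu : {measure set (BorelRV R N) -> \bar R}) : M1plus O mu -> itg mu p.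
    by move=> /M1plus_radon muO; exact: itg_radon muO mp pC r0 pi.
  have addE (mu mu' : {measure set (BorelRV R N) -> \bar R}) : itg mu p -> itg mu' p ->
      I (measure_add mu mu') p = I mu p + I mu' p.
    move=> ip ip'; rewrite /I /Rintegral integral_measure_add// fineD//;
      exact: integrable_fin_num.
  by rewrite !addE; [lra|exact: i..].
- have [mu2s0 _] := mu2sO; have [mu10 _] := mu1O.
  by rewrite -[LHS]/(measure_add mu2s mu1 (~` O)) measure_addE mu2s0 mu10 adde0.
Qed.

End TwoMeasures.
End ReducedMeasures.

Theorem theorem2p17 (R : realType) (N : nat) (O : set 'rV[R]_N) (T : R)
    (g : R -> R) (mu1 mu2 mu1s mu2s : {measure set (BorelRV R N) -> \bar R}) :
  (0 < N)%N -> bounded_domain O -> 0 < T -> admissible g ->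
  M1plus O mu1 -> M1plus O mu2 ->
  (forall A : set (BorelRV R N), measurable A -> (mu1 A <= mu2 A)%E) ->
  reduced_measure O T g mu1 mu1s -> reduced_measure O T g mu2 mu2s ->
  (forall A : set (BorelRV R N), measurable A -> (mu1s A <= mu2s A)%E) /\
  (forall A : set (BorelRV R N), measurable A ->
     (mu2s A + mu1 A <= mu2 A + mu1s A)%E).
Proof.
move=> N0 dO T0 ga mu1O mu2O mu12 red1 red2.
have [M [M_nice M_intQ]] := @nice_intQ_exists R N.
have main := reduced_measure_le M_nice M_intQ N0 dO T0 ga mu1O mu2O mu12 red1 red2.
by split => A /main[].
Qed.
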